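(* Let $(M,e,\mathbf{m})$ be a Lie rack, with $\mathbf{m}(x,y)=x\triangleright y$. The associated coalgebra $F(M)=\mathcal{E}'_e(M)$ with multiplication $\mu=\mathbf{m}_*\circ F_{2~M,M}$ is a rack bialgebra; i.e., writing $a\triangleright b$ for $\mu(a\otimes b)$, for all $a,b,c\in F(M)$: $$\mathbf{1}\triangleright a=a,\qquad a\triangleright\mathbf{1}=\epsilon(a)\mathbf{1},\qquad a\triangleright(b\triangleright c)=\sum_{(a)}(a^{(1)}\triangleright b)\triangleright(a^{(2)}\triangleright c).$$
   Context: $\mathbb{K}$ denotes $\mathbb{R}$ or $\mathbb{C}$; manifolds are Hausdorff and second countable. A Lie rack $(M,e,\mathbf{m})$ is a smooth manifold $M$ with a point $e\in M$ and a smooth map $\mathbf{m}:M\times M\to M$, $\mathbf{m}(x,y)=x\triangleright y$, such that $e\triangleright x=x$, $x\triangleright e=e$, $x\triangleright(y\triangleright z)=(x\triangleright y)\triangleright(x\triangleright z)$ for all $x,y,z$, and each left multiplication $y\mapsto x\triangleright y$ is a diffeomorphism. For a pointed manifold $(M,e)$, $F(M)=\mathcal{E}'_e(M)$ is the $\mathbb{K}$-vector space of continuous linear maps $T:\mathcal{C}^\infty(M,\mathbb{K})\to\mathbb{K}$ (distributions) supported in $\{e\}$; for a smooth pointed map $\varphi$, $(\varphi_*T)(f)=T(f\circ\varphi)$. There are natural linear isomorphisms $F_{2~M,N}:\mathcal{E}'_{e_1}(M)\otimes\mathcal{E}'_{e_2}(N)\to\mathcal{E}'_{(e_1,e_2)}(M\times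 N)$, $F_{2~M,N}(S\otimes T)(f)=S\big(x\mapsto T(f(x,\cdot))\big)$. $\mathcal{E}'_e(M)$ is a coalgebra with comultiplication $\Delta_e=F_{2~M,M}^{-1}\circ(\mathrm{diag}_M)_*$ ($\mathrm{diag}_M(x)=(x,x)$), counit $\epsilon(T)=T(1)$, and coaugmentation $\mathbf{1}=\delta_e$; Sweedler notation $\Delta(a)=\sum_{(a)}a^{(1)}\otimes a^{(2)}$ is used. A rack bialgebra is a coassociative, counital coalgebra $B$ with an element $\mathbf{1}$ satisfying $\Delta(\mathbf{1})=\mathbf{1}\otimes\mathbf{1}$, $\epsilon(\mathbf{1})=1$, and with a multiplication $\mu:B\otimes B\to B$ that is a morphism of coalgebras, preserves counits and sends $\mathbf{1}\otimes\mathbf{1}$ to $\mathbf{1}$, such that the three displayed identities hold. *)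

(* Defs.v *)
From HB Require Import structures.
From mathcomp Require Import all_boot all_order all_algebra generic_quotient sesquilinear.
From mathcomp Require Import complex.
From mathcomp Require Import all_classical all_reals all_analysis.

Set Implicit Arguments.
Unset Strict Implicit.
Unset Printing Implicit Defensive.

Import Order.TTheory GRing.Theory Num.Theory.
Import numFieldNormedType.Exports.

Local Open Scope classical_set_scope.
Local Open Scope ring_scope.
Local Open Scope quotient_scope.

(* Tensor product of two vector spaces: formal sums of pairs (v, w), two of
   them being identified when every bilinear map takes the same value on them.
   The universal property is tens_bilinear, tens_liftE, tens_lift_linear and
   tensorE. *)
Section Tensor.
Variables (K : fieldType) (V W : lmodType K).

Definition eval_sum (U : lmodType K) (f : V -> W -> U) (s : seq (V * W)) : U :=
  \sum_(p <- s) f p.1 p.2.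

Definition tensor_eq (s t : seq (V * W)) : Prop :=
  forall (U : lmodType K) (f : {bilinear V -> W -> U}),
    eval_sum f s = eval_sum f t.

Definition tensor_eqb (s t : seq (V * W)) : bool := `[< tensor_eq s t >].

Fact tensor_eqb_refl : reflexive tensor_eqb.
Proof. by move=> s; apply/asboolP. Qed.

Fact tensor_eqb_sym : symmetric tensor_eqb.
Proof. by move=> s t; apply/asboolP/asboolP => st U f; rewrite st. Qed.

Fact tensor_eqb_trans : transitive tensor_eqb.
Proof.
by move=> t s u /asboolP st /asboolP tu; apply/asboolP => U f; rewrite st tu.
Qed.

Canonical tensor_equiv :=
  EquivRel tensor_eqb tensor_eqb_refl tensor_eqb_sym tensor_eqb_trans.

Definition tensor : Type := {eq_quot tensor_equiv}.

HB.instance Definition _ := Choice.on tensor.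
HB.instance Definition _ := EqQuotient.on tensor.

Definition tens_sum (s : seq (V * W)) : tensor := \pi_tensor s.

Lemma tens_sumP (s t : seq (V * W)) : tens_sum s = tens_sum t <-> tensor_eq s t.
Proof. by split=> [/eqmodP/asboolP//|st]; apply/eqmodP/asboolP. Qed.

Lemma tens_sum_repr (x : tensor) : tens_sum (repr x) = x.
Proof. exact: reprK. Qed.

Lemma eval_sum_repr (U : lmodType K) (f : {bilinear V -> W -> U}) s :
  eval_sum f (repr (tens_sum s)) = eval_sum f s.
Proof. by have /tens_sumP := tens_sum_repr (tens_sum s). Qed.

Definition tscale (a : K) (s : seq (V * W)) := [seq (a *: p.1, p.2) | p <- s].

Definition tens0 : tensor := tens_sum [::].
Definition tens_add (x y : tensor) : tensor := tens_sum (repr x ++ repr y).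
Definition tens_scale (a : K) (x : tensor) : tensor := tens_sum (tscale a (repr x)).
Definition tens_opp (x : tensor) : tensor := tens_scale (-1) x.

Lemma eval_sum_cat (U : lmodType K) (f : V -> W -> U) s t :
  eval_sum f (s ++ t) = eval_sum f s + eval_sum f t.
Proof. exact: big_cat. Qed.

Lemma eval_sum_scale (U : lmodType K) (f : {bilinear V -> W -> U}) a s :
  eval_sum f (tscale a s) = a *: eval_sum f s.
Proof.
by rewrite /eval_sum big_map scaler_sumr; apply: eq_bigr => p _; rewrite linearZl_LR.
Qed.

Let evalE := (eval_sum_repr, eval_sum_cat, eval_sum_scale).

Lemma tens_eqP (x y : tensor) :
  (forall (U : lmodType K) (f : {bilinear V -> W -> U}),
    eval_sum f (repr x) = eval_sum f (repr y)) <-> x = y.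
Proof.
by split=> [xy|-> //]; rewrite -[x]tens_sum_repr -[y]tens_sum_repr; apply/tens_sumP.
Qed.

Fact tens_addA : associative tens_add.
Proof. by move=> x y z; apply/tens_eqP => U f; rewrite !evalE addrA. Qed.
Fact tens_addC : commutative tens_add.
Proof. by move=> x y; apply/tens_eqP => U f; rewrite !evalE addrC. Qed.
Fact tens_add0 : left_id tens0 tens_add.
Proof.
by move=> x; apply/tens_eqP => U f; rewrite !evalE /eval_sum big_nil add0r.
Qed.
Fact tens_addN : left_inverse tens0 tens_opp tens_add.
Proof.
move=> x; apply/tens_eqP => U f.
by rewrite !evalE {3}/eval_sum big_nil scaleN1r addNr.
Qed.

HB.instance Definition _ :=
  GRing.isZmodule.Build tensor tens_addA tens_addC tens_add0 tens_addN.

Fact tens_scaleA a b x : tens_scale a (tens_scale b x) = tens_scale (a * b) x.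
Proof. by apply/tens_eqP => U f; rewrite !evalE scalerA. Qed.
Fact tens_scale1 : left_id 1 tens_scale.
Proof. by move=> x; apply/tens_eqP => U f; rewrite !evalE scale1r. Qed.
Fact tens_scaleDr : right_distributive tens_scale +%R.
Proof. by move=> a x y; apply/tens_eqP => U f; rewrite !evalE scalerDr. Qed.
Fact tens_scaleDl x : {morph tens_scale^~ x : a b / a + b}.
Proof. by move=> a b; apply/tens_eqP => U f; rewrite !evalE scalerDl. Qed.

HB.instance Definition _ := GRing.Zmodule_isLmodule.Build K tensor
  tens_scaleA tens_scale1 tens_scaleDr tens_scaleDl.

Definition tens (v : V) (w : W) : tensor := tens_sum [:: (v, w)].

(* The linear map on the tensor product induced by f, computed on a chosen
   representative so that no proof that f is bilinear has to be supplied.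
   It is the expected map, whatever the representative, only if f is bilinear.
   For x = Delta a, tens_lift f x is the Sweedler sum of f a^(1) a^(2). *)
Definition tens_lift (U : lmodType K) (f : V -> W -> U) (x : tensor) : U :=
  eval_sum f (repr x).

Lemma tens_liftE (U : lmodType K) (f : {bilinear V -> W -> U}) v w :
  tens_lift f (tens v w) = f v w.
Proof. by rewrite /tens_lift eval_sum_repr /eval_sum big_seq1. Qed.

Lemma tens_lift_linear (U : lmodType K) (f : {bilinear V -> W -> U}) :
  linear (tens_lift f).
Proof. by move=> a x y; rewrite /tens_lift !evalE. Qed.

Lemma tens_bilinear : bilinear_for *:%R *:%R tens.
Proof.
split=> [w a v v'|v a w w']; apply/tens_eqP => U f;
  rewrite !evalE /eval_sum !big_seq1 /=.
  by rewrite linearPl.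
by rewrite linearPr.
Qed.

HB.instance Definition _ :=
  bilinear_isBilinear.Build K V W tensor *:%R *:%R tens tens_bilinear.

Lemma tensorE (x : tensor) : x = \sum_(p <- repr x) tens p.1 p.2.
Proof.
rewrite -[LHS]tens_sum_repr; elim: (repr x) => [|[v w] s IHs] /=.
  by rewrite big_nil.
rewrite big_cons -IHs; apply/tens_eqP => U f.
by rewrite !evalE /eval_sum big_cons big_seq1.
Qed.

End Tensor.

Section SmoothOn.
Variable R : realType.
Implicit Types n : nat.

Definition basis_vec n (i : 'I_n) : 'rV[R]_n := delta_mx 0 i.

Fixpoint partials n (s : seq 'I_n) (f : 'rV[R]_n -> R) : 'rV[R]_n -> R :=
  if s is i :: s' then 'D_(basis_vec i) (partials s' f) else f.

(* Meant for open U: on U, all iterated partial derivatives of f exist and are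
   continuous. *)
Definition smooth_on n (U : set 'rV[R]_n) (f : 'rV[R]_n -> R) : Prop :=
  forall (s : seq 'I_n) (x : 'rV[R]_n), U x ->
    {for x, continuous (partials s f)} /\
    forall i, derivable (partials s f) x (basis_vec i).

Definition smooth_map_on m n (U : set 'rV[R]_m) (f : 'rV[R]_m -> 'rV[R]_n) : Prop :=
  forall j, smooth_on U (fun x => f x 0 j).

Lemma partials_lincomb n (U : set 'rV[R]_n) (a b : R) f g s : open U ->
  smooth_on U f -> smooth_on U g ->
  {in U, partials s (fun x => a * f x + b * g x) =1
         (fun x => a * partials s f x + b * partials s g x)}.
Proof.
move=> oU sf sg; elim: s => [//|i s IHs] x /set_mem Ux /=.
have [_ /(_ i) df] := sf s x Ux; have [_ /(_ i) dg] := sg s x Ux.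
rewrite (@near_eq_derive _ _ _ _ (a *: partials s f + b *: partials s g)).
  by rewrite deriveD ?deriveZ//; apply: derivableZ.
by near=> y; rewrite IHs//; apply/mem_set; near: y; exact: open_nbhs_nbhs.
Unshelve. all: by end_near. Qed.

Lemma smooth_on_lincomb n (U : set 'rV[R]_n) (a b : R) f g : open U ->
  smooth_on U f -> smooth_on U g -> smooth_on U (fun x => a * f x + b * g x).
Proof.
move=> oU sf sg s x Ux.
have [cf df] := sf s x Ux; have [cg dg] := sg s x Ux.
have E : \near x, a * partials s f x + b * partials s g x =
    partials s (fun x => a * f x + b * g x) x.
  near=> y; rewrite (partials_lincomb _ _ _ oU sf sg)//; apply/mem_set; near: y.
  exact: open_nbhs_nbhs.
split=> [|i].
  rewrite /prop_for /continuous_at -(nbhs_singleton E).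
  apply: cvg_trans (near_eq_cvg E) _.
  by apply: cvgD; apply: cvgM => //; exact: cvg_cst.
apply: near_eq_derivable E _.
by apply: (@derivableD _ _ _ (a *: partials s f) (b *: partials s g)); apply: derivableZ.
Unshelve. all: by end_near. Qed.

Lemma diff_quotient_comp m n (L : {linear 'rV[R]_m -> 'rV[R]_n})
    (g : 'rV[R]_n -> R) x v :
  (fun h : R => h^-1 *: ((g \o L \o shift x) (h *: v) - (g \o L) x)) =
  (fun h : R => h^-1 *: ((g \o shift (L x)) (h *: L v) - g (L x))).
Proof. by apply/funext => h; rewrite /= (linearP L). Qed.

Lemma partials_comp m n (L : {linear 'rV[R]_m -> 'rV[R]_n}) (f : 'rV[R]_n -> R) s :
  (forall i, L (basis_vec i) = 0 \/ exists j, L (basis_vec i) = basis_vec j) ->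
  (exists s', partials s (f \o L) = partials s' f \o L) \/
  partials s (f \o L) = cst 0.
Proof.
move=> hL; elim: s => [|i s [[s' E]|E]] /=; first by left; exists [::].
- rewrite E; have [L0|[j Lj]] := hL i; [right|left; exists (j :: s')];
    apply/funext => x; rewrite /derive diff_quotient_comp.
    by rewrite L0; exact: derive0.
  by rewrite Lj.
- by right; rewrite E; apply/funext => x; rewrite derive_cst.
Qed.

Lemma smooth_on_comp_coord m n (L : {linear 'rV[R]_m -> 'rV[R]_n}) U
    (f : 'rV[R]_n -> R) : continuous L ->
  (forall i, L (basis_vec i) = 0 \/ exists j, L (basis_vec i) = basis_vec j) ->
  smooth_on U f -> smooth_on (L @^-1` U) (f \o L).
Proof.
move=> cL hL sf s x ULx.
have [[s' ->]|->] := partials_comp f s hL; last first.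
  by split=> [|i]; [exact: cst_continuous|exact: derivable_cst].
have [cf df] := sf s' _ ULx; split=> [|i]; last first.
  rewrite /derivable diff_quotient_comp.
  by have [->|[j ->]] := hL i; [exact: derivable0|exact: df].
exact: (@continuous_comp _ _ _ L (partials s' f) x (cL x) cf).
Qed.

Lemma smooth_onS n (U V : set 'rV[R]_n) f : V `<=` U -> smooth_on U f -> smooth_on V f.
Proof. by move=> VU sf s x /VU Ux; exact: sf. Qed.

End SmoothOn.

(* chart_inv is a total function; its values outside chart_img are irrelevant. *)
Record chart (R : realType) (n : nat) (M : topologicalType) := Chart {
  chart_dom : set M;
  chart_map : M -> 'rV[R]_n;
  chart_inv : 'rV[R]_n -> M;
  chart_dom_open : open chart_dom;
  chart_img_open : open (chart_map @` chart_dom);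
  chart_mapK : forall x, chart_dom x -> chart_inv (chart_map x) = x;
  chart_map_continuous : forall x, chart_dom x -> {for x, continuous chart_map};
  chart_inv_continuous : forall u, (chart_map @` chart_dom) u ->
    {for u, continuous chart_inv}
}.

Definition chart_img R n M (c : chart R n M) := chart_map c @` chart_dom c.

Definition transition R n M (c d : chart R n M) : 'rV[R]_n -> 'rV[R]_n :=
  chart_map d \o chart_inv c.

(* Smooth structures are given by an atlas which need not be maximal: smooth
   maps and the topology of C^oo only depend on the maximal atlas it generates.
   The dimension is constant and may be 0. *)
Record manifold (R : realType) := Manifold {
  carrier :> topologicalType;
  mdim : nat;
  atlas : set (chart R mdim carrier);
  manifold_hausdorff : hausdorff_space carrier;
  manifold_second_countable : @second_countable carrier;
  atlas_cover : forall x : carrier, exists2 c, atlas c & chart_dom c x;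
  atlas_compatible : forall c d, atlas c -> atlas d ->
    smooth_map_on (chart_map c @` (chart_dom c `&` chart_dom d)) (transition c d)
}.

Arguments atlas {R} m _.

Section ProductManifold.
Variable R : realType.

Lemma eq_continuous_at (T U : topologicalType) (f g : T -> U) x :
  f =1 g -> {for x, continuous f} -> {for x, continuous g}.
Proof. by move=> /funext ->. Qed.

Lemma rV_continuous_at (T : topologicalType) n (f : T -> 'rV[R]_n) x :
  (forall j, {for x, continuous (fun y => f y 0 j)}) -> {for x, continuous f}.
Proof.
move=> fc A [P Px PA]; rewrite /nbhs/=.
apply: (@filterS _ _ _ [set y | forall j, P 0 j (f y 0 j)]).
  by move=> y /= Py; apply: PA => i j; rewrite (ord1 i).
apply: filter_forall => j; exact: fc (Px 0 j).
Qed.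

Lemma lsubmx_continuous m n : continuous (@lsubmx R 1 m n).
Proof.
move=> x; apply: rV_continuous_at => j.
by apply: eq_continuous_at (@coord_continuous _ _ _ 0 (lshift n j) x) => y; rewrite mxE.
Qed.

Lemma rsubmx_continuous m n : continuous (@rsubmx R 1 m n).
Proof.
move=> x; apply: rV_continuous_at => j.
by apply: eq_continuous_at (@coord_continuous _ _ _ 0 (rshift m j) x) => y; rewrite mxE.
Qed.

Lemma lsubmx_basis_vec m n (i : 'I_(m + n)) :
  lsubmx (basis_vec R i) = 0 \/ exists j, lsubmx (basis_vec R i) = basis_vec R j.
Proof.
case: (split_ordP i) => j ->.
  right; exists j; apply/rowP => k.
  by rewrite !mxE eqxx /= (inj_eq (@lshift_inj _ _)).
by left; apply/rowP => k; rewrite !mxE eqxx /= eq_lrshift.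
Qed.

Lemma rsubmx_basis_vec m n (i : 'I_(m + n)) :
  rsubmx (basis_vec R i) = 0 \/ exists j, rsubmx (basis_vec R i) = basis_vec R j.
Proof.
case: (split_ordP i) => j ->.
  by left; apply/rowP => k; rewrite !mxE eqxx /= eq_rlshift.
right; exists j; apply/rowP => k.
by rewrite !mxE eqxx /= (inj_eq (@rshift_inj _ _)).
Qed.

Lemma openX (T U : topologicalType) (A : set T) (B : set U) :
  open A -> open B -> open (A `*` B).
Proof.
rewrite !openE => oA oB [x y] [/= Ax By].
by exists (A, B) => [|[] //]; split; [exact: oA|exact: oB].
Qed.

Section ProdChart.
Variables (m n : nat) (M N : topologicalType) (c : chart R m M) (d : chart R n N).

Definition prod_map (p : M * N) : 'rV[R]_(m + n) :=
  row_mx (chart_map c p.1) (chart_map d p.2).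
Definition prod_inv (u : 'rV[R]_(m + n)) : M * N :=
  (chart_inv c (lsubmx u), chart_inv d (rsubmx u)).
Let dom := chart_dom c `*` chart_dom d.

Lemma prod_img_sub (A : set M) (B : set N) :
  prod_map @` (A `*` B) =
  (lsubmx @^-1` (chart_map c @` A)) `&` (rsubmx @^-1` (chart_map d @` B)).
Proof.
apply/seteqP; split=> [_ [[x y] [/= Ax By] <-]|u [[x Ax xu] [y By yu]]].
  by rewrite /prod_map; split; [exists x|exists y] => //; rewrite ?row_mxKl ?row_mxKr.
by exists (x, y) => //; rewrite /prod_map /= xu yu hsubmxK.
Qed.

Fact prod_img_open : open (prod_map @` dom).
Proof.
rewrite prod_img_sub; apply: openI; apply: open_comp.
- by move=> u _; exact: lsubmx_continuous.
- exact: chart_img_open.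
- by move=> u _; exact: rsubmx_continuous.
- exact: chart_img_open.
Qed.

Fact prod_mapK p : dom p -> prod_inv (prod_map p) = p.
Proof.
by case: p => x y [/= cx dy]; rewrite /prod_inv row_mxKl row_mxKr !chart_mapK.
Qed.

Fact prod_map_continuous p : dom p -> {for p, continuous prod_map}.
Proof.
case: p => x y [/= cx dy]; apply: rV_continuous_at => j.
case: (split_ordP j) => k ->.
  apply: (@eq_continuous_at _ _ (fun p : M * N => chart_map c p.1 0 k)).
    by move=> p; rewrite row_mxEl.
  apply: (@continuous_comp _ _ _ (fun p : M * N => chart_map c p.1)
    (fun u => u 0 k)); last exact: coord_continuous.
  apply: (@continuous_comp _ _ _ fst (chart_map c)); first exact: cvg_fst.
  exact: chart_map_continuous.
apply: (@eq_continuous_at _ _ (fun p : M * N => chart_map d p.2 0 k)).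
  by move=> p; rewrite row_mxEr.
apply: (@continuous_comp _ _ _ (fun p : M * N => chart_map d p.2)
  (fun u => u 0 k)); last exact: coord_continuous.
apply: (@continuous_comp _ _ _ snd (chart_map d)); first exact: cvg_snd.
exact: chart_map_continuous.
Qed.

Fact prod_inv_continuous u : (prod_map @` dom) u -> {for u, continuous prod_inv}.
Proof.
rewrite prod_img_sub => -[cu du].
have cL := @continuous_comp _ _ _ (@lsubmx R 1 m n) (chart_inv c) u
  (@lsubmx_continuous m n u) (chart_inv_continuous cu).
have cR := @continuous_comp _ _ _ (@rsubmx R 1 m n) (chart_inv d) u
  (@rsubmx_continuous m n u) (chart_inv_continuous du).
exact: cvg_pair cL cR.
Qed.

Definition prod_chart : chart R (m + n) (M * N)%type :=
  Chart (openX (chart_dom_open c) (chart_dom_open d)) prod_img_open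
    prod_mapK prod_map_continuous prod_inv_continuous.

End ProdChart.

Variables M N : manifold R.

Definition prod_atlas : set (chart R (mdim M + mdim N) (M * N)%type) :=
  [set prod_chart c d | c in atlas M & d in atlas N].

Fact prod_hausdorff : hausdorff_space (M * N)%type.
Proof.
move=> [x y] [x' y'] cl; congr pair.
  apply: manifold_hausdorff => A B nA nB.
  have [||[a b] [/= [Aa _] [Ba _]]] := cl (A `*` setT) (B `*` setT).
  - by exists (A, setT) => //; split=> //; exact: filterT.
  - by exists (B, setT) => //; split=> //; exact: filterT.
  by exists a.
apply: manifold_hausdorff => A B nA nB.
have [||[a b] [/= [_ Ab] [_ Bb]]] := cl (setT `*` A) (setT `*` B).
- by exists (setT, A) => //; split=> //; exact: filterT.
- by exists (setT, B) => //; split=> //; exact: filterT.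
by exists b.
Qed.

Fact prod_second_countable : @second_countable (M * N)%type.
Proof.
have [B cB [oB bB]] := @manifold_second_countable R M.
have [C cC [oC bC]] := @manifold_second_countable R N.
exists [set P.1 `*` P.2 | P in B `*` C].
  exact: (card_le_trans (card_image_le _ _) (countableX cB cC)).
split=> [_ [[U V] [/= BU CV] <-]|[x y] A [[P Q] [/= xP yQ] PQA]].
  by apply: openX; [exact: oB|exact: oC].
have [U [BU Ux] UP] := bB x P xP; have [V [CV Vy] VQ] := bC y Q yQ.
exists (U `*` V); first by split=> //; exists (U, V).
by move=> [a b] [/= Ua Vb]; apply: PQA; split; [exact: UP|exact: VQ].
Qed.

Fact prod_atlas_cover (p : M * N) : exists2 c, prod_atlas c & chart_dom c p.
Proof.
case: p => x y.
have [c Mc cx] := atlas_cover x; have [d Nd dy] := atlas_cover y.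
by exists (prod_chart c d) => //; exists c => //; exists d.
Qed.

Fact prod_atlas_compatible c d : prod_atlas c -> prod_atlas d ->
  smooth_map_on (chart_map c @` (chart_dom c `&` chart_dom d)) (transition c d).
Proof.
move=> [c1 Mc1 [c2 Nc2 <-]] [d1 Md1 [d2 Nd2 <-]] j.
have -> : chart_dom (prod_chart c1 c2) `&` chart_dom (prod_chart d1 d2) =
   (chart_dom c1 `&` chart_dom d1) `*` (chart_dom c2 `&` chart_dom d2).
  by apply/seteqP; split=> -[x y] /= [[? ?] [? ?]].
rewrite [chart_map _]/= prod_img_sub.
case: (split_ordP j) => k ->.
  have -> : (fun u => transition (prod_chart c1 c2) (prod_chart d1 d2) u 0 (lshift _ k))
     = (fun u => transition c1 d1 u 0 k) \o lsubmx.
    by apply/funext => u; rewrite /transition /= row_mxEl.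
  apply: smooth_onS (@subIsetl _ _ _) _.
  apply: smooth_on_comp_coord; [exact: lsubmx_continuous|exact: lsubmx_basis_vec|].
  exact: atlas_compatible.
have -> : (fun u => transition (prod_chart c1 c2) (prod_chart d1 d2) u 0 (rshift _ k))
   = (fun u => transition c2 d2 u 0 k) \o rsubmx.
  by apply/funext => u; rewrite /transition /= row_mxEr.
apply: smooth_onS (@subIsetr _ _ _) _.
apply: smooth_on_comp_coord; [exact: rsubmx_continuous|exact: rsubmx_basis_vec|].
exact: atlas_compatible.
Qed.

Definition prod_manifold : manifold R :=
  Manifold prod_hausdorff prod_second_countable prod_atlas_cover
    prod_atlas_compatible.

End ProductManifold.

(* real_or_complex R K says that K is one of the fields R and R[i], and
   component false, component true : K -> R are the real and imaginary parts. *)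
Inductive real_or_complex (R : realType) : numFieldType -> Type :=
| Real_scalars : real_or_complex R R
| Complex_scalars : real_or_complex R R[i].

Definition component (R : realType) (K : numFieldType) (k : real_or_complex R K)
    (im : bool) : K -> R :=
  match k in real_or_complex _ K return K -> R with
  | Real_scalars => fun x => if im then 0 else x
  | Complex_scalars => fun z => if im then complex.Im z else complex.Re z
  end.

Section SmoothFunctions.
Variables (R : realType) (K : numFieldType) (k : real_or_complex R K).
Variable M : manifold R.

Definition smooth_fun (f : M -> K) : Prop :=
  forall c, atlas M c -> forall im : bool,
    smooth_on (chart_img c) (component k im \o f \o chart_inv c).

Lemma component_lincomb (a : K) im : exists p q : R, forall x y,
  component k im (a * x + y) =
  p * component k false x + q * component k true x + component k im y.
Proof.
case: k a im => [a|[a1 a2]] []; rewrite /component.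
- by exists 0, 0 => x y; rewrite !mul0r !addr0.
- by exists a, 0 => x y; rewrite mul0r addr0.
- by exists a2, a1 => -[x1 x2] [y1 y2] /=; congr (_ + _); exact: addrC.
- by exists a1, (- a2) => -[x1 x2] [y1 y2] /=; rewrite mulNr.
Qed.

Definition smooth_pred : {pred M -> K^o} := fun f => `[< smooth_fun f >].

Fact smooth_submod_closed : submod_closed smooth_pred.
Proof.
split=> [|a f g /asboolP sf /asboolP sg]; apply/asboolP => c Mc im.
  have -> : component k im \o 0 \o chart_inv c = cst 0.
    by apply/funext => u /=; rewrite /component; case: k im => -[].
  move=> s x _; have -> : partials s (cst 0) = cst (0 : R) :> ('rV[R]_(mdim M) -> R).
    by elim: s => //= i s ->; apply/funext => u; rewrite derive_cst.
  by split=> [|i]; [exact: cst_continuous|exact: derivable_cst].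
have [p [q E]] := component_lincomb a im.
pose h := component k; pose i := chart_inv c.
have -> : h im \o (a *: f + g) \o i =
    (fun u => 1 * (p * (h false \o f \o i) u + q * (h true \o f \o i) u)
      + 1 * (h im \o g \o i) u).
  by apply/funext => u; rewrite !mul1r; exact: E.
have oc := @chart_img_open _ _ _ c.
apply: (smooth_on_lincomb _ _ oc); last exact: sg.
by apply: (smooth_on_lincomb _ _ oc); exact: sf.
Qed.

HB.instance Definition _ :=
  GRing.isSubmodClosed.Build K (M -> K^o) smooth_pred smooth_submod_closed.

Definition Cinf : Type := {f : M -> K^o | f \in smooth_pred}.
HB.instance Definition _ := [isSub of Cinf for @sval _ _].
HB.instance Definition _ := [Choice of Cinf by <:].
HB.instance Definition _ := [SubChoice_isSubLmodule of Cinf by <:].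

Definition Cinf_fun (f : Cinf) : M -> K := \val f.
Coercion Cinf_fun : Cinf >-> Funclass.

(* to_Cinf f is f seen as an element of C^oo(M, K) when f is smooth, and 0
   otherwise. *)
Definition to_Cinf (f : M -> K) : Cinf := insubd (0 : Cinf) (f : M -> K^o).

End SmoothFunctions.

(* C^oo(M, K) carries its usual Frechet topology, of uniform convergence on the
   compact subsets of the charts of all partial derivatives. *)
Section CinfTopology.
Variables (R : realType) (K : numFieldType) (k : real_or_complex R K).
Variable M : manifold R.
Local Notation n := (mdim M).

Definition compacts_in (c : chart R n M) : set (set 'rV[R]_n) :=
  [set L | compact L /\ L `<=` chart_img c].

Definition local_partials (c : chart R n M) (im : bool) (s : seq 'I_n)
    (f : Cinf k M) : {family compacts_in c, 'rV[R]_n -> R} :=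
  partials s (component k im \o f \o chart_inv c).

HB.instance Definition _ := Topological.copy (Cinf k M)
  (sup_topology (fun i : {c | atlas M c} * bool * seq 'I_n =>
    Topological.class
      (initial_topology (local_partials (sval i.1.1) i.1.2 i.2)))).

Definition vanishes_on (U : set M) (T : Cinf k M -> K^o) : Prop :=
  forall f : Cinf k M, compact (closure [set x | f x != 0]) ->
    closure [set x | f x != 0] `<=` U -> T f = 0.

Definition dist_support (T : Cinf k M -> K^o) : set M :=
  [set x | forall U, open U -> U x -> ~ vanishes_on U T].

Definition dist_at_pred (e : M) : {pred Cinf k M -> K^o} := fun T =>
  `[< [/\ linear T, continuous T & dist_support T `<=` [set e]] >].

Lemma notin_dist_support T x : ~ dist_support T x ->
  exists U, [/\ open U, U x & vanishes_on U T].
Proof.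
by move=> /existsNP[U /not_implyP[oU /not_implyP[Ux /contrapT vU]]]; exists U.
Qed.

Fact dist_at_submod_closed e : submod_closed (dist_at_pred e).
Proof.
split=> [|a S T /asboolP[lS cS sS] /asboolP[lT cT sT]]; apply/asboolP; split.
- by move=> a f g /=; rewrite scaler0 addr0.
- exact: cst_continuous.
- by move=> x /(_ setT openT I)[].
- move=> b f g; rewrite !fctE lS lT scalerDr scalerA mulrC -scalerA.
  by rewrite [in RHS]scalerDr addrACA.
- by move=> f; exact: (cvgD (cvgZl_tmp (cS f)) (cT f)).
- move=> x sx; apply: contrapT => xe.
  have [U [oU Ux vU]] := notin_dist_support (contra_not (@sS x) xe).
  have [V [oV Vx vV]] := notin_dist_support (contra_not (@sT x) xe).
  apply: (sx (U `&` V)) => //; first exact: openI.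
  move=> f cf; rewrite subsetI => -[fU fV].
  by rewrite !fctE (vU f)// (vV f)// scaler0 addr0.
Qed.

HB.instance Definition _ e :=
  GRing.isSubmodClosed.Build K (Cinf k M -> K^o) (dist_at_pred e)
    (dist_at_submod_closed e).

(* The space E'_e(M) of distributions supported at e. *)
Definition dist_at (e : M) : Type :=
  {T : Cinf k M -> K^o | T \in dist_at_pred e}.
HB.instance Definition _ e := [isSub of dist_at e for @sval _ _].
HB.instance Definition _ e := [Choice of dist_at e by <:].
HB.instance Definition _ e := [SubChoice_isSubLmodule of dist_at e by <:].

Definition dist_fun e (T : dist_at e) : Cinf k M -> K := \val T.
Coercion dist_fun : dist_at >-> Funclass.

(* to_dist e T is T seen as an element of E'_e(M) when T is a distribution
   supported at e, and 0 otherwise. *)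
Definition to_dist (e : M) (T : Cinf k M -> K) : dist_at e :=
  insubd (0 : dist_at e) (T : Cinf k M -> K^o).

End CinfTopology.

Arguments dist_at {R K} k {M} e.
Arguments to_dist {R K} k {M} e T.
Arguments to_Cinf {R K} k {M} f.

Section SmoothMaps.
Variable R : realType.

Definition smooth_map (M N : manifold R) (phi : M -> N) : Prop :=
  continuous phi /\
  forall c d, atlas M c -> atlas N d ->
    smooth_map_on (chart_map c @` (chart_dom c `&` phi @^-1` chart_dom d))
      (chart_map d \o phi \o chart_inv c).

Definition diffeomorphism (M N : manifold R) (phi : M -> N) : Prop :=
  smooth_map phi /\
  exists psi : N -> M, [/\ smooth_map psi, cancel phi psi & cancel psi phi].

Record lie_rack (M : manifold R) (e : M) (m : prod_manifold M M -> M) : Prop := {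
  rack_smooth : smooth_map m;
  rack_unit_l : forall x, m (e, x) = x;
  rack_unit_r : forall x, m (x, e) = e;
  rack_self_distr : forall x y z,
    m (x, m (y, z)) = m (m (x, y), m (x, z));
  rack_left_diffeo : forall x, diffeomorphism (fun y : M => m (x, y))
}.

End SmoothMaps.

Arguments tensor {K} V%_type W%_type.
Notation "V ⊗ W" := (tensor V W) (at level 40, left associativity) : type_scope.
Notation "v ⊗ w" := (tens v w) (at level 40, left associativity) : ring_scope.

Section RackBialgebra.
Variable K : fieldType.

Definition tens_map (V W V' W' : lmodType K) (f : V -> V') (g : W -> W') :
    V ⊗ W -> V' ⊗ W' :=
  tens_lift (fun v w => f v ⊗ g w).

Definition tens_assoc (U V W : lmodType K) : (U ⊗ V) ⊗ W -> U ⊗ (V ⊗ W) :=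
  tens_lift (fun t w => tens_lift (fun u v => u ⊗ (v ⊗ w)) t).

Definition tens_swap_mid (A B C D : lmodType K) :
    (A ⊗ B) ⊗ (C ⊗ D) -> (A ⊗ C) ⊗ (B ⊗ D) :=
  tens_lift (fun s t =>
    tens_lift (fun a b => tens_lift (fun c d => (a ⊗ c) ⊗ (b ⊗ d)) t) s).

Record is_coalgebra (C : lmodType K) (Delta : C -> C ⊗ C) (eps : C -> K) : Prop := {
  Delta_linear : linear Delta;
  eps_linear : scalar eps;
  coassociative : forall a,
    tens_assoc (tens_map Delta id (Delta a)) = tens_map id Delta (Delta a);
  counital_l : forall a, tens_lift (fun x y => eps x *: y) (Delta a) = a;
  counital_r : forall a, tens_lift (fun x y => eps y *: x) (Delta a) = a
}.

Definition tens_Delta (C D : lmodType K) (DC : C -> C ⊗ C) (DD : D -> D ⊗ D) :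
    C ⊗ D -> (C ⊗ D) ⊗ (C ⊗ D) :=
  fun t => tens_swap_mid (tens_map DC DD t).

Definition tens_eps (C D : lmodType K) (eC : C -> K) (eD : D -> K) : C ⊗ D -> K :=
  tens_lift (fun c d => eC c * eD d : K^o).

Record is_rack_bialgebra (B : lmodType K) (Delta : B -> B ⊗ B) (eps : B -> K)
    (one : B) (mu : B ⊗ B -> B) : Prop := {
  rb_coalgebra : is_coalgebra Delta eps;
  rb_Delta_one : Delta one = one ⊗ one;
  rb_eps_one : eps one = 1;
  rb_mu_linear : linear mu;
  rb_mu_Delta : forall t,
    Delta (mu t) = tens_map mu mu (tens_Delta Delta Delta t);
  rb_mu_eps : forall t, eps (mu t) = tens_eps eps eps t;
  rb_mu_one : mu (one ⊗ one) = one;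
  rb_unit_l : forall a, mu (one ⊗ a) = a;
  rb_unit_r : forall a, mu (a ⊗ one) = eps a *: one;
  rb_self_distr : forall a b c,
    mu (a ⊗ mu (b ⊗ c)) =
    tens_lift (fun a1 a2 => mu (mu (a1 ⊗ b) ⊗ mu (a2 ⊗ c))) (Delta a)
}.

End RackBialgebra.

Section PointDistributions.
Variables (R : realType) (K : numFieldType) (k : real_or_complex R K).

Definition pushforward (M N : manifold R) (e : M) (e' : N) (phi : M -> N)
    (T : dist_at k e) : dist_at k e' :=
  to_dist k e' (fun f => T (to_Cinf k (f \o phi))).

Definition F2 (M N : manifold R) (e1 : M) (e2 : N) :
    dist_at k e1 ⊗ dist_at k e2 -> dist_at k ((e1, e2) : prod_manifold M N) :=
  tens_lift (fun (S : dist_at k e1) (T : dist_at k e2) =>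
    to_dist k ((e1, e2) : prod_manifold M N)
    (fun f => S (to_Cinf k (fun x => T (to_Cinf k (fun y => f (x, y))))))).

(* F2 is a linear isomorphism; F2_inv is its inverse. *)
Definition F2_inv (M N : manifold R) (e1 : M) (e2 : N)
    (T : dist_at k ((e1, e2) : prod_manifold M N)) :
    dist_at k e1 ⊗ dist_at k e2 :=
  xget 0 [set t | F2 t = T].

Variables (M : manifold R) (e : M).

Definition diag (x : M) : prod_manifold M M := (x, x).

Definition dist_Delta (T : dist_at k e) : dist_at k e ⊗ dist_at k e :=
  F2_inv (pushforward (diag e) diag T).

Definition dist_eps (T : dist_at k e) : K := T (to_Cinf k (fun=> 1)).

Definition dirac_at : dist_at k e := to_dist k e (fun f => f e).

Definition dist_mu (m : prod_manifold M M -> M) (t : dist_at k e ⊗ dist_at k e) :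
    dist_at k e :=
  pushforward e m (F2 t).

End PointDistributions.

Arguments dist_Delta {R K} k {M} e T.
Arguments dist_eps {R K} k {M} e T.
Arguments dirac_at {R K} k {M} e.
Arguments dist_mu {R K} k {M} e m t.

(* Main.v *)
Require Import Defs.
From HB Require Import structures.
From mathcomp Require Import all_boot all_order all_algebra.
From mathcomp Require Import complex.
From mathcomp Require Import all_classical all_reals all_analysis.
From mathcomp Require Import ring lra.

(** The proof rests on the structure of the distributions supported at a
    point.  Fix a chart c around e.  A continuous functional T supported in {e}
    kills the functions which vanish near e ([germ_vanishing]), and it has
    finite order: for some N it kills every f whose partial derivatives of order
    at most N vanish at e ([finite_order]).  Indeed, cutting such an f off at a
    small scale around e does not change T f and makes the derivatives of order
    at most N uniformly small; if no N worked, cut-off functions normalised by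
    T f = 1 would converge to 0.  Since a functional that vanishes wherever
    finitely many others do is a combination of them, T is a finite combination
    of jets, that is of partial derivatives at e in the chart ([dist_jets]).

    This makes the operations on E'_e(M) explicit.  In charts, x |-> T(F(x, .))
    is a combination of partial derivatives of F, hence smooth; the exchange of
    S and T in S(x |-> T(y |-> F(x, y))) is the symmetry of partial derivatives
    ([iteratedC]); the chain rule does not increase the order, so smooth maps
    push such distributions forward ([pushforward_pred]); and the Leibniz rule
    writes diag_* a in the form F2 t ([diag_push_image]).  The last point gives
    content to the definition of Delta, which picks a preimage under F2.

    The algebra then reduces to identities between functions.  Tensors are
    separated by the pairings <S (x) T, f (x) g> = S(f) T(g)
    ([tensor_separated]), and <Delta a, f (x) g> = a(f g) ([pair2_Delta]), so
    that the coalgebra axioms are dual to the associativity and the unit of the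
    product of functions.  The rack product is
    (a |> b)(f) = a(x |-> b(y |-> f(x |> y))) ([muE]), and its compatibility
    with Delta holds because f |-> f o m is multiplicative.  For
    self-distributivity, put
    G(x, x') = b(y |-> c(z |-> f((x |> y) |> (x' |> z)))).  By the axiom of
    racks, a |> (b |> c) sends f to a(x |-> G(x, x)), which is the sum over
    Delta a of a1(x |-> a2(x' |-> G(x, x'))); exchanging a2 with b turns each
    term into the value at f of (a1 |> b) |> (a2 |> c). *)

Set Implicit Arguments.
Unset Strict Implicit.
Unset Printing Implicit Defensive.

Import Order.TTheory GRing.Theory Num.Theory.
Import numFieldNormedType.Exports.

Local Open Scope classical_set_scope.
Local Open Scope ring_scope.

(** * Increments of functions of several variables *)

Section Increments.
Variable R : realType.
Implicit Types (n : nat).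

Lemma line_quotient n (f : 'rV[R]_n -> R) (y v : 'rV[R]_n) (t : R) :
  (fun h : R => h^-1 *: (((fun t => f (y + t *: v)) \o shift t) (h *: 1)
     - f (y + t *: v))) =
  (fun h : R => h^-1 *: ((f \o shift (y + t *: v)) (h *: v) - f (y + t *: v))).
Proof.
apply/funext => h /=; congr (_ *: (f _ - _)).
by rewrite [h%:A]mulr1 scalerDl addrCA addrA addrC.
Qed.

Lemma line_is_derive n (f : 'rV[R]_n -> R) (y v : 'rV[R]_n) (t : R) :
  derivable f (y + t *: v) v ->
  is_derive t 1 (fun t => f (y + t *: v)) ('D_v f (y + t *: v)).
Proof.
by move=> df; apply: DeriveDef; rewrite /derivable /derive line_quotient.
Qed.

(** The mean value theorem along the line through y in the direction v, in the
    form used below: the increment is close to a prescribed multiple L of b as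
    soon as the directional derivative is close to L on the segment. *)
Lemma increment_bound n (f : 'rV[R]_n -> R) (v y : 'rV[R]_n) (b L eps : R) :
  (forall t, `|t| <= `|b| -> derivable f (y + t *: v) v /\
     `|'D_v f (y + t *: v) - L| <= eps) ->
  `|f (y + b *: v) - f y - b * L| <= eps * `|b|.
Proof.
move=> H.
(* The mean value theorem needs ordered end points; b may be negative. *)
suff main (a c : R) : a <= c -> (forall t, t \in `[a, c] -> `|t| <= `|b|) ->
    `|f (y + c *: v) - f (y + a *: v) - (c - a) * L| <= eps * (c - a).
  have [b0|b0] := lerP 0 b.
    have := main 0 b b0; rewrite scale0r addr0 subr0 (ger0_norm b0); apply=> t.
    by rewrite in_itv/= => /andP[t0 tb]; rewrite ger0_norm.
  have := main b 0 (ltW b0); rewrite scale0r addr0 sub0r (ltr0_norm b0).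
  have -> : f y - f (y + b *: v) - - b * L = - (f (y + b *: v) - f y - b * L).
    by ring.
  rewrite normrN; apply=> t; rewrite in_itv/= => /andP[tb t0].
  by rewrite (ler0_norm t0) lerN2.
move=> ac tab.
have [t tac E] : exists2 t, t \in `[a, c]
    & f (y + c *: v) - f (y + a *: v) = 'D_v f (y + t *: v) * (c - a).
  apply: (@MVT_segment R (fun t => f (y + t *: v))
    (fun t => 'D_v f (y + t *: v))) => // [t tac|].
    have /H[df _] : `|t| <= `|b| by apply: tab; exact: subset_itv_oo_cc.
    exact: line_is_derive.
  apply: derivable_within_continuous => t tac.
  have /H[df _] := tab _ tac.
  by have [] := line_is_derive df.
rewrite E mulrC -mulrBr normrM (ger0_norm (_ : 0 <= c - a)) ?subr_ge0//.
rewrite mulrC ler_wpM2r ?subr_ge0//.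
by have [] := H _ (tab _ tac).
Qed.

Lemma coord_le_norm n (x : 'rV[R]_n) i : `|x 0 i| <= `|x|.
Proof.
rewrite [leRHS]/Num.Def.normr/= mx_normrE.
exact: (le_bigmax _ (fun ij : 'I_1 * 'I_n => `|x ij.1 ij.2|) (0, i)).
Qed.

Lemma norm_le_coord n (x : 'rV[R]_n) r : 0 <= r ->
  (forall i, `|x 0 i| <= r) -> `|x| <= r.
Proof.
move=> r0 H; rewrite [leLHS]/Num.Def.normr/= mx_normrE.
by apply: bigmax_le => // -[i j] _ /=; rewrite (ord1 i).
Qed.

(** The increment from x to x + h telescopes along the path that switches on
    the coordinates of h one at a time: each step is parallel to a coordinate
    axis and stays in the box of radius r, because the norm is the maximum of
    the coordinates. *)
Lemma box_increment n (f : 'rV[R]_n -> R) (x h : 'rV[R]_n) (r : R)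
    (L : 'I_n -> R) (eps : R) :
  (forall y, `|y - x| <= r -> forall i, derivable f y (basis_vec R i) /\
     `|'D_(basis_vec R i) f y - L i| <= eps) ->
  `|h| <= r ->
  `|f (x + h) - f x - \sum_i h 0 i * L i| <= (eps *+ n) * `|h|.
Proof.
move=> H hr.
pose tr k : 'rV[R]_n := \row_j (if (j < k)%N then h 0 j else 0).
have tr0 : tr 0%N = 0 by apply/rowP => j; rewrite !mxE.
have trn : tr n = h by apply/rowP => j; rewrite !mxE ltn_ord.
have trS (k : 'I_n) : tr k.+1 = tr k + h 0 k *: basis_vec R k.
  apply/rowP => j; rewrite !mxE eqxx/= ltnS leq_eqVlt.
  have [/val_inj ->|/=] := eqVneq (val j) (val k).
    by rewrite ltnn eqxx add0r mulr1.
  by rewrite -(inj_eq val_inj) => /negPf->; rewrite mulr0 addr0.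
suff Hk k : (k <= n)%N ->
    `|f (x + tr k) - f x - \sum_(i < n | (i < k)%N) h 0 i * L i| <= (eps *+ k) * `|h|.
  have := Hk n (leqnn n); rewrite trn (eq_bigl xpredT)// => i.
  by rewrite ltn_ord.
elim: k => [_|k IHk kn].
  by rewrite tr0 addr0 subrr sub0r big_pred0// oppr0 normr0 mulr0n mul0r.
pose k' := Ordinal kn.
rewrite (bigD1 k')//= (eq_bigl (fun i : 'I_n => (i < k)%N)); last first.
  move=> i; rewrite ltnS leq_eqVlt -(inj_eq val_inj)/=.
  by case: eqP => [->|]; rewrite /= ?ltnn ?andbT.
rewrite (trS k').
have E (a b c u d : R) : a - b - (d + u) = (c - b - u) + (a - c - d) by ring.
rewrite (E _ _ (f (x + tr k))) mulrSr mulrDl.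
apply: le_trans (ler_normD _ _) _; rewrite lerD ?IHk 1?ltnW//.
rewrite addrA; apply: le_trans (_ : eps * `|h 0 k'| <= _); last first.
  apply: ler_wpM2l (coord_le_norm _ _).
  have [] := H x _ k'; first by rewrite subrr normr0 (le_trans _ hr).
  by move=> _; exact: le_trans.
apply: increment_bound => t th; apply: H.
rewrite addrAC [x + _]addrC addrK.
apply: le_trans hr.
have h0 := normr_ge0 h; apply: norm_le_coord => // j.
rewrite !mxE eqxx/=; case: ifPn => jk.
  have -> : (j == k') = false by apply/negbTE; apply: contraTneq jk => ->; rewrite -leqNgt.
  by rewrite mulr0 addr0 coord_le_norm.
rewrite add0r normrM; case: (j == k'); rewrite ?normr1 ?normr0 ?mulr1 ?mulr0//.
by apply: le_trans th _; exact: coord_le_norm.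
Qed.

End Increments.

(** * Continuous partial derivatives: differentiability and symmetry *)

Section C1.
Variable R : realType.
Implicit Types (n : nat).

Definition gradient n (L : 'I_n -> R) (h : 'rV[R]_n) : R := \sum_i h 0 i * L i.

Lemma gradient_is_linear n (L : 'I_n -> R) : linear (gradient L).
Proof.
move=> a u v; rewrite /gradient scaler_sumr -big_split/=; apply: eq_bigr => i _.
by rewrite !mxE mulrDl -mulrA.
Qed.

HB.instance Definition _ n (L : 'I_n -> R) :=
  GRing.isLinear.Build R 'rV[R]_n R *:%R (gradient L) (@gradient_is_linear n L).

Lemma gradient_continuous n (L : 'I_n -> R) : continuous (gradient L).
Proof.
apply: (@continuous_big R^o 'I_n +%R 0 xpredT (@add_continuous R)
  'rV[R]_n (index_enum _) (fun i h => h 0 i * L i)) => i _ x.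
by apply: continuousM; [exact: coord_continuous|exact: cst_continuous].
Qed.

(** By [box_increment], the increment of f differs from the gradient at x by the
    oscillation of the partial derivatives on a small box, times the norm. *)
Lemma is_diff_of_partials n (f : 'rV[R]_n -> R) x :
  (forall i, \forall y \near x, derivable f y (basis_vec R i)) ->
  (forall i, {for x, continuous ('D_(basis_vec R i) f)}) ->
  is_diff x f (gradient (fun i => 'D_(basis_vec R i) f x)).
Proof.
move=> df cf; set L := fun i => _.
have E : f \o shift x = cst (f x) + gradient L +o_ 0 id.
  apply/eqaddoP => _/posnumP[e].
  pose e' := e%:num / n.+1%:R.
  have e'0 : 0 < e' by rewrite divr_gt0.
  have : \forall y \near x, forall i, derivable f y (basis_vec R i) /\
     `|'D_(basis_vec R i) f y - L i| <= e'.
    have Hi i : \forall y \near x, derivable f y (basis_vec R i) /\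
        `|'D_(basis_vec R i) f y - L i| <= e'.
      near=> y; split; first by near: y; exact: df.
      rewrite distrC; near: y; have /cvgrPdist_le := cf i; exact.
    exact: (@filter_forall _ _ _ _ _ Hi).
  move=> /nbhs_ballP[r /= r0 H].
  have r20 : 0 < r / 2 by rewrite divr_gt0.
  near=> h.
  have H1 : forall y, `|y - x| <= r / 2 -> forall i,
      derivable f y (basis_vec R i) /\ `|'D_(basis_vec R i) f y - L i| <= e'.
    move=> y yx; apply: H; rewrite /= -ball_normE /= distrC.
    by apply: le_lt_trans yx _; lra.
  have H2 : `|h| <= r / 2.
    near: h; apply/nbhs_ballP; exists (r/2) => //= h.
    by rewrite -ball_normE /= sub0r normrN => /ltW.
  have := box_increment H1 H2.
  rewrite [x + h]addrC -addrA -opprD => /le_trans; apply.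
  apply: ler_wpM2r => //; rewrite /e' -[_ *+ n]mulr_natr -mulrA.
  apply: ler_piMr => //; rewrite ler_pdivrMl// mulr1 ler_nat; exact: leqnSn.
have dE := @diff_unique _ _ _ f (gradient L) x (@gradient_continuous n L) E.
suff D : differentiable f x by split.
apply/diff_locallyP; rewrite dE; split; last exact: E.
exact: gradient_continuous.
Unshelve. all: by end_near. Qed.

(** The double difference of f along t u and t v is the increment, along t u, of
    y |-> f(y + t v) - f(y), whose derivative along u is an increment of fu
    along t v; [increment_bound] is applied to both. *)
Lemma mixed_increment n (f fu fuv : 'rV[R]_n -> R) (x u v : 'rV[R]_n) (t eps : R) :
  0 <= t -> `|u| <= 1 -> `|v| <= 1 ->
  (forall y, `|y - x| <= t + t ->
     [/\ is_derive y u f (fu y), is_derive y v fu (fuv y) &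
      `|fuv y - fuv x| <= eps]) ->
  `|(f (x + t *: v + t *: u) - f (x + t *: u)) - (f (x + t *: v) - f x)
     - t * (t * fuv x)| <= eps * t * t.
Proof.
move=> t0 u1 v1 H.
have tt : `|t| = t by rewrite ger0_norm.
have small (a b : R) : `|a| <= t -> `|b| <= t ->
    `|x + a *: u + b *: v - x| <= t + t.
  move=> at_ bt; rewrite addrAC [x + _]addrC addrK.
  apply: le_trans (ler_normD _ _) _.
  by rewrite !normrZ lerD//; apply: le_trans (ler_piMr _ _) _.
pose g := fun y => f (y + t *: v) - f y.
have dg y : derivable f (y + t *: v) u -> derivable f y u ->
    derivable g y u /\ 'D_u g y = 'D_u f (y + t *: v) - 'D_u f y.
  move=> d1 d2.
  have Eq : (fun h : R => h^-1 *: ((f \o shift (t *: v) \o shift y) (h *: u)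
     - (f \o shift (t *: v)) y)) =
    (fun h : R => h^-1 *: ((f \o shift (y + t *: v)) (h *: u) - f (y + t *: v))).
    by apply/funext => h /=; rewrite addrA.
  have d3 : derivable (f \o shift (t *: v)) y u.
    rewrite /derivable Eq; exact: d1.
  have E3 : 'D_u (f \o shift (t *: v)) y = 'D_u f (y + t *: v).
    by rewrite /derive Eq.
  have -> : g = (f \o shift (t *: v)) - f by [].
  by split; [exact: derivableB d3 d2|rewrite (deriveB d3 d2) E3].
have key (s : R) : `|s| <= `|t| ->
    derivable g (x + s *: u) u /\
    `|'D_u g (x + s *: u) - t * fuv x| <= eps * t.
  rewrite tt => st.
  have [d0 _ _] : [/\ is_derive (x + s *: u) u f (fu (x + s *: u)),
      is_derive (x + s *: u) v fu (fuv (x + s *: u)) &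
      `|fuv (x + s *: u) - fuv x| <= eps].
    by apply: H; have := @small s 0 st; rewrite scale0r addr0 normr0; apply.
  have tt' : `|t| <= t by rewrite tt.
  have [d1 _ _] := H _ (small s t st tt').
  have [D1 D2] := dg _ (@ex_derive _ _ _ _ _ _ _ d1) (@ex_derive _ _ _ _ _ _ _ d0).
  split; first exact: D1.
  rewrite D2 (@derive_val _ _ _ _ _ _ _ d1) (@derive_val _ _ _ _ _ _ _ d0).
  rewrite -{3}tt; apply: increment_bound => a; rewrite tt => at_.
  have [_ d2 B] := H _ (small s a st at_); split.
    exact: (@ex_derive _ _ _ _ _ _ _ d2).
  by rewrite (@derive_val _ _ _ _ _ _ _ d2).
have := increment_bound key.
by rewrite tt /g [x + _ + _]addrAC.
Qed.

(** The double difference of f is symmetric in u and v, and by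
    [mixed_increment] it is both t^2 fuv(x) + o(t^2) and t^2 fvu(x) + o(t^2).
    The derivatives are abstract functions so that iterated ones can be used
    without unfolding them. *)
Lemma schwarz n (f fu fv fuv fvu : 'rV[R]_n -> R) (x u v : 'rV[R]_n) :
  `|u| <= 1 -> `|v| <= 1 ->
  (\forall y \near x, is_derive y u f (fu y)) ->
  (\forall y \near x, is_derive y v f (fv y)) ->
  (\forall y \near x, is_derive y v fu (fuv y)) ->
  (\forall y \near x, is_derive y u fv (fvu y)) ->
  {for x, continuous fuv} -> {for x, continuous fvu} ->
  fuv x = fvu x.
Proof.
move=> u1 v1 du dv duv dvu cuv cvu; apply/eqP; rewrite -subr_eq0 -normr_le0.
apply/ler_addgt0Pr => e e0; rewrite add0r.
have e20 : 0 < e / 2 by rewrite divr_gt0.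
(* The points of the double difference at scale t are within t + t of x. *)
have near_t (P : set 'rV[R]_n) : (\forall y \near x, P y) ->
    \forall s \near (0 : R)^'+, forall y, `|y - x| <= s + s -> P y.
  move=> /nbhs_ballP[r /= r0 H].
  near=> s => y yx; apply: H; rewrite -ball_normE /= distrC.
  apply: le_lt_trans yx _; have : s < r / 2.
    by near: s; apply: nbhs_right_lt; rewrite divr_gt0.
  by lra.
have Bu : \forall y \near x, `|fuv y - fuv x| <= e / 2.
  move/cvgrPdist_le : cuv => /(_ _ e20).
  by apply: filterS => y; rewrite distrC.
have Bv : \forall y \near x, `|fvu y - fvu x| <= e / 2.
  move/cvgrPdist_le : cvu => /(_ _ e20).
  by apply: filterS => y; rewrite distrC.
have Hu := near_t _ (filterI du (filterI duv Bu)).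
have Hv := near_t _ (filterI dv (filterI dvu Bv)).
near (0 : R)^'+ => t.
have t0 : 0 < t by near: t; exact: nbhs_right_gt.
have H1 : `|(f (x + t *: v + t *: u) - f (x + t *: u)) - (f (x + t *: v) - f x)
     - t * (t * fuv x)| <= e / 2 * t * t.
  apply: (@mixed_increment n f fu) => //.
  suff : forall y, `|y - x| <= t + t ->
      is_derive y u f (fu y) /\ is_derive y v fu (fuv y) /\
      `|fuv y - fuv x| <= e / 2 by move=> C y /C[? []].
  by near: t; exact: Hu.
have H2 : `|(f (x + t *: u + t *: v) - f (x + t *: v)) - (f (x + t *: u) - f x)
     - t * (t * fvu x)| <= e / 2 * t * t.
  apply: (@mixed_increment n f fv) => //.
  suff : forall y, `|y - x| <= t + t ->
      is_derive y v f (fv y) /\ is_derive y u fv (fvu y) /\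
      `|fvu y - fvu x| <= e / 2 by move=> C y /C[? []].
  by near: t; exact: Hv.
move: H1 H2; rewrite [x + t *: v + t *: u]addrAC.
set A := f _ => H1 H2.
rewrite -(ler_pM2r (mulr_gt0 t0 t0)) -[X in `|_| * X]ger0_norm; last first.
  by rewrite mulr_ge0 ?ltW.
rewrite -normrM.
set B := _ * (t * t).
have -> : B = (A - f (x + t *: v) - (f (x + t *: u) - f x) - t * (t * fvu x))
    - (A - f (x + t *: u) - (f (x + t *: v) - f x) - t * (t * fuv x)).
  by rewrite /B; ring.
apply: le_trans (ler_normB _ _) _; apply: le_trans (lerD H2 H1) _.
by lra.
Unshelve. all: by end_near. Qed.

End C1.

(** * Smooth functions on open subsets of R^n *)

Section PartialDerivatives.
Variable R : realType.
Implicit Types (n : nat).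

Lemma partials_cat n (s t : seq 'I_n) (f : 'rV[R]_n -> R) :
  partials (s ++ t) f = partials s (partials t f).
Proof. by elim: s => //= i s ->. Qed.

Section EqOnOpen.
Variables (n : nat) (U : set 'rV[R]_n) (oU : open U) (f g : 'rV[R]_n -> R).
Hypothesis fg : forall x, U x -> f x = g x.

Lemma near_eq_on x : U x -> \forall y \near x, f y = g y.
Proof.
by move=> Ux; apply: filterS fg _; exact: open_nbhs_nbhs.
Qed.

Lemma derive_eq_on x v : U x -> 'D_v f x = 'D_v g x.
Proof. by move=> Ux; apply: near_eq_derive; exact: near_eq_on. Qed.

Lemma derivable_eq_on x v : U x -> derivable f x v -> derivable g x v.
Proof. by move=> Ux; apply: near_eq_derivable; exact: near_eq_on. Qed.

Lemma continuous_eq_on x : U x -> {for x, continuous f} -> {for x, continuous g}.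
Proof.
move=> Ux cf; rewrite /prop_for /continuous_at -(fg Ux).
exact: cvg_trans (near_eq_cvg (near_eq_on Ux)) cf.
Qed.

End EqOnOpen.

Lemma eq_partials_on n (U : set 'rV[R]_n) f g s : open U ->
  (forall x, U x -> f x = g x) ->
  forall x, U x -> partials s f x = partials s g x.
Proof.
move=> oU fg; elim: s => [//|i s IHs] x Ux; exact: derive_eq_on IHs _ _ Ux.
Qed.

Lemma smooth_on_eq n (U : set 'rV[R]_n) f g : open U ->
  (forall x, U x -> f x = g x) -> smooth_on U f -> smooth_on U g.
Proof.
move=> oU fg sf s x Ux; have [cf df] := sf s x Ux.
have E := eq_partials_on s oU fg; split=> [|i].
  exact: (continuous_eq_on oU E Ux).
by apply: (derivable_eq_on oU E Ux); exact: df.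
Qed.

Lemma smooth_on_local n (U : set 'rV[R]_n) f :
  (forall x, U x -> exists V, V x /\ smooth_on V f) -> smooth_on U f.
Proof. by move=> H s x /H[V [Vx sV]]; exact: sV. Qed.

Lemma smooth_on_partials n (U : set 'rV[R]_n) f t :
  smooth_on U f -> smooth_on U (partials t f).
Proof. by move=> sf s x Ux; rewrite -partials_cat; exact: sf. Qed.

Lemma smooth_on_continuous n (U : set 'rV[R]_n) f x :
  smooth_on U f -> U x -> {for x, continuous f}.
Proof. by move=> sf Ux; have [] := sf [::] x Ux. Qed.

Lemma smooth_on_derivable n (U : set 'rV[R]_n) f x i :
  smooth_on U f -> U x -> derivable f x (basis_vec R i).
Proof. by move=> sf Ux; have [_] := sf [::] x Ux; exact. Qed.

Lemma smooth_on_cst n (U : set 'rV[R]_n) (a : R) : smooth_on U (cst a).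
Proof.
move=> s x _; suff [b ->] : exists b, partials s (cst a) = cst b.
  by split=> [|i]; [exact: cst_continuous|exact: derivable_cst].
elim: s => [|i s [b IHs]]; first by exists a.
by exists 0; rewrite /= IHs; apply/funext => y; rewrite derive_cst.
Qed.

Lemma smooth_on_is_diff n (U : set 'rV[R]_n) f x : open U -> smooth_on U f ->
  U x -> is_diff x f (gradient (fun i => partials [:: i] f x)).
Proof.
move=> oU sf Ux; apply: is_diff_of_partials => i.
  have : nbhs x U by exact: open_nbhs_nbhs.
  by apply: filterS => y Uy; exact: smooth_on_derivable sf Uy.
by have [] := sf [:: i] x Ux.
Qed.

Lemma basis_vec_norm n (i : 'I_n) : `|basis_vec R i| <= 1.
Proof.
apply: norm_le_coord => // j; rewrite !mxE eqxx/=.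
by case: (_ == _); rewrite ?normr1 ?normr0.
Qed.

Lemma partials_swap n (U : set 'rV[R]_n) f i j x : open U -> smooth_on U f ->
  U x -> partials [:: i; j] f x = partials [:: j; i] f x.
Proof.
move=> oU sf Ux.
have ev s k : \forall y \near x, is_derive y (basis_vec R k) (partials s f)
    (partials (k :: s) f y).
  have : nbhs x U by exact: open_nbhs_nbhs.
  apply: filterS => y Uy; apply: DeriveDef => //.
  by have [_] := sf s y Uy; exact.
have ct s : {for x, continuous (partials s f)} by have [] := sf s x Ux.
exact: (schwarz (basis_vec_norm j) (basis_vec_norm i) (ev [::] j) (ev [::] i)
  (ev [:: j] i) (ev [:: i] j) (ct [:: i; j]) (ct [:: j; i])).
Qed.

Lemma partials_move n (U : set 'rV[R]_n) f s i t x : open U -> smooth_on U f ->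
  U x -> partials (s ++ i :: t) f x = partials (i :: s ++ t) f x.
Proof.
move=> oU sf; elim: s x => [//|j s IHs] x Ux.
rewrite cat_cons; transitivity (partials (j :: i :: s ++ t) f x).
  exact: (derive_eq_on oU IHs).
exact: (partials_swap j i oU (smooth_on_partials (s ++ t) sf) Ux).
Qed.

(** On smooth functions only the multiset of the indices of a word of partial
    derivatives matters: [partials_move] brings the first letter of s to the
    front of t. *)
Lemma partials_perm n (U : set 'rV[R]_n) f s t x : open U -> smooth_on U f ->
  perm_eq s t -> U x -> partials s f x = partials t f x.
Proof.
move=> oU sf; elim: s t x => [|i s IHs] t x st Ux.
  by move: st; rewrite perm_sym => /perm_nilP ->.
have it : i \in t by rewrite -(perm_mem st) mem_head.
case/splitPr: it st => t1 t2 st; rewrite (partials_move t1 i t2 oU sf Ux).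
have E y (Uy : U y) : partials s f y = partials (t1 ++ t2) f y.
  apply: IHs => //.
  by rewrite -(perm_cons i) (perm_trans st)// perm_catC/= perm_cons perm_catC.
exact: (derive_eq_on oU E).
Qed.

Lemma is_derive_bigsum (I : eqType) n (r : seq I) (F : I -> 'rV[R]_n -> R) dF x v :
  (forall i, i \in r -> is_derive x v (F i) (dF i)) ->
  is_derive x v (fun y => \sum_(i <- r) F i y) (\sum_(i <- r) dF i).
Proof.
elim: r => [_|i r IHr H].
  rewrite big_nil; under eq_fun do rewrite big_nil; exact: is_derive_cst.
rewrite big_cons; under eq_fun do rewrite big_cons.
apply: (@is_deriveD _ _ _ (F i) (fun y => \sum_(i <- r) F i y)).
  by apply: H; exact: mem_head.
by apply: IHr => j jr; apply: H; rewrite inE jr orbT.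
Qed.

Lemma continuous_bigsum (I : eqType) (T : topologicalType) (r : seq I)
    (F : I -> T -> R) x :
  (forall i, i \in r -> {for x, continuous (F i)}) ->
  {for x, continuous (fun y => \sum_(i <- r) F i y)}.
Proof.
elim: r => [_|i r IHr H].
  apply: (@eq_continuous_at _ _ (cst 0)); last exact: cst_continuous.
  by move=> y; rewrite big_nil.
apply: (@eq_continuous_at _ _ (fun y => F i y + \sum_(i <- r) F i y)).
  by move=> y; rewrite big_cons.
apply: (@continuousD _ _ _ (F i) (fun y => \sum_(i <- r) F i y)).
  by apply: H; exact: mem_head.
by apply: IHr => j jr; apply: H; rewrite inE jr orbT.
Qed.

(** The ways of distributing the letters of a word over two subwords: the index
    set of the Leibniz rule for the derivative along that word. *)
Fixpoint splits (I : Type) (s : seq I) : seq (seq I * seq I) :=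
  if s is i :: s' then
    [seq (i :: p.1, p.2) | p <- splits s'] ++ [seq (p.1, i :: p.2) | p <- splits s']
  else [:: ([::], [::])].

Lemma size_splits (I : eqType) (s : seq I) p :
  p \in splits s -> (size p.1 + size p.2 = size s)%N.
Proof.
elim: s p => [|i s IHs] p /=; first by rewrite inE => /eqP->.
by rewrite mem_cat => /orP[] /mapP[q /IHs <- ->] /=; rewrite ?addnS.
Qed.

Section Product.
Variables (n : nat) (U : set 'rV[R]_n) (oU : open U) (f g : 'rV[R]_n -> R).
Hypotheses (sf : smooth_on U f) (sg : smooth_on U g).

Let dmul s t x i : U x -> is_derive x (basis_vec R i)
  (fun y => partials s f y * partials t g y)
  (partials (i :: s) f x * partials t g x + partials s f x * partials (i :: t) g x).
Proof.
move=> Ux; have [_ /(_ i) df] := sf s Ux; have [_ /(_ i) dg] := sg t Ux.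
have H := @is_deriveM _ _ (partials s f) (partials t g) x (basis_vec R i) _ _
  (derivableP df) (derivableP dg).
apply: is_derive_eq H _; rewrite addrC /GRing.scale/= mulrC.
by congr (_ + _).
Qed.

Lemma partials_mul s x : U x ->
  partials s (fun y => f y * g y) x =
  \sum_(p <- splits s) partials p.1 f x * partials p.2 g x.
Proof.
elim: s x => [|i s IHs] x Ux; first by rewrite big_seq1.
rewrite [LHS](derive_eq_on oU IHs _ Ux) big_cat/= !big_map -big_split/=.
have H := @is_derive_bigsum _ n (splits s) _ _ x (basis_vec R i)
  (fun p _ => @dmul p.1 p.2 x i Ux).
by rewrite (@derive_val _ _ _ _ _ _ _ H).
Qed.

Lemma smooth_on_mul : smooth_on U (fun y => f y * g y).
Proof.
move=> s x Ux; have E y (Uy : U y) := esym (partials_mul s Uy).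
split=> [|i].
  apply: (continuous_eq_on oU E Ux); apply: continuous_bigsum => p _.
  by apply: continuousM; [have [] := sf p.1 Ux|have [] := sg p.2 Ux].
apply: (derivable_eq_on oU E Ux).
have H := @is_derive_bigsum _ n (splits s) _ _ x (basis_vec R i)
  (fun p _ => @dmul p.1 p.2 x i Ux).
exact: (@ex_derive _ _ _ _ _ _ _ H).
Qed.

End Product.

(** The last letter of a word acts first, so a function is smooth when its first
    partial derivatives exist and are smooth. *)
Lemma smooth_on_intro n (U : set 'rV[R]_n) f :
  (forall x, U x -> {for x, continuous f}) ->
  (forall x i, U x -> derivable f x (basis_vec R i)) ->
  (forall i, smooth_on U ('D_(basis_vec R i) f)) -> smooth_on U f.
Proof.
move=> cf df sdf s x Ux; case/lastP: s => [|s i].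
  by split=> [|i]; [exact: cf|exact: df].
by rewrite -cats1 partials_cat; exact: sdf.
Qed.

Lemma is_derive_linear n (L : {linear 'rV[R]_n -> R}) x v : continuous L ->
  is_derive x v L (L v).
Proof.
move=> cL; have dL : differentiable L x by exact: linear_differentiable.
apply: DeriveDef; first exact: diff_derivable.
by rewrite deriveE// diff_lin.
Qed.

Lemma smooth_on_linear n (U : set 'rV[R]_n) (L : {linear 'rV[R]_n -> R}) :
  continuous L -> smooth_on U L.
Proof.
move=> cL; apply: smooth_on_intro => [x _|x i _|i].
- exact: cL.
- have H := is_derive_linear x (basis_vec R i) cL.
  exact: (@ex_derive _ _ _ _ _ _ _ H).
have -> : 'D_(basis_vec R i) L = cst (L (basis_vec R i)).
  apply/funext => x; have H := is_derive_linear x (basis_vec R i) cL.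
  exact: (@derive_val _ _ _ _ _ _ _ H).
exact: smooth_on_cst.
Qed.

Lemma coord_gradient n j :
  (fun x : 'rV[R]_n => x 0 j) = gradient (fun i => (i == j)%:R).
Proof.
apply/funext => x; rewrite /gradient (bigD1 j)//= eqxx mulr1 big1 ?addr0//.
by move=> i /negPf->; rewrite mulr0.
Qed.

Lemma smooth_on_coord n (U : set 'rV[R]_n) j : smooth_on U (fun x => x 0 j).
Proof.
by rewrite coord_gradient; apply: smooth_on_linear; exact: gradient_continuous.
Qed.

Lemma is_derive_coord n (x : 'rV[R]_n) i j :
  is_derive x (basis_vec R i) (fun y : 'rV[R]_n => y 0 j) (j == i)%:R.
Proof.
have D := is_derive_linear x (basis_vec R i)
  (@gradient_continuous R n (fun i => (i == j)%:R)).
rewrite coord_gradient; apply: is_derive_eq D _.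
by rewrite /= -coord_gradient !mxE eqxx.
Qed.

(** Restricting tau to the line through x in the direction v reduces the
    statement to the chain rule for differentiable maps: a directional
    derivative is a derivative at 0 of a function of one variable. *)
Lemma chain_rule m n (tau : 'rV[R]_m -> 'rV[R]_n) (g : 'rV[R]_n -> R)
    (dtau dg : 'I_n -> R) x v :
  (forall j, is_derive x v (fun y => tau y 0 j) (dtau j)) ->
  is_diff (tau x) g (gradient dg) ->
  is_derive x v (g \o tau) (\sum_j dtau j * dg j).
Proof.
move=> htau [hg hdg].
have dt : derivable tau x v.
  apply/derivable_mxP => i j; rewrite (ord1 i).
  by have [] := htau j.
have Dt : 'D_v tau x = \row_j dtau j.
  rewrite derive_mx//; apply/rowP => j; rewrite !mxE.
  by have [] := htau j.
pose p (h : R) := tau (h *: v + x).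
have dp : derivable p 0 1 := proj1 (derivable1P tau x v) dt.
have p0 : p 0 = tau x by rewrite /p scale0r add0r.
have dfp : differentiable p 0 := proj1 (derivable1_diffP p 0) dp.
have hg0 : differentiable g (p 0) by rewrite p0.
have dgp : differentiable (g \o p) 0 by exact: differentiable_comp.
have quot (W : normedModType R) (f : 'rV[R]_m -> W) :
    'D_1 (fun h : R => f (h *: v + x)) 0 = 'D_v f x.
  have E : (fun h : R => h^-1 *: (((fun h : R => f (h *: v + x)) \o shift 0) (h *: 1)
      - f (0 *: v + x))) = (fun h : R => h^-1 *: ((f \o shift x) (h *: v) - f x)).
    by apply/funext => h /=; rewrite scale0r add0r addr0 [h%:A]mulr1.
  by rewrite /derive E.
apply: DeriveDef.
  apply: (proj2 (derivable1P (g \o tau) x v)).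
  rewrite -[fun h : R => _]/(g \o p); exact: diff_derivable.
rewrite -quot -[LHS]/('D_1 (g \o p) 0) deriveE//.
rewrite diff_comp//= -[X in 'd g _ X]deriveE// p0 quot Dt hdg.
by apply: eq_bigr => j _; rewrite mxE.
Qed.

Section Composition.
Variables (m n : nat) (U : set 'rV[R]_m) (V : set 'rV[R]_n).
Variables (oU : open U) (oV : open V) (tau : 'rV[R]_m -> 'rV[R]_n).
Hypotheses (stau : smooth_map_on U tau) (tauV : forall x, U x -> V (tau x)).

Let Coef : Type := (('rV[R]_m -> R) * seq 'I_n)%type.

Let is_derive_term (g : 'rV[R]_n -> R) (p : Coef) i x :
  smooth_on V g -> smooth_on U p.1 -> U x ->
  is_derive x (basis_vec R i) (fun y => p.1 y * partials p.2 g (tau y))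
  ('D_(basis_vec R i) p.1 x * partials p.2 g (tau x) +
   \sum_(j < n) p.1 x * 'D_(basis_vec R i) (fun y => tau y 0 j) x *
      partials (j :: p.2) g (tau x)).
Proof.
move=> sg sp Ux.
have d1 := derivableP (@smooth_on_derivable _ _ _ _ i sp Ux).
have d2 j := derivableP (@smooth_on_derivable _ _ _ _ i (stau j) Ux).
have d3 := smooth_on_is_diff oV (smooth_on_partials p.2 sg) (tauV Ux).
have H := @is_deriveM _ _ p.1 (partials p.2 g \o tau) x (basis_vec R i) _ _
   d1 (chain_rule d2 d3).
apply: is_derive_eq H _; rewrite addrC /GRing.scale/= mulrC; congr (_ + _).
rewrite mulr_sumr; apply: eq_bigr => j _; by rewrite mulrA.
Qed.

(** A coarse form of the formula of Faa di Bruno.  What matters is that the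
    coefficients are smooth and independent of g, and that no derivative of g of
    higher order occurs: this bounds derivatives after a change of charts, and
    shows that composition with tau preserves flatness. *)
Lemma partials_comp_expand s : exists l : seq Coef,
  (forall p, p \in l -> smooth_on U p.1 /\ (size p.2 <= size s)%N) /\
  forall g, smooth_on V g -> forall x, U x ->
    partials s (g \o tau) x = \sum_(p <- l) p.1 x * partials p.2 g (tau x).
Proof.
elim: s => [|i s [l [sl IHs]]].
  exists [:: (cst 1, [::])]; split=> [p|g _ x _]; last first.
    by rewrite big_seq1 /= mul1r.
  by rewrite inE => /eqP -> /=; split=> //; exact: smooth_on_cst.
(* The product rule applied to one term: differentiate the coefficient, or the
   derivative of g by the chain rule. *)
pose term (p : Coef) : seq Coef :=
  ('D_(basis_vec R i) p.1, p.2) ::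
  [seq ((fun x => p.1 x * 'D_(basis_vec R i) (fun y => tau y 0 j) x), j :: p.2)
    | j <- enum 'I_n].
exists (flatten [seq term p | p <- l]); split=> [p|g sg x Ux].
  move=> /flatten_mapP[q ql]; have [sq tq] := sl _ ql.
  rewrite inE => /orP[/eqP ->|/mapP[j _ ->]] /=.
    by split; [exact: (smooth_on_partials [:: i] sq)|exact: leqW].
  split; last exact: tq.
  have st := smooth_on_partials [:: i] (stau j).
  exact: (smooth_on_mul oU sq st).
rewrite [LHS](derive_eq_on oU (IHs g sg) _ Ux) big_flatten big_map.
have H : is_derive x (basis_vec R i)
    (fun y => \sum_(p <- l) p.1 y * partials p.2 g (tau y))
    (\sum_(p <- l) \sum_(q <- term p) q.1 x * partials q.2 g (tau x)).
  apply: is_derive_bigsum => p pl; have [sp _] := sl _ pl.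
  have D := is_derive_term i sg sp Ux; apply: is_derive_eq D _.
  by rewrite big_cons big_map big_enum.
exact: (@derive_val _ _ _ _ _ _ _ H).
Qed.

Lemma smooth_on_comp g : smooth_on V g -> smooth_on U (g \o tau).
Proof.
move=> sg s x Ux; have [l [sl E]] := partials_comp_expand s.
have E' y (Uy : U y) := esym (E g sg y Uy).
split=> [|i].
  apply: (continuous_eq_on oU E' Ux); apply: continuous_bigsum => p pl.
  have [sp _] := sl _ pl.
  apply: continuousM; first exact: smooth_on_continuous sp Ux.
  apply: (@continuous_comp _ _ _ tau (partials p.2 g)).
    by apply: rV_continuous_at => j; exact: smooth_on_continuous (stau j) Ux.
  by have [] := sg p.2 _ (tauV Ux).
apply: (derivable_eq_on oU E' Ux).
have H := is_derive_bigsum (fun p pl =>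
  is_derive_term i sg (proj1 (sl p pl)) Ux).
exact: (@ex_derive _ _ _ _ _ _ _ H).
Qed.

End Composition.

End PartialDerivatives.

(** * Partial derivatives under affine substitutions *)

Section AffineChanges.
Variable R : realType.
Implicit Types (m n : nat).

(** An affine map sending coordinate lines to coordinate lines only renames the
    indices of partial derivatives; the slices u |-> (u, v) and v |-> (u, v) of
    a product are the cases of interest.  Already the difference quotients
    agree. *)
Lemma partials_reindex m n (A : 'rV[R]_m -> 'rV[R]_n) (sigma : 'I_m -> 'I_n)
    (F : 'rV[R]_n -> R) s :
  (forall i h v, A (h *: basis_vec R i + v) = h *: basis_vec R (sigma i) + A v) ->
  partials s (F \o A) = partials (map sigma s) F \o A.
Proof.
move=> HA; elim: s => [//|i s IHs] /=.
apply/funext => v; rewrite IHs /derive /=.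
have E : (fun h : R => h^-1 *: ((partials [seq sigma i | i <- s] F \o A \o shift v)
     (h *: basis_vec R i) - (partials [seq sigma i | i <- s] F \o A) v)) =
   (fun h : R => h^-1 *: ((partials [seq sigma i | i <- s] F \o shift (A v))
     (h *: basis_vec R (sigma i)) - partials [seq sigma i | i <- s] F (A v))).
  by apply/funext => h /=; rewrite HA.
by rewrite E.
Qed.

Lemma smooth_on_reindex m n (A : 'rV[R]_m -> 'rV[R]_n) (sigma : 'I_m -> 'I_n)
    (F : 'rV[R]_n -> R) (W : set 'rV[R]_n) :
  (forall i h v, A (h *: basis_vec R i + v) = h *: basis_vec R (sigma i) + A v) ->
  continuous A -> smooth_on W F -> smooth_on (A @^-1` W) (F \o A).
Proof.
move=> HA cA sF s x Wx; rewrite (partials_reindex F s HA).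
have [cF dF] := sF (map sigma s) _ Wx; split=> [|i].
  exact: (@continuous_comp _ _ _ A (partials _ F) x (cA x) cF).
move: (dF (sigma i)); rewrite /derivable.
set G := partials _ F.
have E : (fun h : R => h^-1 *: ((G \o A \o shift x) (h *: basis_vec R i) - (G \o A) x))
   = (fun h : R => h^-1 *: ((G \o shift (A x)) (h *: basis_vec R (sigma i)) - G (A x))).
  by apply/funext => h /=; rewrite HA.
by rewrite E.
Qed.

Lemma row_mx_basis_l m n (u : 'rV[R]_n) i h (v : 'rV[R]_m) :
  row_mx (h *: basis_vec R i + v) u =
  h *: basis_vec R (lshift n i) + row_mx v u.
Proof.
apply/rowP => j; case: (split_ordP j) => k ->; rewrite [RHS]mxE.
  rewrite !row_mxEl [LHS]mxE; congr (_ + _).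
  by rewrite !mxE (inj_eq (@lshift_inj _ _)).
by rewrite !row_mxEr !mxE eq_rlshift andbF mulr0 add0r.
Qed.

Lemma row_mx_basis_r m n (u : 'rV[R]_m) i h (v : 'rV[R]_n) :
  row_mx u (h *: basis_vec R i + v) =
  h *: basis_vec R (rshift m i) + row_mx u v.
Proof.
apply/rowP => j; case: (split_ordP j) => k ->; rewrite [RHS]mxE.
  by rewrite !row_mxEl !mxE eq_lrshift andbF mulr0 add0r.
rewrite !row_mxEr [LHS]mxE; congr (_ + _).
by rewrite !mxE (inj_eq (@rshift_inj _ _)).
Qed.

Lemma row_mx_continuous (T : topologicalType) m n (f : T -> 'rV[R]_m)
    (g : T -> 'rV[R]_n) x : {for x, continuous f} -> {for x, continuous g} ->
  {for x, continuous (fun y => row_mx (f y) (g y))}.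
Proof.
move=> cf cg; apply: rV_continuous_at => j; case: (split_ordP j) => k ->.
  apply: (@eq_continuous_at _ _ (fun y => f y 0 k)); first by move=> y; rewrite row_mxEl.
  exact: (@continuous_comp _ _ _ f (fun u => u 0 k) x cf (@coord_continuous _ _ _ 0 k _)).
apply: (@eq_continuous_at _ _ (fun y => g y 0 k)); first by move=> y; rewrite row_mxEr.
exact: (@continuous_comp _ _ _ g (fun u => u 0 k) x cg (@coord_continuous _ _ _ 0 k _)).
Qed.

Lemma row_mxl_continuous m n (u : 'rV[R]_n) : continuous (fun v : 'rV[R]_m => row_mx v u).
Proof.
move=> x; exact: (@row_mx_continuous _ _ _ id (cst u) x cvg_id (@cst_continuous _ _ _ _)).
Qed.

Lemma row_mxr_continuous m n (u : 'rV[R]_m) : continuous (fun v : 'rV[R]_n => row_mx u v).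
Proof.
move=> x; exact: (@row_mx_continuous _ _ _ (cst u) id x (@cst_continuous _ _ _ _) cvg_id).
Qed.

Section Diagonal.
Variables (n : nat) (W : set 'rV[R]_(n + n)) (oW : open W) (F : 'rV[R]_(n + n) -> R).
Hypothesis sF : smooth_on W F.

Definition diag_mx2 (x : 'rV[R]_n) : 'rV[R]_(n + n) := row_mx x x.

Lemma diag_mx2_continuous : continuous diag_mx2.
Proof. by move=> x; exact: (@row_mx_continuous _ _ _ id id x cvg_id cvg_id). Qed.

Lemma is_derive_diag t i x : W (diag_mx2 x) ->
  is_derive x (basis_vec R i) (partials t F \o diag_mx2)
    (partials (lshift n i :: t) F (diag_mx2 x) +
     partials (rshift n i :: t) F (diag_mx2 x)).
Proof.
move=> Wx.
have d1 j : is_derive x (basis_vec R i) (fun y => diag_mx2 y 0 j)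
    ((j == lshift n i)%:R + (j == rshift n i)%:R).
  case: (split_ordP j) => k ->.
    have -> : (fun y => diag_mx2 y 0 (lshift n k)) = (fun y : 'rV[R]_n => y 0 k).
      by apply/funext => y; rewrite row_mxEl.
    rewrite (inj_eq (@lshift_inj _ _)) eq_lrshift addr0.
    exact: is_derive_coord.
  have -> : (fun y => diag_mx2 y 0 (rshift n k)) = (fun y : 'rV[R]_n => y 0 k).
    by apply/funext => y; rewrite row_mxEr.
  rewrite (inj_eq (@rshift_inj _ _)) eq_rlshift add0r.
  exact: is_derive_coord.
have d2 := smooth_on_is_diff oW (smooth_on_partials t sF) Wx.
apply: is_derive_eq (chain_rule d1 d2) _.
under eq_bigr do rewrite mulrDl.
rewrite big_split/=; congr (_ + _).
  rewrite (bigD1 (lshift n i))//= eqxx mul1r big1 ?addr0// => j /negPf->.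
  by rewrite mul0r.
rewrite (bigD1 (rshift n i))//= eqxx mul1r big1 ?addr0// => j /negPf->.
by rewrite mul0r.
Qed.

(** Each derivative of x |-> F(x, x) falls either on the first or on the second
    argument.  Schwarz is used to collect the derivatives in the first argument
    in front of those in the second one. *)
Lemma partials_diag s x : W (diag_mx2 x) ->
  partials s (F \o diag_mx2) x = \sum_(p <- splits s)
    partials (map (@lshift n n) p.1 ++ map (@rshift n n) p.2) F (diag_mx2 x).
Proof.
have oU : open (diag_mx2 @^-1` W).
  by apply: open_comp => // y _; exact: diag_mx2_continuous.
elim: s x => [|i s IHs] x Wx; first by rewrite big_seq1.
rewrite [LHS](derive_eq_on oU IHs _ Wx) big_cat/= !big_map -big_split/=.
have H := is_derive_bigsum (fun p (_ : p \in splits s) => is_derive_diag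
  (map (@lshift n n) p.1 ++ map (@rshift n n) p.2) i Wx).
rewrite (@derive_val _ _ _ _ _ _ _ H); apply: eq_bigr => p _; congr (_ + _).
by rewrite /= (partials_move _ _ _ oW sF Wx).
Qed.

End Diagonal.

Lemma partials_scale n (F : 'rV[R]_n -> R) (a : 'rV[R]_n) c s :
  smooth_on setT F ->
  partials s (fun x => F (c *: (x - a))) =
  (fun x => c ^+ size s * partials s F (c *: (x - a))).
Proof.
move=> sF; pose A (x : 'rV[R]_n) := c *: (x - a).
elim: s => [|i s IHs]; first by apply/funext => x; rewrite mul1r.
apply/funext => x; rewrite /= IHs.
have H (k : 'I_n) : is_derive x (basis_vec R i) (fun y => A y 0 k) (c * (k == i)%:R).
  have -> : (fun y : 'rV[R]_n => A y 0 k) =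
      c *: (fun y : 'rV[R]_n => y 0 k) + cst (- c * a 0 k).
    by apply/funext => y; rewrite !fctE /A !mxE mulrBr mulNr.
  apply: is_derive_eq (is_deriveD (is_deriveZ c (is_derive_coord x i k))
    (is_derive_cst (- c * a 0 k) x (basis_vec R i))) _.
  by rewrite addr0.
have D := chain_rule H (smooth_on_is_diff openT (smooth_on_partials s sF) (I : setT (A x))).
have D' := is_deriveZ (c ^+ size s) D.
have <- : c ^+ size s *: (partials s F \o A) = (fun x => c ^+ size s * partials s F (c *: (x - a))).
  by apply/funext.
rewrite (@derive_val _ _ _ _ _ _ _ D') exprSr -mulrA; congr (_ * _).
rewrite (bigD1 i)//= eqxx mulr1 big1 ?addr0// => j /negPf->.
by rewrite mulr0 mul0r.
Qed.

Lemma smooth_on_scale n (F : 'rV[R]_n -> R) (a : 'rV[R]_n) c U : open U ->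
  smooth_on setT F -> smooth_on U (fun x => F (c *: (x - a))).
Proof.
move=> oU sF; apply: (@smooth_on_comp _ _ _ U setT oU openT (fun x => c *: (x - a))) => //.
move=> j; apply: (@smooth_on_eq _ _ _ (fun x => c * x 0 j + (- c * a 0 j) * cst 1 x)) => //.
  by move=> x _; rewrite !mxE /cst; ring.
by apply: smooth_on_lincomb => //; [exact: smooth_on_coord|exact: smooth_on_cst].
Qed.

End AffineChanges.

(** * Bump functions on R^n *)

Section ExpInv.
Variable R : realType.

(** The function equal to exp(-1/t) for t > 0 and to 0 otherwise is the case
    k = 0.  The factors t^-k make the family closed, up to linear combinations,
    under differentiation. *)
Definition expinv (k : nat) (t : R) : R :=
  if 0 < t then t^-1 ^+ k * expR (- t^-1) else 0.

(** With u = 1/t, the inequality exp(u) >= (u / (k + 1))^(k + 1) gives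
    u^k exp(-u) <= (k + 1)^(k + 1) / u.  So each function of the family
    vanishes at 0 to first order. *)
Lemma expinv_bound k : exists C : R, forall t, `|expinv k t| <= C * `|t|.
Proof.
exists (k.+1%:R ^+ k.+1) => t; rewrite /expinv.
case: ifPn => [t0|_]; last by rewrite normr0 mulr_ge0// exprn_ge0.
set u := t^-1; have u0 : 0 < u by rewrite invr_gt0.
have k0 : 0 < k.+1%:R :> R by [].
rewrite ger0_norm; last by rewrite mulr_ge0 ?expR_ge0// exprn_ge0 ?ltW.
rewrite (gtr0_norm t0) expRN.
have le_exp : (u / k.+1%:R) ^+ k.+1 <= expR u.
  have {2}-> : u = k.+1%:R * (u / k.+1%:R) by rewrite mulrC divfK.
  rewrite expRM_natl; apply: lerXn2r.
  - by rewrite nnegrE divr_ge0 ?ltW.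
  - by rewrite nnegrE expR_ge0.
  by apply: le_trans (expR_ge1Dx _); rewrite lerDr.
have p0 : 0 < (u / k.+1%:R) ^+ k.+1 by rewrite exprn_gt0 ?divr_gt0.
apply: le_trans (_ : u ^+ k * ((u / k.+1%:R) ^+ k.+1)^-1 <= _).
  apply: ler_wpM2l; first by rewrite exprn_ge0 ?ltW.
  by rewrite lef_pV2 ?posrE ?expR_gt0.
rewrite expr_div_n invf_div mulrCA ler_wpM2l ?exprn_ge0//.
rewrite exprS invfM mulrCA divff ?expf_neq0 ?gt_eqF// mulr1.
by rewrite /u invrK.
Qed.

Lemma expinv_quotient k (h : R) : h^-1 * expinv k h = expinv k.+1 h.
Proof. by rewrite /expinv; case: ifP => _; rewrite ?mulr0// exprS mulrA. Qed.

(** At 0, the difference quotient of one function of the family is the next one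
    ([expinv_quotient]), which tends to 0. *)
Lemma is_derive_expinv k (t : R) :
  is_derive t 1 (expinv k) (expinv k.+2 t - k%:R * expinv k.+1 t).
Proof.
have [t0|t0|->] := ltgtP t 0.
- rewrite /expinv (lt_gtF t0) mulr0 subr0.
  apply: (@near_eq_is_derive _ _ _ (cst 0)).
  near=> s; have s0 : s < 0 by near: s; exact: lt_nbhsl.
  by rewrite (lt_gtF s0).
- rewrite /expinv t0.
  apply: (@near_eq_is_derive _ _ _ (fun s : R => s^-1 ^+ k * expR (- s^-1))).
    near=> s; have s0 : 0 < s by near: s; exact: lt_nbhsr.
    by rewrite s0.
  have tn0 : t != 0 by rewrite gt_eqF.
  have Dinv : is_derive t 1 (fun s : R => s^-1) (- t ^- 2).
    have D := @is_deriveV R id t 1 1 tn0 (is_derive_id _ _).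
    by apply: is_derive_eq D _; rewrite [_ *: _]mulr1.
  have Dexp : is_derive t 1 (fun s : R => expR (- s^-1)) (expR (- t^-1) * t ^- 2).
    have DN := is_deriveN Dinv; rewrite opprK in DN.
    exact: (@is_derive1_comp R expR (- (fun s : R => s^-1)) t _ _ (is_derive_expR _) DN).
  have Dpow := is_deriveX k Dinv.
  have -> : (fun s : R => s^-1 ^+ k * expR (- s^-1)) =
      (fun s : R => s^-1) ^+ k * (fun s : R => expR (- s^-1)).
    by apply/funext => s; rewrite !fctE.
  apply: is_derive_eq (is_deriveM Dpow Dexp) _.
  rewrite /GRing.scale/= !fctE !exprVn.
  move: (expR _) => ex; case: k {Dpow} => [|k] /=; rewrite !exprS ?expr0.
    by field; exact: tn0.
  by move: (k.+1%:R) => c; field; rewrite tn0 expf_neq0.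
- have E0 : expinv k.+2 0 - k%:R * expinv k.+1 0 = 0 by rewrite /expinv ltxx mulr0 subrr.
  rewrite E0.
  suff H : (fun h : R => h^-1 *: ((expinv k \o shift 0) (h *: 1) - expinv k 0)) @ 0^' --> (0 : R).
    by apply: DeriveDef; [apply/cvg_ex; exists 0|exact: cvg_lim].
  have -> : (fun h : R => h^-1 *: ((expinv k \o shift 0) (h *: 1) - expinv k 0)) = expinv k.+1.
    apply/funext => h /=; rewrite addr0 [h%:A]mulr1 {2}/expinv ltxx subr0.
    exact: expinv_quotient.
  have [C HC] := expinv_bound k.+1.
  apply/cvgr0Pnorm_le => e e0.
  have C0 : 0 < `|C| + 1 by rewrite ltr_wpDl.
  near=> h; apply: le_trans (HC h) _.
  apply: le_trans (_ : (`|C| + 1) * `|h| <= _).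
    by rewrite ler_wpM2r// (le_trans (ler_norm C))// lerDl.
  rewrite -ler_pdivlMl// mulrC ltW//; near: h.
  by apply: dnbhs0_lt; rewrite divr_gt0.
Unshelve. all: by end_near. Qed.

Lemma expinv_ge0 k t : 0 <= expinv k t.
Proof.
rewrite /expinv; case: ifP => // t0.
by rewrite mulr_ge0 ?expR_ge0// exprn_ge0 ?invr_ge0 ?ltW.
Qed.

Lemma expinv0_gt0 t : 0 < t -> 0 < expinv 0 t.
Proof. by move=> t0; rewrite /expinv t0 mul1r expR_gt0. Qed.

Lemma expinv0_le (s t : R) : s <= t -> expinv 0 s <= expinv 0 t.
Proof.
move=> st; rewrite {1}/expinv; case: ifPn => s0; last exact: expinv_ge0.
have t0 : 0 < t by exact: lt_le_trans st.
by rewrite /expinv t0 !mul1r ler_expR lerN2 lef_pV2.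
Qed.

(** Every iterated derivative is again a combination of the family. *)
Lemma smooth_on_expinv k : smooth_on setT (fun x : 'rV[R]_1 => expinv k (x 0 0)).
Proof.
pose phi j (x : 'rV[R]_1) := expinv j (x 0 0).
have dphi j i x : is_derive x (basis_vec R i) (phi j)
    (phi j.+2 x - j%:R * phi j.+1 x).
  have [d1 d2] := is_derive_expinv j (x 0 0).
  have E : (fun h : R => h^-1 *: ((phi j \o shift x) (h *: basis_vec R i) - phi j x))
     = (fun h : R => h^-1 *: ((expinv j \o shift (x 0 0)) (h *: 1) - expinv j (x 0 0))).
    apply/funext => h; rewrite /phi /= !mxE (ord1 i) !eqxx.
    by [].
  by apply: DeriveDef; rewrite ?/derivable ?/derive E.
have comb s : exists l : seq (R * nat),
    partials s (phi k) = (fun x => \sum_(p <- l) p.1 * phi p.2 x).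
  elim: s => [|i s [l IHs]].
    by exists [:: (1, k)]; apply/funext => x; rewrite big_seq1 mul1r.
  exists (flatten [seq [:: (p.1, p.2.+2); (- p.1 * p.2%:R, p.2.+1)] | p <- l]).
  apply/funext => x; rewrite /= IHs.
  have H := is_derive_bigsum (fun p (_ : p \in l) => is_deriveZ p.1 (dphi p.2 i x)).
  have <- : (fun y => \sum_(p <- l) (p.1 *: phi p.2) y) =
      (fun x => \sum_(p <- l) p.1 * phi p.2 x) by [].
  rewrite (@derive_val _ _ _ _ _ _ _ H) big_flatten big_map; apply: eq_bigr => p _.
  by rewrite !big_cons big_nil /= addr0 /GRing.scale /=; ring.
move=> s x _; have [l ->] := comb s; split=> [|i].
  apply: continuous_bigsum => p _; apply: continuousM; first exact: cst_continuous.
  apply: (@continuous_comp _ _ _ (fun x : 'rV[R]_1 => x 0 0) (expinv p.2)).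
    exact: coord_continuous.
  apply: differentiable_continuous; apply/derivable1_diffP.
  by have [] := is_derive_expinv p.2 (x 0 0).
have H := is_derive_bigsum (fun p (_ : p \in l) => is_deriveZ p.1 (dphi p.2 i x)).
exact: (@ex_derive _ _ _ _ _ _ _ H).
Qed.

Lemma smooth_on_expinv_comp n (U : set 'rV[R]_n) k f : open U ->
  smooth_on U f -> smooth_on U (expinv k \o f).
Proof.
move=> oU sf.
have E : expinv k \o f = (fun x : 'rV[R]_1 => expinv k (x 0 0)) \o
    (fun y : 'rV[R]_n => (\row_(j < 1) f y)).
  by apply/funext => y /=; rewrite mxE.
have st : smooth_map_on U (fun y : 'rV[R]_n => \row_(j < 1) f y).
  by move=> j; apply: (smooth_on_eq oU _ sf) => x _; rewrite mxE.
by rewrite E; exact: (smooth_on_comp oU openT st (fun _ _ => I) (smooth_on_expinv k)).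
Qed.

(** With E(t) = exp(-1/t) for t > 0 and 0 otherwise, kappa = E(1/2) and
    q(x) = sum of the squares of the coordinates, take
    chi = E(kappa - E(q - 1/2)) / E(kappa).  It equals 1 where q <= 1/2, and
    vanishes where q >= 1, since E is monotone.  Only a constant is divided by,
    so compositions of E suffice for smoothness. *)
Lemma bump_exists n : exists chi : 'rV[R]_n -> R,
  [/\ smooth_on setT chi, \forall x \near (0 : 'rV[R]_n), chi x = 1 &
    forall x : 'rV[R]_n, 1 <= `|x| -> chi x = 0].
Proof.
pose q (x : 'rV[R]_n) := \sum_i x 0 i * x 0 i.
pose kappa := expinv 0 (1 / 2).
have kappa0 : 0 < kappa by apply: expinv0_gt0; lra.
have sq : smooth_on setT q.
  rewrite /q; elim: (index_enum _) => [|i r IHr].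
    by under eq_fun do rewrite big_nil; exact: smooth_on_cst.
  under eq_fun do rewrite big_cons.
  apply: (@smooth_on_eq _ _ _ (fun x => 1 * (x 0 i * x 0 i) +
     1 * \sum_(j <- r) x 0 j * x 0 j) _ openT).
    by move=> x _; rewrite !mul1r.
  apply: smooth_on_lincomb; [exact: openT| |exact: IHr].
  by apply: (smooth_on_mul openT); exact: smooth_on_coord.
have sA (a b : R) f : smooth_on setT f -> smooth_on setT (fun x : 'rV[R]_n => a * f x + b).
  move=> sf; apply: (@smooth_on_eq _ _ _ (fun x => a * f x + b * cst 1 x) _ openT).
    by move=> x _; rewrite mulr1.
  by apply: smooth_on_lincomb; [exact: openT|exact: sf|exact: smooth_on_cst].
pose chi x := (expinv 0 kappa)^-1 * expinv 0 (kappa - expinv 0 (q x - 1 / 2)).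
have nz : expinv 0 kappa != 0 by rewrite gt_eqF// expinv0_gt0.
exists chi; split.
- have s1 := smooth_on_expinv_comp 0 openT (sA 1 (- (1 / 2)) _ sq).
  have s2 := smooth_on_expinv_comp 0 openT (sA (-1) kappa _ s1).
  apply: (smooth_on_eq openT _ (sA (expinv 0 kappa)^-1 0 _ s2)) => x _ /=.
  by rewrite addr0 mul1r mulN1r addrC.
- have cq : {for 0, continuous q} by exact: (smooth_on_continuous sq).
  have q0 : q 0 = 0 by rewrite /q big1// => i _; rewrite mxE mul0r.
  have H : \forall x \near (0 : 'rV[R]_n), `|q 0 - q x| < 1 / 2.
    by move/cvgrPdist_lt : cq; apply; lra.
  apply: filterS H => x; rewrite q0 sub0r normrN => qx.
  have E : expinv 0 (q x - 1 / 2) = 0.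
    rewrite /expinv ifF//; apply/negbTE; rewrite -leNgt subr_le0.
    exact: le_trans (ler_norm _) (ltW qx).
  by rewrite /chi E subr0 mulVf.
- move=> x x1.
  have q1 : 1 <= q x.
    have [i xi] : exists i, `|x| = `|x 0 i|.
      have [[i j] /= E] : exists ij : 'I_1 * 'I_n, `|x| = `|x ij.1 ij.2|.
        apply: mx_norm_neq0; have : 0 < `|x| by rewrite (lt_le_trans _ x1).
        exact: lt0r_neq0.
      by exists j; rewrite E (ord1 i).
    rewrite /q (bigD1 i)//= ler_wpDr ?sumr_ge0// => [j _|].
      by rewrite -expr2 sqr_ge0.
    by rewrite -expr2 -real_normK ?num_real// -xi exprn_ege1.
  have E : kappa - expinv 0 (q x - 1 / 2) <= 0.
    by rewrite subr_le0; apply: expinv0_le; lra.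
  by rewrite /chi {2}/expinv ltNge E mulr0.
Qed.

End ExpInv.

(** * Functions with vanishing Taylor polynomial *)

Section Flat.
Variable R : realType.

Fixpoint short_seqs n N : seq (seq 'I_n) :=
  if N is N'.+1 then
    [::] :: [seq i :: s | i <- enum 'I_n, s <- short_seqs n N'] else [:: [::]].

Lemma mem_short_seqs n N (s : seq 'I_n) : (s \in short_seqs n N) = (size s <= N)%N.
Proof.
elim: N s => [|N IHN] [|i s] //=; rewrite inE/=.
apply/allpairsP/idP => [[[j t] /= [_ tN [_ ->]]]|sN]; first by rewrite ltnS -IHN.
by exists (i, s); split=> //=; rewrite ?mem_enum// IHN.
Qed.

Lemma near_all (T : topologicalType) (I : eqType) (r : seq I) (P : I -> T -> Prop) (x : T) :
  (forall i, i \in r -> \forall y \near x, P i y) ->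
  \forall y \near x, forall i, i \in r -> P i y.
Proof.
elim: r => [_|i r IHr H]; first by apply: nearW.
have Hi := H i (mem_head _ _).
have Hr : \forall y \near x, forall i, i \in r -> P i y.
  by apply: IHr => j jr; apply: H; rewrite inE jr orbT.
apply: filterS2 Hi Hr => y Pi Pr j; rewrite inE => /orP[/eqP ->//|].
exact: Pr.
Qed.

Lemma all_bounded (I : eqType) (r : seq I) (T : Type) (F : I -> T -> R) :
  (forall i, i \in r -> exists C : R, forall x, `|F i x| <= C) ->
  exists C : R, forall i, i \in r -> forall x, `|F i x| <= C.
Proof.
elim: r => [_|i r IHr H]; first by exists 0.
have [C HC] := H i (mem_head _ _).
have [D HD] : exists D : R, forall i, i \in r -> forall x, `|F i x| <= D.
  by apply: IHr => j jr; apply: H; rewrite inE jr orbT.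
exists (Num.max C D) => j; rewrite inE => /orP[/eqP ->|jr] x.
  by rewrite le_max HC.
by rewrite le_max (HD _ jr) orbT.
Qed.

Lemma partials_cst0 n s (x : 'rV[R]_n) : partials s (cst 0) x = 0.
Proof.
have -> : partials s (cst 0) = cst 0 :> ('rV[R]_n -> R).
  by elim: s => //= i s ->; apply/funext => y; rewrite derive_cst.
by [].
Qed.

(** The derivatives are continuous on the compact unit box and vanish outside. *)
Lemma partials_bounded n (chi : 'rV[R]_n -> R) s : smooth_on setT chi ->
  (forall x : 'rV[R]_n, 1 <= `|x| -> chi x = 0) ->
  exists C : R, forall x, `|partials s chi x| <= C.
Proof.
move=> sc c0.
have out x : 1 < `|x| -> partials s chi x = 0.
  move=> x1; have oU : open [set y : 'rV[R]_n | 1 < `|y|].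
    apply: (@open_comp _ _ (fun y : 'rV[R]_n => `|y|) [set t : R | 1 < t]).
      by move=> y _; exact: norm_continuous.
    exact: open_gt.
  have -> : partials s chi x = partials s (cst 0) x.
    have E y : 1 < `|y| -> chi y = cst 0 y by move=> /ltW /c0.
    exact: (eq_partials_on s oU E).
  by rewrite partials_cst0.
have cK : compact [set y : 'rV[R]_n | `|y| <= 1].
  apply: bounded_closed_compact.
    by exists 1; split=> // M M1 x /= x1; exact: le_trans x1 (ltW M1).
  apply: (@closed_comp _ _ (fun y : 'rV[R]_n => `|y|) [set t : R | t <= 1]).
    by move=> y _; exact: norm_continuous.
  exact: closed_le.
have cs : continuous (partials s chi) by move=> x; have [] := sc s x I.
have /compact_bounded[M [_ HM]] :=
  continuous_compact (continuous_subspaceT cs) cK.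
exists (`|M| + 1) => x; have [x1|x1] := lerP `|x| 1.
  apply: HM; first by rewrite (le_lt_trans (ler_norm M))// ltrDl.
  by exists x.
by rewrite out// normr0 addr_ge0.
Qed.

Definition flat_at n N (F : 'rV[R]_n -> R) a :=
  forall s : seq 'I_n, (size s <= N)%N -> partials s F a = 0.

(** Taylor estimates for a flat function, by descending induction on the order of
    the derivative: derivatives of order N are smaller than a multiple
    of eta near a since they vanish at a, and each mean value estimate gains a factor r and loses a
    factor n. *)
Lemma flat_bound n (U : set 'rV[R]_n) F a N (eta : R) : open U -> smooth_on U F -> U a ->
  flat_at N F a -> 0 < eta ->
  exists2 rho, 0 < rho & forall s, (size s <= N)%N -> forall (r : R) (x : 'rV[R]_n),
    `|x - a| <= r -> r <= rho ->
    U x /\ `|partials s F x| <= eta * r ^+ (N - size s).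
Proof.
move=> oU sF Ua Fa eta0.
pose eta' := eta / n.+1%:R ^+ N.
have eta'0 : 0 < eta' by rewrite divr_gt0// exprn_gt0.
have : \forall y \near a, U y /\ forall s, s \in short_seqs n N ->
    `|partials s F y| < eta'.
  apply: filterI; first exact: open_nbhs_nbhs.
  apply: (@near_all _ _ _ (fun s y => `|partials s F y| < eta') a) => s.
  rewrite mem_short_seqs => sN.
  have [cF _] := sF s a Ua; move/cvgrPdist_lt : cF => /(_ _ eta'0).
  by apply: filterS => y; rewrite Fa// sub0r normrN.
move=> /nbhs_ballP[r0 /= r00 H].
have r020 : 0 < r0 / 2 by rewrite divr_gt0.
exists (r0 / 2) => //.
have in_ball r x : `|x - a| <= r -> r <= r0 / 2 -> ball a r0 x.
  by rewrite -ball_normE/= distrC => xr rr; lra.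
suff main j s : (size s + j = N)%N -> forall r x, `|x - a| <= r -> r <= r0 / 2 ->
    `|partials s F x| <= eta' * n%:R ^+ j * r ^+ j.
  move=> s sN r x xr rr; split; first by have [] := H _ (in_ball r x xr rr).
  apply: le_trans (main _ s (subnKC sN) r x xr rr) _.
  have r_ge0 : 0 <= r by exact: le_trans xr.
  apply: ler_wpM2r; first exact: exprn_ge0.
  rewrite /eta' mulrAC ler_pdivrMr ?exprn_gt0//.
  apply: ler_wpM2l; first exact: ltW.
  apply: (@le_trans _ _ (n.+1%:R ^+ (N - size s))).
    by apply: lerXn2r; rewrite ?nnegrE// ler_nat.
  by apply: ler_weXn2l; rewrite ?leq_subr// ler1n.
elim: j s => [|j IHj] s sj r x xr rr.
  rewrite !expr0 !mulr1 ltW//; have [_ +] := H _ (in_ball r x xr rr).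
  by apply; rewrite mem_short_seqs -sj addn0.
have Fs : partials s F a = 0 by apply: Fa; rewrite -sj leq_addr.
have key y : `|y - a| <= r -> forall i, derivable (partials s F) y (basis_vec R i) /\
    `|'D_(basis_vec R i) (partials s F) y - 0| <= eta' * n%:R ^+ j * r ^+ j.
  move=> yr i; have [Uy _] := H _ (in_ball r y yr rr).
  split; first by have [_] := sF s y Uy; exact.
  rewrite subr0; apply: (IHj (i :: s) _ r y yr rr).
  by rewrite /= addSnnS.
have := box_increment (L := fun=> 0) key xr.
rewrite big1 => [|i _]; last by rewrite mulr0.
rewrite subr0 Fs subr0 [a + _]addrC subrK => /le_trans; apply.
have r_ge0 : 0 <= r by exact: le_trans xr.
rewrite -[_ *+ n]mulr_natr.
have -> : eta' * n%:R ^+ j.+1 * r ^+ j.+1 = eta' * n%:R ^+ j * r ^+ j * n%:R * r.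
  by rewrite !exprS; ring.
by rewrite ler_wpM2l// !mulr_ge0 ?exprn_ge0// ltW.
Qed.

(** Each derivative of the cut-off function at scale rho costs a factor rho^-1,
    and by [flat_bound] each derivative not taken on the N-flat function F gains
    a factor rho; so the terms of the Leibniz rule are bounded by
    eta rho^(N - |s|), with eta as small as wanted. *)
Lemma cutoff_flat n (chi : 'rV[R]_n -> R) (U : set 'rV[R]_n) F a N (delta : R) :
  smooth_on setT chi -> (forall x : 'rV[R]_n, 1 <= `|x| -> chi x = 0) ->
  open U -> smooth_on U F -> U a -> flat_at N F a -> 0 < delta ->
  exists2 rho0, 0 < rho0 & forall rho, 0 < rho -> rho <= rho0 ->
    forall s, (size s <= N)%N -> forall x, U x ->
    `|partials s (fun y => chi (rho^-1 *: (y - a)) * F y) x| <= delta.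
Proof.
move=> sc c0 oU sF Ua Fa delta0.
have [C HC] : exists C : R, forall s, s \in short_seqs n N -> forall x, `|partials s chi x| <= C.
  by apply: all_bounded => s _; exact: partials_bounded.
have C0 : 0 <= C.
  by apply: le_trans (HC [::] _ 0) => //; rewrite mem_short_seqs.
(* The Leibniz sum has at most 2^N terms, each bounded by C eta. *)
pose eta := delta / (2 ^+ N * (C + 1)).
have eta0 : 0 < eta by rewrite divr_gt0// mulr_gt0 ?exprn_gt0// ltr_wpDl.
have [rho1 rho10 HF] := flat_bound oU sF Ua Fa eta0.
exists (Num.min rho1 1); first by rewrite lt_min rho10/=.
move=> rho rho0; rewrite le_min => /andP[rr1 rho1'] s sN x Ux.
(* Beyond the scale rho the cut-off function vanishes identically. *)
have [far|near_a] := ltrP rho `|x - a|.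
  have oV : open (U `&` [set y : 'rV[R]_n | rho < `|y - a|]).
    apply: openI => //.
    apply: (@open_comp _ _ (fun y : 'rV[R]_n => `|y - a|) [set t : R | rho < t]).
      move=> y _; have cB : {for y, continuous (fun z : 'rV[R]_n => z - a)}.
        by apply: continuousB; [exact: cvg_id|exact: cst_continuous].
      exact: (cvg_norm cB).
    exact: open_gt.
  have -> : partials s (fun y => chi (rho^-1 *: (y - a)) * F y) x =
     partials s (cst 0) x.
    have E y : (U `&` [set y : 'rV[R]_n | rho < `|y - a|]) y ->
        chi (rho^-1 *: (y - a)) * F y = cst 0 y.
      move=> [Uy /= ry]; rewrite c0 ?mul0r// normrZ gtr0_norm ?invr_gt0//.
      by rewrite ler_pdivlMl// mulr1 ltW.
    by apply: (eq_partials_on s oV E).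
  by rewrite partials_cst0 normr0 ltW.
rewrite (partials_mul oU (smooth_on_scale a rho^-1 oU sc) sF)//.
apply: le_trans (ler_norm_sum _ _ _) _.
apply: (@le_trans _ _ (\sum_(p <- splits s) (C * eta))).
  rewrite big_seq [leRHS]big_seq; apply: ler_sum => p ps.
  have sp := size_splits ps.
  rewrite partials_scale// !normrM -[C * eta]mulr1.
  have p2N : (size p.2 <= N)%N by apply: leq_trans sN; rewrite -sp leq_addl.
  have p1N : (size p.1 <= N)%N by apply: leq_trans sN; rewrite -sp leq_addr.
  have [_ B2] := HF p.2 p2N rho x near_a rr1.
  have B1 : `|partials p.1 chi (rho^-1 *: (x - a))| <= C by apply: HC; rewrite mem_short_seqs.
  rewrite normrX gtr0_norm ?invr_gt0//.
  apply: (@le_trans _ _ (rho^-1 ^+ size p.1 * C * (eta * rho ^+ (N - size p.2)))).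
    apply: ler_pM => //; first by rewrite mulr_ge0// exprn_ge0// invr_ge0 ltW.
    by rewrite ler_wpM2l// exprn_ge0// invr_ge0 ltW.
  have -> : (N - size p.2 = size p.1 + (N - size s))%N.
    rewrite -sp addnC in sN *; rewrite subnDA [RHS]addnC subnK// leq_subRL//.
  rewrite exprD.
  have -> : rho^-1 ^+ size p.1 * C * (eta * (rho ^+ size p.1 * rho ^+ (N - size s)))
     = C * eta * ((rho^-1 * rho) ^+ size p.1 * rho ^+ (N - size s)).
    by rewrite exprMn; ring.
  rewrite mulVf ?gt_eqF// expr1n mul1r; apply: ler_wpM2l.
    by rewrite mulr_ge0// ltW.
  by rewrite exprn_ile1// ltW.
have size_sp : size (splits s) = (2 ^ size s)%N.
  elim: (s) => [//|i s' IHs'] /=; rewrite size_cat !size_map IHs' expnS.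
  by rewrite mul2n addnn.
rewrite big_const_seq count_predT iter_addr_0 size_sp -mulr_natl natrX.
apply: (@le_trans _ _ (2 ^+ N * ((C + 1) * eta))).
  apply: ler_pM.
  - exact: exprn_ge0.
  - by apply: mulr_ge0 => //; exact: ltW.
  - by apply: ler_weXn2l => //; rewrite ler1n.
  by apply: ler_wpM2r; [exact: ltW|rewrite lerDl].
rewrite /eta mulrA [_ * (_ / _)]mulrC divfK//.
apply: lt0r_neq0; apply: mulr_gt0; first exact: exprn_gt0.
by rewrite ltr_wpDl.
Qed.

End Flat.

(** * Charts *)

Section Charts.
Variables (R : realType) (n : nat) (M : topologicalType) (c : chart R n M).

Lemma chart_imgP u : chart_img c u ->
  chart_dom c (chart_inv c u) /\ chart_map c (chart_inv c u) = u.
Proof. by move=> [x cx <-]; rewrite chart_mapK. Qed.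

Lemma chart_img_map x : chart_dom c x -> chart_img c (chart_map c x).
Proof. by exists x. Qed.

Lemma chart_img_setI (W : set M) :
  chart_map c @` (chart_dom c `&` W) = chart_img c `&` (chart_inv c @^-1` W).
Proof.
apply/seteqP; split=> [_ [x [cx Wx] <-]|u [cu Wu]].
  by split; [exists x|rewrite /= chart_mapK].
by have [? E] := chart_imgP cu; exists (chart_inv c u).
Qed.

Lemma open_chart_img (W : set M) : open W -> open (chart_map c @` (chart_dom c `&` W)).
Proof.
move=> oW; rewrite chart_img_setI openE => u [cu Wu].
apply: filterI; first by apply: open_nbhs_nbhs; split=> //; exact: chart_img_open.
by apply: (chart_inv_continuous cu); exact: open_nbhs_nbhs.
Qed.

Lemma open_chart_preimage (V : set 'rV[R]_n) : open V ->
  open (chart_dom c `&` chart_map c @^-1` V).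
Proof.
move=> oV; rewrite openE => x [cx Vx].
apply: filterI; first by apply: open_nbhs_nbhs; split=> //; exact: chart_dom_open.
by apply: (chart_map_continuous cx); exact: open_nbhs_nbhs.
Qed.

End Charts.

(** * Smooth maps of manifolds *)

Section SmoothReal.
Variable R : realType.
Implicit Types M N P : manifold R.

(** Coordinates of a map in a chart of the target are only meaningful on the
    preimage of its domain; smoothness of maps is reduced to that of real
    functions on such open subsets. *)
Definition smooth_real M (W : set M) (h : M -> R) : Prop :=
  forall c, atlas M c ->
    smooth_on (chart_map c @` (chart_dom c `&` W)) (h \o chart_inv c).

Lemma smooth_realS M (W W' : set M) h : W' `<=` W ->
  smooth_real W h -> smooth_real W' h.
Proof.
by move=> WW' sh c Mc; apply: smooth_onS (sh c Mc); apply: image_subset; exact: setIS.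
Qed.

(** Smoothness can be tested in one chart around each point, because the
    transition maps are smooth. *)
Lemma smooth_real_chart M (W : set M) h :
  (forall x, W x -> exists c (V : set 'rV[R]_(mdim M)), [/\ atlas M c, chart_dom c x, open V,
     V (chart_map c x) & smooth_on V (h \o chart_inv c)]) ->
  smooth_real W h.
Proof.
move=> H c' Mc'; apply: smooth_on_local => _ [x [c'x Wx] <-].
have [c [V [Mc cx oV Vx sV]]] := H x Wx.
pose D := chart_dom c `&` chart_map c @^-1` V.
have oD : open D by exact: open_chart_preimage.
exists (chart_map c' @` (chart_dom c' `&` D)); split; first by exists x.
have st : smooth_map_on (chart_map c' @` (chart_dom c' `&` D)) (transition c' c).
  move=> j; apply: smooth_onS (atlas_compatible Mc' Mc j).
  by apply: image_subset => y [c'y [cy _]].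
have tV u : (chart_map c' @` (chart_dom c' `&` D)) u -> V (transition c' c u).
  by move=> [y [c'y [cy Vy]] <-]; rewrite /transition /= chart_mapK.
have oU := open_chart_img (c := c') oD.
have sc := smooth_on_comp oU oV st tV sV.
apply: (smooth_on_eq oU _ sc) => u [y [c'y [cy Vy]] <-].
by rewrite /transition /= !chart_mapK.
Qed.

Lemma smooth_mapP M N (phi : M -> N) : continuous phi ->
  (forall d j, atlas N d ->
    smooth_real (phi @^-1` chart_dom d) (fun x => chart_map d (phi x) 0 j)) ->
  smooth_map phi.
Proof. by move=> cphi H; split=> // c d Mc Nd j; exact: H. Qed.

Lemma smooth_real_comp M N (phi : M -> N) (W : set N) h : smooth_map phi ->
  open W -> smooth_real W h -> smooth_real (phi @^-1` W) (h \o phi).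
Proof.
move=> [cphi sphi] oW sh; apply: smooth_real_chart => x Wx.
have [c Mc cx] := atlas_cover x; have [d Nd dx] := atlas_cover (phi x).
pose D := phi @^-1` (chart_dom d `&` W).
have oD : open D.
  apply: open_comp; first by move=> y _; exact: cphi.
  by apply: openI => //; exact: chart_dom_open.
have oU := open_chart_img (c := c) oD.
exists c, (chart_map c @` (chart_dom c `&` D)); split=> //; first by exists x.
have oV := open_chart_img (c := d) oW.
have st : smooth_map_on (chart_map c @` (chart_dom c `&` D))
    (chart_map d \o phi \o chart_inv c).
  move=> j; apply: smooth_onS (sphi c d Mc Nd j).
  by apply: image_subset => y [cy [dy _]].
have tV u : (chart_map c @` (chart_dom c `&` D)) u ->
    (chart_map d @` (chart_dom d `&` W)) ((chart_map d \o phi \o chart_inv c) u).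
  by move=> [y [cy Dy] <-]; rewrite /= chart_mapK//; exists (phi y).
apply: (smooth_on_eq oU _ (smooth_on_comp oU oV st tV (sh d Nd))).
by move=> u [y [cy [dy _]] <-]; rewrite /= !chart_mapK.
Qed.

Lemma smooth_real_cst M (W : set M) a : smooth_real W (cst a).
Proof. by move=> c Mc; exact: smooth_on_cst. Qed.

Lemma smooth_map_comp M N P (phi : M -> N) (psi : N -> P) :
  smooth_map phi -> smooth_map psi -> smooth_map (psi \o phi).
Proof.
move=> sphi spsi; apply: smooth_mapP => [x|d j Pd].
  by apply: continuous_comp; [exact: sphi.1|exact: spsi.1].
have oW : open (psi @^-1` chart_dom d).
  by apply: open_comp => [y _|]; [exact: spsi.1|exact: chart_dom_open].
apply: (smooth_real_comp (h := fun y => chart_map d (psi y) 0 j) sphi oW) => c Nc.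
exact: spsi.2.
Qed.

Lemma smooth_map_id M : smooth_map (@id M).
Proof.
apply: smooth_mapP => [x //|d j Md c Mc].
exact: (atlas_compatible Mc Md).
Qed.

Lemma smooth_map_cst M N (y : N) : smooth_map (fun _ : M => y).
Proof.
apply: smooth_mapP => [x|d j Nd]; first exact: cst_continuous.
exact: smooth_real_cst.
Qed.

Lemma smooth_fst M N : smooth_map (fst : prod_manifold M N -> M).
Proof.
apply: smooth_mapP => [x|d j Md]; first exact: cvg_fst.
apply: smooth_real_chart => -[x y] /= dx.
have [c Nc cy] := atlas_cover y.
exists (prod_chart d c), (chart_img (prod_chart d c)); split=> //.
- by exists d => //; exists c.
- exact: chart_img_open.
- by exists (x, y).
apply: (@smooth_on_eq _ _ _ (fun u => u 0 (lshift _ j))).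
- exact: chart_img_open.
- move=> u [[x' y'] [/= dx' cy'] <-] /=.
  by rewrite /prod_map row_mxKl chart_mapK// row_mxEl.
exact: smooth_on_coord.
Qed.

Lemma smooth_snd M N : smooth_map (snd : prod_manifold M N -> N).
Proof.
apply: smooth_mapP => [x|d j Nd]; first exact: cvg_snd.
apply: smooth_real_chart => -[x y] /= dy.
have [c Mc cx] := atlas_cover x.
exists (prod_chart c d), (chart_img (prod_chart c d)); split=> //.
- by exists c => //; exists d.
- exact: chart_img_open.
- by exists (x, y).
apply: (@smooth_on_eq _ _ _ (fun u => u 0 (rshift _ j))).
- exact: chart_img_open.
- move=> u [[x' y'] [/= cx' dy'] <-] /=.
  by rewrite /prod_map row_mxKr chart_mapK// row_mxEr.
exact: smooth_on_coord.
Qed.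

Lemma smooth_pair M N P (phi : P -> M) (psi : P -> N) :
  smooth_map phi -> smooth_map psi ->
  smooth_map ((fun x => (phi x, psi x)) : P -> prod_manifold M N).
Proof.
move=> sphi spsi; apply: smooth_mapP => [x|_ j [d1 Md1 [d2 Nd2 <-]]].
  by apply: cvg_pair; [exact: sphi.1|exact: spsi.1].
case: (split_ordP j) => k ->.
  have -> : (fun x => chart_map (prod_chart d1 d2) (phi x, psi x) 0 (lshift _ k)) =
     (fun x => chart_map d1 (phi x) 0 k).
    by apply/funext => x /=; rewrite /prod_map row_mxEl.
  apply: (@smooth_realS _ (phi @^-1` chart_dom d1)) => [x [] //|c Pc].
  exact: (sphi.2 c d1 Pc Md1).
have -> : (fun x => chart_map (prod_chart d1 d2) (phi x, psi x) 0 (rshift _ k)) =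
   (fun x => chart_map d2 (psi x) 0 k).
  by apply/funext => x /=; rewrite /prod_map row_mxEr.
apply: (@smooth_realS _ (psi @^-1` chart_dom d2)) => [x [] //|c Pc].
exact: (spsi.2 c d2 Pc Nd2).
Qed.

End SmoothReal.

(** * Partial derivatives of functions with real or complex values *)

Section Scalars.
Variables (R : realType) (K : numFieldType) (k : real_or_complex R K).

Definition of_components : R -> R -> K :=
  match k in real_or_complex _ K return R -> R -> K with
  | Real_scalars => fun x _ => x
  | Complex_scalars => fun x y => Complex x y
  end.

Local Notation cpt := (component k).

Lemma of_componentsK (z : K) : of_components (cpt false z) (cpt true z) = z.
Proof. by move: z; rewrite /of_components /component; case: k => // -[]. Qed.

Lemma component_inj (y z : K) : (forall im, cpt im y = cpt im z) -> y = z.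
Proof. by move=> H; rewrite -[y]of_componentsK -[z]of_componentsK !H. Qed.

Lemma component0 im : cpt im 0 = 0.
Proof. by rewrite /component; case: k im => -[]. Qed.

Lemma componentD im (x y : K) : cpt im (x + y) = cpt im x + cpt im y.
Proof.
by move: x y; rewrite /component; case: k im => -[] //= => [x y|[? ?] [? ?]|[? ?] [? ?]] //; rewrite addr0.
Qed.

Lemma componentM im (x y : K) : cpt im (x * y) =
  if im then cpt false x * cpt true y + cpt true x * cpt false y
  else cpt false x * cpt false y - cpt true x * cpt true y.
Proof.
move: x y; rewrite /component; case: k im => -[] //= => [x y|x y|[? ?] [? ?]|[? ?] [? ?]] //.
- by rewrite mulr0 mul0r addr0.
- by rewrite mulr0 subr0.
Qed.

Lemma component_sum (I : Type) im (r : seq I) (F : I -> K) :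
  cpt im (\sum_(i <- r) F i) = \sum_(i <- r) cpt im (F i).
Proof. exact: (big_morph _ (componentD im) (component0 im)). Qed.

Definition of_real (a : R) : K := of_components a 0.

Lemma component_real im a (z : K) : cpt im (of_real a * z) = a * cpt im z.
Proof.
rewrite componentM; have -> : cpt true (of_real a) = 0.
  by rewrite /of_real /of_components /component; case: k.
have -> : cpt false (of_real a) = a.
  by rewrite /of_real /of_components /component; case: k.
by case: im; rewrite mul0r ?addr0 ?subr0.
Qed.

Lemma component1 im : cpt im 1 = if im then 0 else 1.
Proof. by rewrite /component; case: k im => -[]. Qed.

Lemma component_of_real im a : cpt im (of_real a) = if im then 0 else a.
Proof. by rewrite -[of_real a]mulr1 component_real component1; case: im; rewrite ?mulr0 ?mulr1. Qed.

Definition ksmooth_on n (U : set 'rV[R]_n) (F : 'rV[R]_n -> K) :=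
  forall im, smooth_on U (cpt im \o F).

Definition kpartials n (s : seq 'I_n) (F : 'rV[R]_n -> K) (x : 'rV[R]_n) : K :=
  of_components (partials s (cpt false \o F) x) (partials s (cpt true \o F) x).

(** For real scalars the second component is the zero function, whose derivatives
    vanish; this is what makes the equation uniform in the scalars. *)
Lemma component_kpartials n im s (F : 'rV[R]_n -> K) x :
  cpt im (kpartials s F x) = partials s (cpt im \o F) x.
Proof.
rewrite /kpartials /of_components; move: F; rewrite /component.
case: k im => -[] F //=; rewrite -[fun _ => 0]/(cst 0).
have -> : (cst 0 \o F) = cst 0 by [].
by rewrite partials_cst0.
Qed.

End Scalars.

Section Kpartials.
Variables (R : realType) (K : numFieldType) (k : real_or_complex R K).
Local Notation cpt := (component k).
Local Notation ksmooth := (ksmooth_on k).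
Local Notation kpar := (kpartials k).

Lemma ksmooth_onS n (U V : set 'rV[R]_n) F : V `<=` U -> ksmooth U F -> ksmooth V F.
Proof. by move=> VU sF im; exact: smooth_onS VU (sF im). Qed.

Lemma ksmooth_on_eq n (U : set 'rV[R]_n) F G : open U -> (forall x, U x -> F x = G x) ->
  ksmooth U F -> ksmooth U G.
Proof.
move=> oU FG sF im; apply: (smooth_on_eq oU _ (sF im)) => x Ux /=.
by rewrite FG.
Qed.

Lemma eq_kpartials_on n (U : set 'rV[R]_n) F G s x : open U ->
  (forall y, U y -> F y = G y) -> U x -> kpar s F x = kpar s G x.
Proof.
move=> oU FG Ux; apply: (@component_inj _ _ k) => im; rewrite !component_kpartials.
by apply: (eq_partials_on s oU _ Ux) => y Uy /=; rewrite FG.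
Qed.

Lemma kpartials0 n s (x : 'rV[R]_n) : kpar s (cst 0) x = 0.
Proof.
apply: (@component_inj _ _ k) => im; rewrite component_kpartials component0.
have -> : cpt im \o cst 0 = cst 0 :> ('rV[R]_n -> R).
  by apply/funext => y /=; exact: component0.
exact: partials_cst0.
Qed.

Lemma ksmooth_on_cst n (U : set 'rV[R]_n) a : ksmooth U (cst a).
Proof. by move=> im; exact: (@smooth_on_cst R n U (cpt im a)). Qed.

Lemma ksmooth_lincomb n (U : set 'rV[R]_n) (a : K) F G : open U ->
  ksmooth U F -> ksmooth U G -> ksmooth U (fun x => a * F x + G x).
Proof.
move=> oU sF sG im; have [p [q E]] := component_lincomb k a im.
have -> : cpt im \o (fun x => a * F x + G x) = (fun u =>
    1 * (p * (cpt false \o F) u + q * (cpt true \o F) u) + 1 * (cpt im \o G) u).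
  by apply/funext => u; rewrite !mul1r; exact: E.
by apply: (smooth_on_lincomb _ _ oU); [apply: (smooth_on_lincomb _ _ oU)|].
Qed.

Lemma kpartials_lincomb n (U : set 'rV[R]_n) (a : K) F G s x : open U ->
  ksmooth U F -> ksmooth U G -> U x ->
  kpar s (fun x => a * F x + G x) x = a * kpar s F x + kpar s G x.
Proof.
move=> oU sF sG Ux; apply: (@component_inj _ _ k) => im.
have [p [q E]] := component_lincomb k a im.
rewrite E !component_kpartials.
have -> : cpt im \o (fun x => a * F x + G x) = (fun u =>
    1 * (p * (cpt false \o F) u + q * (cpt true \o F) u) + 1 * (cpt im \o G) u).
  by apply/funext => u; rewrite !mul1r; exact: E.
have sFF := smooth_on_lincomb p q oU (sF false) (sF true).
by rewrite (partials_lincomb 1 1 s oU sFF (sG im)) ?inE// !mul1r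
  (partials_lincomb p q s oU (sF false) (sF true)) ?inE.
Qed.

Lemma ksmooth_sum (I : Type) n (U : set 'rV[R]_n) (r : seq I) (a : I -> K)
    (F : I -> 'rV[R]_n -> K) : open U ->
  (forall i, ksmooth U (F i)) -> ksmooth U (fun x => \sum_(i <- r) a i * F i x).
Proof.
move=> oU sF; elim: r => [|i r IHr].
  by under eq_fun do rewrite big_nil; exact: ksmooth_on_cst.
under eq_fun do rewrite big_cons.
exact: (ksmooth_lincomb (a i) oU (sF i) IHr).
Qed.

Lemma kpartials_sum (I : Type) n (U : set 'rV[R]_n) (r : seq I) (a : I -> K)
    (F : I -> 'rV[R]_n -> K) s x : open U ->
  (forall i, ksmooth U (F i)) -> U x ->
  kpar s (fun x => \sum_(i <- r) a i * F i x) x = \sum_(i <- r) a i * kpar s (F i) x.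
Proof.
move=> oU sF Ux; elim: r => [|i r IHr].
  under eq_fun do rewrite big_nil.
  by rewrite big_nil; exact: kpartials0.
under eq_fun do rewrite big_cons.
rewrite big_cons -IHr (kpartials_lincomb _ _ oU)//.
exact: ksmooth_sum.
Qed.

Lemma ksmooth_mul n (U : set 'rV[R]_n) F G : open U ->
  ksmooth U F -> ksmooth U G -> ksmooth U (fun x => F x * G x).
Proof.
move=> oU sF sG im.
have sM a b := smooth_on_mul oU (sF a) (sG b).
case: im.
  apply: (smooth_on_eq oU _ (smooth_on_lincomb 1 1 oU (sM false true) (sM true false))).
  by move=> x _ /=; rewrite componentM !mul1r.
apply: (smooth_on_eq oU _ (smooth_on_lincomb 1 (-1) oU (sM false false) (sM true true))).
by move=> x _ /=; rewrite componentM mul1r mulN1r.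
Qed.

Lemma kpartials_cat n s t (F : 'rV[R]_n -> K) : kpar (s ++ t) F = kpar s (kpar t F).
Proof.
apply/funext => x; apply: (@component_inj _ _ k) => im.
rewrite !component_kpartials partials_cat; congr (partials s _ x).
by apply/funext => y /=; rewrite component_kpartials.
Qed.

Lemma ksmooth_kpartials n (U : set 'rV[R]_n) s F : ksmooth U F -> ksmooth U (kpar s F).
Proof.
move=> sF im; have -> : cpt im \o kpar s F = partials s (cpt im \o F).
  by apply/funext => y /=; rewrite component_kpartials.
exact: smooth_on_partials (sF im).
Qed.

Lemma kpartials_perm n (U : set 'rV[R]_n) F s t x : open U -> ksmooth U F ->
  perm_eq s t -> U x -> kpar s F x = kpar t F x.
Proof.
move=> oU sF st Ux; apply: (@component_inj _ _ k) => im; rewrite !component_kpartials.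
exact: (partials_perm oU (sF im) st Ux).
Qed.

Section Reindex.
Variables (m n : nat) (A : 'rV[R]_m -> 'rV[R]_n) (sigma : 'I_m -> 'I_n).
Hypothesis HA : forall i h v,
  A (h *: basis_vec R i + v) = h *: basis_vec R (sigma i) + A v.

Lemma kpartials_reindex (F : 'rV[R]_n -> K) s :
  kpar s (F \o A) = kpar (map sigma s) F \o A.
Proof.
apply/funext => x; apply: (@component_inj _ _ k) => im /=.
rewrite !component_kpartials.
have := @partials_reindex _ _ _ A sigma (cpt im \o F) s HA.
by move/(congr1 (fun f => f x)).
Qed.

Lemma ksmooth_reindex (F : 'rV[R]_n -> K) (W : set 'rV[R]_n) : continuous A ->
  ksmooth W F -> ksmooth (A @^-1` W) (F \o A).
Proof.
by move=> cA sF im; exact: (smooth_on_reindex HA cA (sF im)).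
Qed.

End Reindex.

Lemma kpartials_diag n (W : set 'rV[R]_(n + n)) (F : 'rV[R]_(n + n) -> K) s x :
  open W -> ksmooth W F -> W (diag_mx2 x) ->
  kpar s (F \o @diag_mx2 R n) x = \sum_(p <- splits s)
    kpar (map (@lshift n n) p.1 ++ map (@rshift n n) p.2) F (diag_mx2 x).
Proof.
move=> oW sF Wx; apply: (@component_inj _ _ k) => im.
rewrite component_kpartials component_sum (partials_diag oW (sF im))//.
by apply: eq_bigr => p _; rewrite component_kpartials.
Qed.

Lemma kpartials_comp_expand m n (U : set 'rV[R]_m) (V : set 'rV[R]_n) tau s :
  open U -> open V -> smooth_map_on U tau -> (forall x, U x -> V (tau x)) ->
  exists l : seq (('rV[R]_m -> R) * seq 'I_n),
  (forall p, p \in l -> smooth_on U p.1 /\ (size p.2 <= size s)%N) /\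
  forall g, ksmooth V g -> forall x, U x ->
    kpar s (g \o tau) x = \sum_(p <- l) of_real k (p.1 x) * kpar p.2 g (tau x).
Proof.
move=> oU oV st tV; have [l [sl E]] := partials_comp_expand oU oV st tV s.
exists l; split=> // g sg x Ux; apply: (@component_inj _ _ k) => im.
rewrite component_kpartials component_sum [LHS](E _ (sg im))//.
by apply: eq_bigr => p _; rewrite component_real component_kpartials.
Qed.

End Kpartials.

(** * The algebra of smooth functions *)

Section CinfOperations.
Variables (R : realType) (K : numFieldType) (k : real_or_complex R K).
Local Notation cpt := (component k).
Implicit Types M N : manifold R.

Lemma Cinf_smooth M (f : Cinf k M) : smooth_fun k f.
Proof. exact/asboolP/(valP f). Qed.

Lemma to_CinfE M (f : M -> K) : smooth_fun k f -> to_Cinf k f =1 f.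
Proof.
move=> sf x; rewrite /to_Cinf /Cinf_fun insubdK//.
exact/asboolP.
Qed.

Lemma Cinf_ext M (f g : Cinf k M) : f =1 g -> f = g.
Proof. by move=> fg; apply/val_inj/funext. Qed.

Lemma to_Cinf_id M (f : Cinf k M) (g : M -> K) : g =1 f -> to_Cinf k g = f.
Proof.
move=> /funext->; apply: Cinf_ext; apply: to_CinfE; exact: Cinf_smooth.
Qed.

Lemma Cinf_lin M (a : K) (f g : Cinf k M) x :
  (a *: f + g : Cinf k M) x = a * f x + g x.
Proof. by []. Qed.

Lemma Cinf0 M (x : M) : (0 : Cinf k M) x = 0.
Proof. by []. Qed.

Lemma smooth_funP M (f : M -> K) :
  smooth_fun k f <-> forall im, smooth_real setT (cpt im \o f).
Proof.
split=> [sf im c Mc|sf c Mc im]; have := setIT (chart_dom c) => E.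
  by rewrite E; exact: sf.
by have := sf im c Mc; rewrite E.
Qed.

Lemma smooth_fun_chart M (f : M -> K) :
  (forall x, exists c (V : set 'rV[R]_(mdim M)), [/\ atlas M c, chart_dom c x,
     open V, V (chart_map c x) & ksmooth_on k V (f \o chart_inv c)]) ->
  smooth_fun k f.
Proof.
move=> H; apply/smooth_funP => im; apply: smooth_real_chart => x _.
by have [c [V [Mc cx oV Vx sV]]] := H x; exists c, V; split=> //; exact: sV.
Qed.

Lemma smooth_fun_comp M N (phi : M -> N) (f : N -> K) :
  smooth_map phi -> smooth_fun k f -> smooth_fun k (f \o phi).
Proof.
move=> sphi /smooth_funP sf; apply/smooth_funP => im.
have := smooth_real_comp sphi openT (sf im).
by rewrite preimage_setT.
Qed.

Lemma smooth_fun_cst M (a : K) : smooth_fun k (fun _ : M => a).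
Proof. by move=> c Mc im; exact: (@smooth_on_cst R _ _ (cpt im a)). Qed.

Lemma smooth_fun_mul M (f g : M -> K) :
  smooth_fun k f -> smooth_fun k g -> smooth_fun k (fun x => f x * g x).
Proof.
move=> sf sg c Mc.
exact: (ksmooth_mul (@chart_img_open _ _ _ c) (sf c Mc) (sg c Mc)).
Qed.

Definition Cmul M (f g : Cinf k M) : Cinf k M := to_Cinf k (fun x => f x * g x).

Lemma CmulE M (f g : Cinf k M) x : Cmul f g x = f x * g x.
Proof. by apply: to_CinfE; apply: smooth_fun_mul; exact: Cinf_smooth. Qed.

Lemma Cinf_ksmooth M (f : Cinf k M) c : atlas M c ->
  ksmooth_on k (chart_img c) (f \o chart_inv c).
Proof. by move=> Mc; exact: (Cinf_smooth f Mc). Qed.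

End CinfOperations.

(** * Convergence of smooth functions and continuity of jets *)

Section Topology.
Variables (R : realType) (K : numFieldType) (k : real_or_complex R K).
Local Notation cpt := (component k).
Variable M : manifold R.

(** For complex scalars, the norm is at most the sum of the absolute values of
    the two components. *)
Lemma component_cvg (T : Type) (F : set_system T) (h : T -> K^o) (l : K^o) :
  Filter F -> (forall im, (fun x => cpt im (h x)) @ F --> (cpt im l : R)) ->
  h @ F --> l.
Proof.
move=> FF; move: h l; rewrite /component; case: k => h l H; first exact: (H false).
apply/cvgrPdist_lt => e; rewrite ltcE => /andP[/eqP e2 e1].
have e20 : 0 < complex.Re e / 2 by rewrite divr_gt0.
have /cvgrPdist_lt/(_ _ e20) Hf := H false.
have /cvgrPdist_lt/(_ _ e20) Ht := H true.
apply: filterS2 Hf Ht => x A B; rewrite normc_def ltcE /=; apply/andP; split; first exact/eqP.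
have -> : complex.Re (l - h x) = complex.Re l - complex.Re (h x).
  by case: l {H A B} (h x) => [a b] [c d].
have -> : complex.Im (l - h x) = complex.Im l - complex.Im (h x).
  by case: l {H A B} (h x) => [a b] [c d].
set a := complex.Re l - _ in A *; set b := complex.Im l - _ in B *.
apply: (@le_lt_trans _ _ (`|a| + `|b|)); last by rewrite [X in _ < X]splitr ltrD.
have ab0 : 0 <= `|a| + `|b| by rewrite addr_ge0.
have -> : `|a| + `|b| = Num.sqrt ((`|a| + `|b|) ^+ 2) by rewrite sqrtr_sqr (ger0_norm ab0).
have sqE (y : R) : y ^+ 2 = `|y| ^+ 2 by rewrite -normrX ger0_norm ?sqr_ge0.
apply: ler_wsqrtr; rewrite [leLHS](congr2 +%R (sqE a) (sqE b)) sqrrD.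
by rewrite [leRHS]addrAC lerDl mulrn_wge0// mulr_ge0.
Qed.

(** The topology is that of uniform convergence of all derivatives on compact
    subsets of the chart images.  By compactness, estimates that hold near each
    point, uniformly for large n, are enough. *)
Lemma Cinf_cvg0 (g : nat -> Cinf k M) :
  (forall c, atlas M c -> forall im s u, chart_img c u -> forall eps : R, 0 < eps ->
     \forall v \near u & n \near \oo,
       `|partials s (cpt im \o g n \o chart_inv c) v| < eps) ->
  g @ \oo --> (0 : Cinf k M).
Proof.
move=> H; apply/cvg_sup => -[[[c Mc] im] s] /= A [_ [[B oB <-] /= B0 sub]].
apply: filterS sub _.
pose lp : Cinf k M -> {family compacts_in c, 'rV[R]_(mdim M) -> R} :=
  local_partials c im s.
suff : (lp \o g) @ \oo --> lp 0.
  by apply; apply: open_nbhs_nbhs; split.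
apply: (proj2 (@fam_cvgP _ _ (compacts_in c) ((lp \o g) @ \oo)
  (lp 0) _)) => L [cL Lc] P /uniform_nbhs[E [entE sP]].
move: entE; rewrite -entourage_ballE => -[e /= e0 eE].
have /compact_near_coveringP cov := cL.
pose small n := L `<=` (fun v => `|partials s (cpt im \o g n \o chart_inv c) v| < e).
have C : \forall n \near \oo, small n.
  exact: (cov nat \oo (fun n v => `|partials s (cpt im \o g n \o chart_inv c) v| < e)
    _ (fun u Lu => H c Mc im s u (Lc u Lu) e e0)).
have sub' n : small n -> P (lp (g n)).
  move=> Hn; apply: sP => y Ly; apply: (eE (_, _)) => /=.
  have -> : lp 0 y = 0.
    rewrite /lp /local_partials.
    have -> : cpt im \o (0 : Cinf k M) \o chart_inv c = cst 0.
      by apply/funext => u /=; exact: component0.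
    exact: partials_cst0.
  by rewrite -ball_normE /= sub0r normrN; exact: Hn.
exact: filterS sub' C.
Qed.

Definition jet (c : chart R (mdim M) M) (s : seq 'I_(mdim M)) (x : M) (f : Cinf k M) : K :=
  kpartials k s (f \o chart_inv c) (chart_map c x).

(** Uniform convergence on the compact set reduced to the point c(x). *)
Lemma jet_continuous c s x : atlas M c -> chart_dom c x ->
  continuous (jet c s x : Cinf k M -> K^o).
Proof.
move=> Mc cx f; apply: (@component_cvg _ (nbhs f) _ _ (nbhs_filter f)) => im.
have -> : (fun f => cpt im (jet c s x f)) =
    (fun f => local_partials c im s f (chart_map c x)).
  by apply/funext => f'; rewrite component_kpartials.
rewrite component_kpartials.
pose lp : Cinf k M -> {family compacts_in c, 'rV[R]_(mdim M) -> R} :=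
  local_partials c im s.
have clp : lp @ f --> lp f.
  move=> A /= nA.
  have : (f : Cinf k M) @[f --> f] --> f by exact: cvg_id.
  move=> /cvg_sup/(_ (exist _ c Mc, im, s))/(_ (lp @^-1` A)); apply.
    exact: fmap_filter (nbhs_filter f).
  exact: (@initial_continuous (Cinf k M) _ lp f _ nA).
have ccx : compacts_in c [set chart_map c x].
  by split; [exact: compact_set1|move=> _ ->; exists x].
have Flp : Filter (lp @ f) by exact: (@fmap_filter _ _ _ _ (nbhs_filter f)).
have := proj1 (@fam_cvgP _ _ (compacts_in c) (lp @ f) (lp f) Flp) clp _ ccx.
by rewrite (@uniform_set1 _ _ (lp @ f) _ _ Flp).
Qed.

End Topology.

(** * Bump functions on a manifold *)

Section Bumps.
Variables (R : realType) (K : numFieldType) (k : real_or_complex R K).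
Local Notation cpt := (component k).
Variable M : manifold R.
Local Notation n := (mdim M).

Variables (chi : 'rV[R]_n -> R) (c : chart R n M) (a : 'rV[R]_n) (rho : R).
Hypotheses (schi : smooth_on setT chi)
  (chi0 : forall x : 'rV[R]_n, 1 <= `|x| -> chi x = 0) (Mc : atlas M c).
Hypotheses (rho0 : 0 < rho)
  (box_img : forall u : 'rV[R]_n, `|u - a| <= rho -> chart_img c u).

Definition bump_fun (y : M) : K :=
  if `[< chart_dom c y >] then of_real k (chi (rho^-1 *: (chart_map c y - a))) else 0.

Definition bump_supp : set M := chart_inv c @` [set u | `|u - a| <= rho].

Lemma bump_fun_dom y : chart_dom c y ->
  bump_fun y = of_real k (chi (rho^-1 *: (chart_map c y - a))).
Proof. by move=> cy; rewrite /bump_fun asboolT. Qed.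

Lemma bump_supp_dom : bump_supp `<=` chart_dom c.
Proof. by move=> _ [u /box_img /chart_imgP[cu _] <-]. Qed.

Lemma of_real0 : of_real k 0 = 0.
Proof.
apply: (@component_inj _ _ k) => im; rewrite component_of_real component0.
by case: im.
Qed.

Lemma bump_fun_out y : ~ bump_supp y -> bump_fun y = 0.
Proof.
move=> ny; rewrite /bump_fun; case: asboolP => // cy.
rewrite chi0 ?of_real0//; rewrite normrZ gtr0_norm ?invr_gt0//.
rewrite ler_pdivlMl// mulr1 leNgt; apply/negP => yr; apply: ny.
by exists (chart_map c y); [exact: ltW|exact: chart_mapK].
Qed.

Lemma compact_bump_supp : compact bump_supp.
Proof.
apply: continuous_compact.
  apply: continuous_in_subspaceT => u; rewrite inE => /= /box_img.
  exact: chart_inv_continuous.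
apply: bounded_closed_compact.
  exists (rho + `|a|); split=> [|m m1 u /= ur]; first exact: num_real.
  apply: le_trans (ltW m1); rewrite -[u](subrK a).
  by apply: le_trans (ler_normD _ _) _; rewrite lerD2r.
apply: (@closed_comp _ _ (fun u : 'rV[R]_n => `|u - a|) [set t : R | t <= rho]).
  move=> u _; have cB : {for u, continuous (fun z : 'rV[R]_n => z - a)}.
    by apply: continuousB; [exact: cvg_id|exact: cst_continuous].
  exact: (cvg_norm cB).
exact: closed_le.
Qed.

Lemma closed_bump_supp : closed bump_supp.
Proof. exact: compact_closed (@manifold_hausdorff _ M) compact_bump_supp. Qed.

(** In the chart c the function is chi rescaled.  A point outside the domain
    of c lies in the complement of the support, which is open because compact
    subsets of a Hausdorff space are closed, and there the function is 0. *)
Lemma smooth_bump : smooth_fun k bump_fun.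
Proof.
apply: smooth_fun_chart => x; have [cx|ncx] := pselect (chart_dom c x).
  exists c, (chart_img c); split=> //; first exact: chart_img_open.
    exact: chart_img_map.
  have oc := @chart_img_open _ _ _ c.
  have s1 := smooth_on_scale a rho^-1 oc schi.
  move=> im; pose h := if im then cst 0 else (fun x => chi (rho^-1 *: (x - a))).
  have sh : smooth_on (chart_img c) h.
    by rewrite /h; case: im {h}; [exact: (@smooth_on_cst _ _ _ 0)|exact: s1].
  apply: (smooth_on_eq oc _ sh) => u /chart_imgP[cu cuK] /=.
  by rewrite bump_fun_dom// cuK component_of_real /h; case: im {h sh}.
have [d Md dx] := atlas_cover x.
have oQ : open (~` bump_supp) by exact: closed_openC closed_bump_supp.
have oV := open_chart_img (c := d) oQ.
exists d, (chart_map d @` (chart_dom d `&` ~` bump_supp)); split=> //.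
  by exists x => //; split=> //; move/bump_supp_dom.
apply: (ksmooth_on_eq oV _ (@ksmooth_on_cst _ _ _ _ _ 0)).
by move=> u [y [dy ny] <-]; rewrite /= chart_mapK// bump_fun_out.
Qed.

Lemma bump_near : (\forall u \near (0 : 'rV[R]_n), chi u = 1) ->
  forall x, chart_dom c x -> chart_map c x = a -> \forall y \near x, bump_fun y = 1.
Proof.
move=> /nbhs_ballP[r /= r0 H] x cx xa.
have rr0 : 0 < rho * r by rewrite mulr_gt0.
have : \forall y \near x, chart_dom c y /\ ball a (rho * r) (chart_map c y).
  apply: filterI; first by apply: open_nbhs_nbhs; split=> //; exact: chart_dom_open.
  have := chart_map_continuous cx; rewrite /prop_for /continuous_at xa.
  by move=> /(_ (ball a (rho * r))); apply; exact: nbhsx_ballx.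
apply: filterS => y [cy By]; rewrite bump_fun_dom// H.
  apply: (@component_inj _ _ k) => im; rewrite component_of_real component1.
  by case: im.
rewrite -ball_normE /= sub0r normrN normrZ gtr0_norm ?invr_gt0// ltr_pdivrMl//.
by move: By; rewrite -ball_normE /= distrC.
Qed.

End Bumps.

Section BumpExists.
Variables (R : realType) (K : numFieldType) (k : real_or_complex R K).
Variable M : manifold R.

Lemma chart_box (c : chart R (mdim M) M) (x : M) (W : set M) :
  chart_dom c x -> open W -> W x -> exists2 r : R, 0 < r &
    forall u : 'rV[R]_(mdim M), `|u - chart_map c x| <= r ->
      chart_img c u /\ W (chart_inv c u).
Proof.
move=> cx oW Wx.
have oV := open_chart_img (c := c) oW.
have Vx : (chart_map c @` (chart_dom c `&` W)) (chart_map c x) by exists x.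
have /nbhs_ballP[r /= r0 H] := open_nbhs_nbhs (conj oV Vx).
exists (r / 2); first by rewrite divr_gt0.
move=> u ur; have /H : ball (chart_map c x) r u.
  by rewrite -ball_normE /= distrC (le_lt_trans ur)//; lra.
by rewrite chart_img_setI.
Qed.

Lemma bump_in (x : M) (W : set M) : open W -> W x ->
  exists beta : Cinf k M, [/\ \forall y \near x, beta y = 1,
    compact (closure [set y | beta y != 0]) & closure [set y | beta y != 0] `<=` W].
Proof.
move=> oW Wx; have [c Mc cx] := atlas_cover x.
have [chi [schi chi1 chi0]] := bump_exists R (mdim M).
have [r r0 H] := chart_box cx oW Wx.
have box u : `|u - chart_map c x| <= r -> chart_img c u by move=> /H[].
have sb := smooth_bump k schi chi0 Mc r0 box.
have cl : closure [set y | to_Cinf k (bump_fun k chi c (chart_map c x) r) y != 0] `<=`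
    bump_supp c (chart_map c x) r.
  have /closure_id -> := closed_bump_supp box.
  apply: closureS => y /=; apply: contra_neqP => ny.
  by rewrite to_CinfE// bump_fun_out.
exists (to_Cinf k (bump_fun k chi c (chart_map c x) r)); split.
- have := bump_near k r0 chi1 cx erefl.
  by apply: filterS => y; rewrite to_CinfE.
- apply: subclosed_compact cl; first exact: closed_closure.
  exact: compact_bump_supp.
- by apply: subset_trans cl _ => _ [u /H[_ ?] <-].
Qed.

End BumpExists.

(** * Linear maps and linear functionals *)

Section LinearMaps.
Variables (K : fieldType) (V W : lmodType K) (f : V -> W) (lf : linear f).

Lemma lin_map0 : f 0 = 0.
Proof. by have := lf (-1) 0 0; rewrite scaler0 addr0 scaleN1r addNr. Qed.

Lemma lin_mapZ a u : f (a *: u) = a *: f u.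
Proof. by have := lf a u 0; rewrite !addr0 lin_map0 addr0. Qed.

Lemma lin_mapN u : f (- u) = - f u.
Proof. by rewrite -scaleN1r lin_mapZ scaleN1r. Qed.

Lemma lin_mapD u v : f (u + v) = f u + f v.
Proof. by have := lf 1 u v; rewrite !scale1r. Qed.

Lemma lin_map_sum (I : Type) (r : seq I) (F : I -> V) :
  f (\sum_(i <- r) F i) = \sum_(i <- r) f (F i).
Proof. exact: (big_morph f lin_mapD lin_map0). Qed.

End LinearMaps.

Section FunctionalsAlgebra.
Variables (K : fieldType) (V : lmodType K).

Lemma scalar0 (f : V -> K) : scalar f -> f 0 = 0.
Proof. exact: (lin_map0 (W := K^o)). Qed.

Lemma scalarB (f : V -> K) a u v : scalar f -> f (v - a *: u) = f v - a * f u.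
Proof. by move=> lf; rewrite addrC -scaleNr lf mulNr addrC. Qed.

(** By induction on r.  If T does not vanish on the common kernel of the tail, pick
    v in it with T v != 0; then phi i v != 0, and subtracting from T the multiple
    of phi i which agrees with it at v gives a functional to which the induction
    hypothesis applies.  The space V may have infinite dimension. *)
Lemma functional_combination (I : Type) (r : seq I) (phi : I -> V -> K) (T : V -> K) :
  (forall i, scalar (phi i)) -> scalar T ->
  (forall v, foldr (fun i P => phi i v = 0 /\ P) True r -> T v = 0) ->
  exists l : seq (K * I), forall v, T v = \sum_(p <- l) p.1 * phi p.2 v.
Proof.
move=> lphi; elim: r T => [|i r IHr] T lT H.
  by exists [::] => v; rewrite big_nil H.
have [H0|] := pselect (forall v, foldr (fun i P => phi i v = 0 /\ P) True r -> T v = 0).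
  exact: IHr.
move=> /existsNP[v /not_implyP[rv Tv]].
have iv : phi i v != 0 by apply/eqP => iv; apply: Tv; apply: H.
pose c := T v / phi i v.
have ker w a : foldr (fun j P => phi j w = 0 /\ P) True r ->
    foldr (fun j P => phi j (w - a *: v) = 0 /\ P) True r.
  elim: (r) rv => //= j r' IHr' [jv rv] [jw rw]; split; last exact: IHr'.
  by rewrite scalarB// jv jw mulr0 subr0.
have [|w rw|l El] := IHr (fun w => T w - c * phi i w).
- move=> a u w; rewrite lT lphi; ring.
- have Tw : T (w - (phi i w / phi i v) *: v) = 0.
    apply: H; split; last exact: ker.
    by rewrite scalarB// divfK// subrr.
  move: Tw; rewrite scalarB// => /eqP; rewrite subr_eq0 => /eqP ->.
  by rewrite /c; ring.
- exists ((c, i) :: l) => w; rewrite big_cons -El /=; ring.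
Qed.

End FunctionalsAlgebra.

(** * Functionals supported at a point have finite order *)

Section PointSupport.
Variables (R : realType) (K : numFieldType) (k : real_or_complex R K).
Local Notation cpt := (component k).
Variable M : manifold R.

(** Locally eventually zero sequences converge to 0: on a compact set only
    finitely many terms are non-zero. *)
Lemma Cinf_cvg0_vanishing (g : nat -> Cinf k M) :
  (forall x, exists W n0, [/\ open W, W x &
     forall n y, (n0 <= n)%N -> W y -> g n y = 0]) ->
  g @ \oo --> (0 : Cinf k M).
Proof.
move=> H; apply: Cinf_cvg0 => c Mc im s _ [x cx <-] eps eps0.
have [W [n0 [oW Wx gW]]] := H x.
have oV := open_chart_img (c := c) oW.
exists (chart_map c @` (chart_dom c `&` W), [set n | (n0 <= n)%N]).
  split; last by exists n0.
  by apply: open_nbhs_nbhs; split=> //; exists x.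
move=> [v n] [/= Vv n0n].
suff -> : partials s (cpt im \o g n \o chart_inv c) v = 0 by rewrite normr0.
have E u : (chart_map c @` (chart_dom c `&` W)) u ->
    (cpt im \o g n \o chart_inv c) u = cst 0 u.
  by move=> [y [cy Wy] <-] /=; rewrite chart_mapK// gW// component0.
by rewrite (eq_partials_on s oV E Vv) partials_cst0.
Qed.

Lemma continuous_seq0 (T : Cinf k M -> K^o) (g : nat -> Cinf k M) (a : K) :
  linear T -> continuous T -> g @ \oo --> (0 : Cinf k M) ->
  (forall n, T (g n) = a) -> a = 0.
Proof.
move=> lT cT g0 Tg.
have T0 := lin_map0 lT.
have TgE : T \o g = cst (a : K^o) by apply/funext => n /=.
have : (T \o g) @ \oo --> T 0 by apply: cvg_comp g0 (cT 0).
rewrite TgE T0 => /cvgr0Pnorm_lt H; apply/eqP; rewrite -normr_le0.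
have [//|an] := eqVneq a 0; first by move=> ->; rewrite normr0.
have /H [n _ /(_ n (leqnn n))] : 0 < `|a| by rewrite normr_gt0.
by rewrite /= ltxx.
Qed.

(** Each p != e has a basic neighbourhood U and a function beta with beta = 1
    on U and T(f beta) = 0 for all f.  As the basis is countable, such functions
    beta_n can be chosen so that the corresponding U cover M \ {e}.  Then
    g_n = h prod_(i < n) (1 - beta_i) satisfies T(g_n) = T(h), and near every
    point it is eventually 0: near e because h is.  This replaces a partition of
    unity. *)
Lemma germ_vanishing (T : Cinf k M -> K^o) e (h : Cinf k M) :
  linear T -> continuous T -> dist_support T `<=` [set e] ->
  (\forall y \near e, h y = 0) -> T h = 0.
Proof.
move=> lT cT sT he.
have T0 := lin_map0 lT.
have [B cB [oB bB]] := @manifold_second_countable R M.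
pose good (U : set M) (beta : Cinf k M) := (forall y, U y -> beta y = 1) /\
  (forall f : Cinf k M, T (Cmul f beta) = 0).
have good_ex p : p != e -> exists U beta, [/\ B U, U p & good U beta].
  move=> pe.
  have np : ~ dist_support T p by move/sT => /= pe'; rewrite pe' eqxx in pe.
  have [W [oW Wp vW]] := notin_dist_support np.
  have [beta [b1 cb bW]] := bump_in k oW Wp.
  have [U [BU Up] Ub] := bB p _ b1.
  exists U, beta; split=> //; split=> [y /Ub //|f].
  have sub : [set y | Cmul f beta y != 0] `<=` [set y | beta y != 0].
    by move=> y /=; rewrite CmulE; apply: contra_neq => ->; rewrite mulr0.
  apply: vW; last by apply: subset_trans bW; exact: closureS.
  apply: subclosed_compact cb (closureS sub); exact: closed_closure.
have /countable_injP[code codeI] := cB.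
(* beta n serves the basic set with code n, if that set is good; otherwise it is 0. *)
have /choice[beta betaP] : forall n : nat, exists beta : Cinf k M,
    (forall f : Cinf k M, T (Cmul f beta) = 0) /\
    (forall U, B U -> code U = n -> (exists beta, good U beta) ->
       forall y, U y -> beta y = 1).
  move=> n; have [[U [BU [Un [beta [b1 b2]]]]]|no] :=
      pselect (exists U, B U /\ code U = n /\ exists beta, good U beta).
    exists beta; split=> // V BV Vn _ y Vy; apply: b1.
    by rewrite (codeI U V) ?inE// Un Vn.
  exists 0; split=> [f|U BU Un gU]; last by case: no; exists U.
  rewrite (_ : Cmul f 0 = 0)//; apply: Cinf_ext => y.
  by rewrite CmulE Cinf0 mulr0.
pose g := fix g n : Cinf k M := if n is n'.+1 then
  (-1) *: Cmul (g n') (beta n') + g n' else h.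
have gS n y : g n.+1 y = g n y * (1 - beta n y).
  by rewrite /= Cinf_lin CmulE; ring.
have Tg n : T (g n) = T h.
  elim: n => [//|n IHn] /=; rewrite lT IHn.
  by have [-> _] := betaP n; rewrite scaler0 add0r.
have zeroS n m y : (n <= m)%N -> g n y = 0 -> g m y = 0.
  move=> nm gn; elim: m nm => [|m IHm]; first by rewrite leqn0 => /eqP <-.
  rewrite leq_eqVlt => /orP[/eqP <- //|]; rewrite ltnS => /IHm gm.
  by rewrite gS gm mul0r.
apply: (continuous_seq0 lT cT (g := g)) => //.
apply: Cinf_cvg0_vanishing => x; have [->|xe] := eqVneq x e.
  exists (interior [set y | h y = 0]), 0%N; split=> //; first exact: open_interior.
  by move=> n y _ /interior_subset hy; exact: (zeroS 0%N).
have [U [b [BU Ux gU]]] := good_ex x xe.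
exists U, (code U).+1; split=> //; first exact: oB.
move=> n y Un Uy; apply: (zeroS _ _ _ Un); rewrite gS.
have [_ /(_ U BU erefl (ex_intro _ b gU) y Uy) ->] := betaP (code U).
by rewrite subrr mulr0.
Qed.

Lemma jet_linear c s x : atlas M c -> chart_dom c x -> scalar (jet (k := k) c s x).
Proof.
move=> Mc cx a f g; rewrite /jet.
exact: (kpartials_lincomb a s (@chart_img_open _ _ _ c) (Cinf_ksmooth f Mc)
  (Cinf_ksmooth g Mc) (chart_img_map cx)).
Qed.

Definition flat_jet c (e : M) N (f : Cinf k M) :=
  forall s, (size s <= N)%N -> jet c s e f = 0.

Lemma flat_component c e N (f : Cinf k M) im : flat_jet c e N f ->
  flat_at N (cpt im \o f \o chart_inv c) (chart_map c e).
Proof.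
move=> ff s sN; rewrite -[partials _ _ _](component_kpartials k im s (f \o chart_inv c)).
by rewrite [kpartials _ _ _ _]ff// component0.
Qed.

(** Multiply f by the bump function at scale rho given by [cutoff_flat], with rho
    small enough for the two components of f and for the domain of c. *)
Lemma flat_truncation c e N (f : Cinf k M) (delta : R) : atlas M c -> chart_dom c e ->
  flat_jet c e N f -> 0 < delta ->
  exists g : Cinf k M, [/\ \forall y \near e, g y = f y,
    (forall im s u, (size s <= N)%N -> chart_img c u ->
       `|partials s (cpt im \o g \o chart_inv c) u| <= delta) &
    forall y, g y != 0 -> chart_dom c y /\
      `|chart_map c y - chart_map c e| <= delta].
Proof.
move=> Mc ce ff delta0; set a := chart_map c e.
have [chi [schi chi1 chi0]] := bump_exists R (mdim M).
have [r r0 H] := chart_box ce openT (I : setT e).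
have oc := @chart_img_open _ _ _ c; have ac := chart_img_map ce.
have sf im : smooth_on (chart_img c) (cpt im \o f \o chart_inv c) := Cinf_ksmooth f Mc im.
have [rf rf0 Hf] := cutoff_flat schi chi0 oc (sf false) ac
  (flat_component false ff) delta0.
have [rt rt0 Ht] := cutoff_flat schi chi0 oc (sf true) ac
  (flat_component true ff) delta0.
pose rho := Num.min (Num.min rf rt) (Num.min r delta).
have rho0 : 0 < rho by rewrite !lt_min rf0 rt0 r0.
have rho_f : rho <= rf by rewrite /rho !ge_min lexx.
have rho_t : rho <= rt by rewrite /rho !ge_min lexx orbT.
have rho_r : rho <= r by rewrite /rho !ge_min lexx !orbT.
have rho_d : rho <= delta by rewrite /rho !ge_min lexx !orbT.
have box u : `|u - a| <= rho -> chart_img c u.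
  by move=> ur; have [] := H u (le_trans ur rho_r).
have sb := smooth_bump k schi chi0 Mc rho0 box.
pose beta := to_Cinf k (bump_fun k chi c a rho).
have betaE y : beta y = bump_fun k chi c a rho y by rewrite to_CinfE.
exists (Cmul beta f); split.
- have := bump_near k rho0 chi1 ce erefl.
  by apply: filterS => y b1; rewrite CmulE betaE b1 mul1r.
- move=> im s u sN cu.
  have E v : chart_img c v -> (cpt im \o Cmul beta f \o chart_inv c) v =
      chi (rho^-1 *: (v - a)) * (cpt im \o f \o chart_inv c) v.
    move=> /chart_imgP[cv vK] /=.
    by rewrite CmulE betaE bump_fun_dom// vK component_real.
  rewrite (eq_partials_on s oc E cu).
  by case: im {E}; [exact: Ht|exact: Hf].
- move=> y; rewrite CmulE betaE => nz.
  have : bump_supp c a rho y.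
    apply: contrapT => /(bump_fun_out k chi0 rho0) b0.
    by rewrite b0 mul0r eqxx in nz.
  move=> [u /= ur <-]; have [cu uK] := chart_imgP (box u ur).
  by rewrite uK; split=> //; exact: le_trans rho_d.
Qed.

(** Otherwise there is, for every N, an N-flat function on which T is 1, and
    [flat_truncation] changes it away from e into g_N with T g_N = 1, whose
    derivatives of order at most N are bounded by 1/(N+1) and whose support
    shrinks to e.  Then g_N converges to 0, contradicting continuity.  Away
    from e the g_N are eventually 0; near e, the derivatives in another chart
    are controlled through [partials_comp_expand]. *)
Lemma finite_order (T : Cinf k M -> K^o) c e : atlas M c -> chart_dom c e ->
  linear T -> continuous T -> dist_support T `<=` [set e] ->
  exists N, forall f, flat_jet c e N f -> T f = 0.
Proof.
move=> Mc ce lT cT sT; apply: contrapT => /forallNP no.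
have inv0 N : 0 < N.+1%:R^-1 :> R by rewrite invr_gt0.
have /choice[g gP] : forall N : nat, exists g : Cinf k M, [/\ T g = 1,
    (forall im s u, (size s <= N)%N -> chart_img c u ->
       `|partials s (cpt im \o g \o chart_inv c) u| <= N.+1%:R^-1) &
    forall y, g y != 0 -> chart_dom c y /\
       `|chart_map c y - chart_map c e| <= N.+1%:R^-1].
  move=> N; have /existsNP[f /not_implyP[ff Tf]] := no N.
  have T0 := lin_map0 lT.
  pose f1 : Cinf k M := (T f)^-1 *: f + 0.
  have ff1 : flat_jet c e N f1.
    move=> s sN; rewrite /f1 jet_linear// ff// mulr0 add0r.
    exact: (scalar0 (jet_linear s Mc ce)).
  have Tf1 : T f1 = 1.
    rewrite /f1 lT T0 addr0 [_ *: _]mulVf//; exact/eqP.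
  have [g [gf1 gN gd]] := flat_truncation Mc ce ff1 (inv0 N).
  exists g; split=> //.
  have : T ((-1) *: f1 + g) = 0.
    apply: (germ_vanishing (e := e)) => //.
    by apply: filterS gf1 => y E; rewrite Cinf_lin E mulN1r addNr.
  by rewrite lT Tf1 => /eqP; rewrite scaleN1r addrC subr_eq0 => /eqP.
suff g0 : g @ \oo --> (0 : Cinf k M).
  have /eqP := continuous_seq0 lT cT g0 (fun n => let: And3 E _ _ := gP n in E).
  by rewrite oner_eq0.
apply: Cinf_cvg0 => c' Mc' im s _ [x c'x <-] eps eps0.
have oc := @chart_img_open _ _ _ c.
have [xe|xe] := eqVneq x e; last first.
  have hM := @manifold_hausdorff R M; rewrite open_hausdorff in hM.
  have [[A B] /= [xA eB] [oA oB AB]] := hM x e xe.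
  rewrite !inE in xA eB.
  have [r r0 Hr] := chart_box ce oB eB.
  have oV := open_chart_img (c := c') oA.
  have [n0 n0r] : exists n0, forall n, (n0 <= n)%N -> n.+1%:R^-1 <= r.
    have [n0 _ Hn0] := near_infty_natSinv_lt (PosNum r0).
    by exists n0 => n nn; apply: ltW; exact: Hn0.
  exists (chart_map c' @` (chart_dom c' `&` A), [set n | (n0 <= n)%N]).
    split; last by exists n0.
    by apply: open_nbhs_nbhs; split=> //; exists x.
  move=> [v n] [/= Vv n0n].
  suff -> : partials s (cpt im \o g n \o chart_inv c') v = 0 by rewrite normr0.
  have E u : (chart_map c' @` (chart_dom c' `&` A)) u ->
      (cpt im \o g n \o chart_inv c') u = cst 0 u.
    move=> [y [cy Ay] <-] /=; rewrite chart_mapK//.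
    rewrite (_ : g n y = 0) ?component0//; apply/eqP; apply: contraT => gy.
    have [_ _ /(_ y gy)[cy' yn]] := gP n.
    have [_] := Hr _ (le_trans yn (n0r n n0n)); rewrite chart_mapK// => By.
    by move/eqP : AB => /seteqP[/(_ y)] /(_ (conj Ay By)).
  by rewrite (eq_partials_on s oV E Vv) partials_cst0.
subst x.
pose U := chart_map c' @` (chart_dom c' `&` chart_dom c).
have oU : open U by apply: open_chart_img; exact: chart_dom_open.
have st : smooth_map_on U (transition c' c) := atlas_compatible Mc' Mc.
have tV u : U u -> chart_img c (transition c' c u).
  by move=> [y [cy' cy] <-]; rewrite /transition /= chart_mapK//; exact: chart_img_map.
have Ue : U (chart_map c' e) by exists e.
have [l [sl El]] := partials_comp_expand oU oc st tV s.
pose A := \sum_(p <- l) (`|p.1 (chart_map c' e)| + 1).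
have A0 : 0 <= A by apply: sumr_ge0 => p _; rewrite addr_ge0.
have nearA : \forall v \near chart_map c' e, forall p, p \in l ->
    `|p.1 v| <= `|p.1 (chart_map c' e)| + 1.
  apply: (@near_all _ _ _ (fun p v => `|p.1 v| <= `|p.1 (chart_map c' e)| + 1)) => p pl.
  have [sp _] := sl p pl; have cp := smooth_on_continuous sp Ue.
  move/cvgrPdist_le : cp => /(_ 1 ltr01); apply: filterS => v vp.
  rewrite -lerBlDl; apply: le_trans (lerB_dist _ _) _; by rewrite distrC.
have [n0 n0e] : exists n0, forall n, (n0 <= n)%N -> A * n.+1%:R^-1 < eps.
  have A1 : 0 < A + 1 by rewrite ltr_wpDl.
  have eA : 0 < eps / (A + 1) by rewrite divr_gt0.
  have [n0 _ Hn0] := near_infty_natSinv_lt (PosNum eA).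
  exists n0 => n nn; apply: (@le_lt_trans _ _ ((A + 1) * n.+1%:R^-1)).
    by rewrite ler_wpM2r ?lerDl// invr_ge0.
  by rewrite mulrC -ltr_pdivlMr//; exact: Hn0.
exists ([set v | U v /\ forall p, p \in l ->
    `|p.1 v| <= `|p.1 (chart_map c' e)| + 1], [set n | (maxn n0 (size s) <= n)%N]).
  split; last by exists (maxn n0 (size s)).
  by apply: filterI => //; apply: open_nbhs_nbhs.
move=> [v n] [/= [Uv Bv]]; rewrite geq_max => /andP[n0n sn].
pose G := cpt im \o g n \o chart_inv c.
have E u : U u -> (cpt im \o g n \o chart_inv c') u = (G \o transition c' c) u.
  by move=> [y [cy' cy] <-]; rewrite /G /transition /= !chart_mapK.
have sG : smooth_on (chart_img c) G := Cinf_ksmooth (g n) Mc im.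
rewrite (eq_partials_on s oU E Uv) El//.
apply: le_lt_trans (ler_norm_sum _ _ _) (le_lt_trans _ (n0e n n0n)).
rewrite /A mulr_suml big_seq [leRHS]big_seq; apply: ler_sum => p pl.
rewrite normrM; apply: ler_pM => //; first exact: Bv.
have [_ Gb _] := gP n; apply: Gb; last exact: tV.
by have [_ sp] := sl p pl; exact: leq_trans sn.
Qed.

End PointSupport.

(** * Distributions supported at a point are combinations of jets *)

Section JetDistributions.
Variables (R : realType) (K : numFieldType) (k : real_or_complex R K).
Implicit Types M : manifold R.
Local Notation dpred := (@dist_at_pred R K k _).

Lemma flat_short_seqs M c e N (f : Cinf k M) :
  foldr (fun s Q => jet c s e f = 0 /\ Q) True (short_seqs (mdim M) N) ->
  flat_jet c e N f.
Proof.
move=> H s; rewrite -mem_short_seqs; elim: (short_seqs _ _) H => //= t r IHr [ft fr].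
by rewrite inE => /orP[/eqP ->|/IHr]; [exact: ft|exact].
Qed.

Lemma jet_combination M c e N (T : Cinf k M -> K) : atlas M c -> chart_dom c e ->
  scalar T -> (forall f, flat_jet c e N f -> T f = 0) ->
  exists l : seq (K * seq 'I_(mdim M)),
    forall f, T f = \sum_(p <- l) p.1 * jet c p.2 e f.
Proof.
move=> Mc ce lT H; apply: (functional_combination (r := short_seqs _ N)
  (phi := fun s (f : Cinf k M) => jet c s e f)) => //.
  by move=> s; exact: jet_linear.
by move=> f /flat_short_seqs; exact: H.
Qed.

Lemma dist_linear M (e : M) (T : dist_at k e) : scalar (T : Cinf k M -> K).
Proof. by have /asboolP[lT _ _] := valP T; exact: lT. Qed.

(** A functional of order N is killed by the common kernel of the finitely many
    jets of order at most N, hence is a combination of them. *)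
Lemma dist_jets M (e : M) (T : dist_at k e) c : atlas M c -> chart_dom c e ->
  exists l : seq (K * seq 'I_(mdim M)),
    forall f, T f = \sum_(p <- l) p.1 * jet c p.2 e f.
Proof.
move=> Mc ce; have /asboolP[lT cT sT] := valP T.
have [N HN] := finite_order Mc ce lT cT sT.
exact: (jet_combination Mc ce (@dist_linear M e T) HN).
Qed.

(** A function whose support avoids e vanishes near e, and so does its jet at
    e. *)
Lemma jet_dist_pred M c s (e : M) : atlas M c -> chart_dom c e ->
  (jet c s e : Cinf k M -> K^o) \in dpred e.
Proof.
move=> Mc ce; apply/asboolP; split.
- exact: jet_linear.
- exact: jet_continuous.
move=> x; apply: contraPP => /eqP xe /(_ (~` [set e])).
have oU : open (~` [set e]).
  apply: closed_openC; apply: accessible_closed_set1.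
  exact: hausdorff_accessible (@manifold_hausdorff R M).
apply=> //; first exact/eqP.
move=> f _ fU.
have ne : ~ closure [set x | f x != 0] e by move/fU; exact.
have oV : open (~` closure [set x | f x != 0]).
  by apply: closed_openC; exact: closed_closure.
have oW := open_chart_img (c := c) oV.
have E u : (chart_map c @` (chart_dom c `&` ~` closure [set x | f x != 0])) u ->
    (f \o chart_inv c) u = cst 0 u.
  move=> [y [cy ny] <-] /=; rewrite chart_mapK//; apply/eqP; apply: contraT => fy.
  by case: ny; exact: subset_closure.
rewrite /jet (eq_kpartials_on k s oW E) ?kpartials0//.
by exists e.
Qed.

Lemma jets_dist_pred M c (e : M) (l : seq (K * seq 'I_(mdim M))) (T : Cinf k M -> K) :
  atlas M c -> chart_dom c e ->
  (forall f, T f = \sum_(p <- l) p.1 * jet c p.2 e f) ->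
  (T : Cinf k M -> K^o) \in dpred e.
Proof.
move=> Mc ce E.
have -> : (T : Cinf k M -> K^o) =
    \sum_(p <- l) p.1 *: (jet c p.2 e : Cinf k M -> K^o).
  apply/funext => f; rewrite E fct_sumE; apply: eq_bigr => p _.
  by [].
by apply: rpred_sum => p _; apply: rpredZ; exact: jet_dist_pred.
Qed.

Lemma to_distE M (e : M) (T : Cinf k M -> K) f :
  (T : Cinf k M -> K^o) \in dpred e -> to_dist k e T f = T f.
Proof. by move=> H; rewrite /to_dist /dist_fun insubdK. Qed.

Lemma dist_ext M (e : M) (S T : dist_at k e) : (forall f, S f = T f) -> S = T.
Proof. by move=> ST; apply/val_inj/funext. Qed.

Lemma dist_lin M (e : M) a (S T : dist_at k e) f :
  (a *: S + T : dist_at k e) f = a * S f + T f.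
Proof. by []. Qed.

Lemma to_Cinf_lin M a (f g : M -> K) : smooth_fun k f -> smooth_fun k g ->
  to_Cinf k (fun x => a * f x + g x) = a *: to_Cinf k f + to_Cinf k g.
Proof.
move=> sf sg; apply: to_Cinf_id => x.
exact: esym (congr2 (fun u v => a * u + v) (to_CinfE sf x) (to_CinfE sg x)).
Qed.

Lemma dist_cst M (e : M) (T : dist_at k e) a :
  T (to_Cinf k (fun _ => a)) = a * T (to_Cinf k (fun _ => 1)).
Proof.
rewrite (_ : to_Cinf k (fun _ : M => a) = a *: to_Cinf k (fun _ => 1) + 0).
  by rewrite dist_linear (scalar0 (dist_linear T)) addr0.
apply: to_Cinf_id => x; rewrite Cinf_lin Cinf0 addr0 to_CinfE ?mulr1//.
exact: smooth_fun_cst.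
Qed.

Section Pushforward.
Variables (M N : manifold R) (e : M) (e' : N) (phi : M -> N).
Hypotheses (sphi : smooth_map phi) (phie : phi e = e').

(** If f is flat to a large enough order at phi(e), so is f o phi at e, because
    the chain rule does not increase the order.  So the push-forward has finite
    order, and this makes it a combination of jets, from which continuity and
    support follow. *)
Lemma pushforward_pred (T : dist_at k e) :
  ((fun f : Cinf k N => T (to_Cinf k (f \o phi))) : Cinf k N -> K^o)
    \in dpred e'.
Proof.
have [c Mc ce] := atlas_cover e; have [d Nd de] := atlas_cover e'.
have [l El] := dist_jets T Mc ce.
have sf (f : Cinf k N) : smooth_fun k (f \o phi).
  by apply: smooth_fun_comp => //; exact: Cinf_smooth.
pose n := \max_(p <- l) size p.2.
have lT : scalar (fun f : Cinf k N => T (to_Cinf k (f \o phi))).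
  move=> a f g; rewrite -dist_linear -to_Cinf_lin//.
suff [l' El'] : exists l : seq (K * seq 'I_(mdim N)), forall f : Cinf k N,
    T (to_Cinf k (f \o phi)) = \sum_(p <- l) p.1 * jet d p.2 e' f.
  exact: (jets_dist_pred Nd de El').
apply: (jet_combination (N := n) Nd de lT) => f ff.
rewrite El big_seq big1// => p pl.
have [_ sphi2] := sphi.
have oD : open (phi @^-1` chart_dom d).
  apply: open_comp; last exact: chart_dom_open.
  by move=> y _; exact: sphi.1.
have oU := open_chart_img (c := c) oD.
have od := @chart_img_open _ _ _ d.
have tV u : (chart_map c @` (chart_dom c `&` phi @^-1` chart_dom d)) u ->
    chart_img d ((chart_map d \o phi \o chart_inv c) u).
  by move=> [y [cy dy] <-] /=; rewrite chart_mapK//; exact: chart_img_map.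
have [l0 [s0 E0]] := kpartials_comp_expand k p.2 oU od (sphi2 c d Mc Nd) tV.
have Ue : (chart_map c @` (chart_dom c `&` phi @^-1` chart_dom d)) (chart_map c e).
  by exists e => //; split=> //=; rewrite phie.
have E u : (chart_map c @` (chart_dom c `&` phi @^-1` chart_dom d)) u ->
    (to_Cinf k (f \o phi) \o chart_inv c) u =
    ((f \o chart_inv d) \o (chart_map d \o phi \o chart_inv c)) u.
  by move=> [y [cy dy] <-]; rewrite /= to_CinfE//= !chart_mapK.
rewrite /jet (eq_kpartials_on k p.2 oU E Ue) (E0 _ (Cinf_ksmooth f Nd) _ Ue).
rewrite big_seq big1 ?mulr0// => q ql; have [_ sq] := s0 q ql.
rewrite /= chart_mapK// phie.
rewrite [kpartials _ _ _ _]ff ?mulr0//; apply: leq_trans sq _.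
by rewrite /n (big_rem p)//= leq_maxl.
Qed.

Lemma pushforwardE (T : dist_at k e) f :
  @Defs.pushforward R K k M N e e' phi T f = T (to_Cinf k (f \o phi)).
Proof. exact: to_distE (pushforward_pred T). Qed.

Lemma pushforward_linear : linear (@Defs.pushforward R K k M N e e' phi).
Proof.
move=> a S T; apply: dist_ext => f.
by rewrite dist_lin !pushforwardE.
Qed.

End Pushforward.

Lemma dirac_pred M (e : M) :
  ((fun f : Cinf k M => f e) : Cinf k M -> K^o) \in dpred e.
Proof.
have [c Mc ce] := atlas_cover e.
apply: (jets_dist_pred (l := [:: (1, [::])]) Mc ce) => f.
rewrite big_seq1 mul1r /jet; apply: (@component_inj _ _ k) => im.
by rewrite component_kpartials /= chart_mapK.
Qed.

Lemma dirac_atE M (e : M) f : dirac_at k e f = f e.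
Proof. exact: to_distE (dirac_pred e). Qed.

End JetDistributions.

Section BilinearLifts.
Variables (K : fieldType) (V W U : lmodType K) (f : V -> W -> U).
Hypothesis bf : bilinear_for *:%R *:%R f.

(** Liftings to the tensor product are well defined for bundled bilinear maps;
    this bundles a map for which bilinearity is proved after the fact. *)
Definition mk_bilinear : {bilinear V -> W -> U} :=
  HB.pack f (bilinear_isBilinear.Build K V W U *:%R *:%R f bf).

Lemma tens_lift_tens v w : tens_lift f (v ⊗ w) = f v w.
Proof. exact: (tens_liftE mk_bilinear). Qed.

Lemma tens_lift_is_linear : linear (tens_lift f).
Proof. exact: (tens_lift_linear mk_bilinear). Qed.

End BilinearLifts.

(** * Iterated distributions on a product of manifolds *)

Section Products.
Variables (R : realType) (K : numFieldType) (k : real_or_complex R K).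
Variables M N : manifold R.
Local Notation kpar := (kpartials k).

Lemma smooth_slice_r (F : prod_manifold M N -> K) x : smooth_fun k F ->
  smooth_fun k (fun y => F (x, y)).
Proof.
move=> sF; apply: (smooth_fun_comp (phi := fun y => ((x, y) : prod_manifold M N)) _ sF).
by apply: smooth_pair; [exact: smooth_map_cst|exact: smooth_map_id].
Qed.

Lemma smooth_slice_l (F : prod_manifold M N -> K) y : smooth_fun k F ->
  smooth_fun k (fun x => F (x, y)).
Proof.
move=> sF; apply: (smooth_fun_comp (phi := fun x => ((x, y) : prod_manifold M N)) _ sF).
by apply: smooth_pair; [exact: smooth_map_id|exact: smooth_map_cst].
Qed.

Variables (c : chart R (mdim M) M) (d : chart R (mdim N) N).
Hypotheses (Mc : atlas M c) (Nd : atlas N d).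
Local Notation cd := (prod_chart c d).

Lemma prod_chart_atlas : atlas (prod_manifold M N) cd.
Proof. by exists c => //; exists d. Qed.

Lemma prod_imgE u v : chart_img cd (row_mx u v) = (chart_img c u /\ chart_img d v).
Proof.
have -> : chart_img cd = prod_map c d @` (chart_dom c `*` chart_dom d) by [].
by rewrite prod_img_sub /setI /preimage /= row_mxKl row_mxKr.
Qed.

Section Slices.
Variable F : prod_manifold M N -> K.
Hypothesis sF : smooth_fun k F.

Let Fhat := F \o chart_inv cd.

Lemma hat_smooth : ksmooth_on k (chart_img cd) Fhat.
Proof. exact: (sF prod_chart_atlas). Qed.

Lemma jet_slice_r s x y : chart_dom c x ->
  jet d s y (to_Cinf k (fun y => F (x, y))) =
  kpar (map (@rshift _ _) s) Fhat (row_mx (chart_map c x) (chart_map d y)).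
Proof.
move=> cx; rewrite /jet.
have -> : to_Cinf k (fun y => F (x, y)) \o chart_inv d =
    Fhat \o (fun v => row_mx (chart_map c x) v).
  apply/funext => v; rewrite /= to_CinfE; last exact: smooth_slice_r.
  by rewrite /Fhat /= /prod_inv row_mxKl row_mxKr chart_mapK.
by rewrite (kpartials_reindex _ (row_mx_basis_r _)).
Qed.

Lemma jet_slice_l s x y : chart_dom d y ->
  jet c s x (to_Cinf k (fun x => F (x, y))) =
  kpar (map (@lshift _ _) s) Fhat (row_mx (chart_map c x) (chart_map d y)).
Proof.
move=> dy; rewrite /jet.
have -> : to_Cinf k (fun x => F (x, y)) \o chart_inv c =
    Fhat \o (fun u => row_mx u (chart_map d y)).
  apply/funext => v; rewrite /= to_CinfE; last exact: smooth_slice_l.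
  by rewrite /Fhat /= /prod_inv row_mxKl row_mxKr chart_mapK.
by rewrite (kpartials_reindex _ (row_mx_basis_l _)).
Qed.

Variables (e1 : M) (e2 : N).
Hypotheses (ce : chart_dom c e1) (de : chart_dom d e2).

Section RightJets.
Variables (T : dist_at k e2) (l : seq (K * seq 'I_(mdim N))).
Hypothesis El : forall f, T f = \sum_(p <- l) p.1 * jet d p.2 e2 f.

Let G (p : K * seq 'I_(mdim N)) (u : 'rV[R]_(mdim M)) :=
  (kpar (map (@rshift (mdim M) (mdim N)) p.2) Fhat \o
     (fun u => row_mx u (chart_map d e2))) u.

Let sG (p : K * seq 'I_(mdim N)) : ksmooth_on k (chart_img c) (G p).
Proof.
have := ksmooth_reindex (row_mx_basis_l (chart_map d e2)) (@row_mxl_continuous _ _ _ _)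
  (ksmooth_kpartials (map (@rshift (mdim M) (mdim N)) p.2) hat_smooth).
apply: ksmooth_onS => u cu /=; rewrite prod_imgE; split=> //.
exact: chart_img_map.
Qed.

Let valE u : chart_img c u ->
  T (to_Cinf k (fun y => F (chart_inv c u, y))) = \sum_(p <- l) p.1 * G p u.
Proof.
move=> /chart_imgP[cu cuK]; rewrite El; apply: eq_bigr => p _.
by rewrite jet_slice_r// cuK.
Qed.

(** Writing T as a combination of jets turns the parameter integral into a
    combination of partial derivatives of F in the second variables, restricted
    to a slice. *)
Lemma ksmooth_param_r : ksmooth_on k (chart_img c)
  ((fun x => T (to_Cinf k (fun y => F (x, y)))) \o chart_inv c).
Proof.
have oc := @chart_img_open _ _ _ c.
apply: (ksmooth_on_eq oc _ (ksmooth_sum l (fun p => p.1) oc sG)) => u cu.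
by rewrite /= valE.
Qed.

(** The derivatives in x of T(F(x, .)) add letters in front of those that T
    contributes: those of T act first. *)
Lemma jet_param_r s (f : Cinf k M) :
  (forall x, f x = T (to_Cinf k (fun y => F (x, y)))) ->
  jet c s e1 f = \sum_(p <- l) p.1 *
    kpar (map (@lshift _ _) s ++ map (@rshift _ _) p.2) Fhat
      (row_mx (chart_map c e1) (chart_map d e2)).
Proof.
move=> fE; have oc := @chart_img_open _ _ _ c.
have E u : chart_img c u -> (f \o chart_inv c) u = \sum_(p <- l) p.1 * G p u.
  by move=> cu; rewrite /= fE valE.
rewrite /jet (eq_kpartials_on k s oc E (chart_img_map ce)).
rewrite (kpartials_sum l (fun p => p.1) s oc sG (chart_img_map ce)).
apply: eq_bigr => p _; congr (_ * _).
by rewrite [G p]/(_ \o _) (kpartials_reindex _ (row_mx_basis_l _)) kpartials_cat.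
Qed.

End RightJets.

Section LeftJets.
Variables (S : dist_at k e1) (l : seq (K * seq 'I_(mdim M))).
Hypothesis El : forall f, S f = \sum_(p <- l) p.1 * jet c p.2 e1 f.

Let G (p : K * seq 'I_(mdim M)) (v : 'rV[R]_(mdim N)) :=
  (kpar (map (@lshift (mdim M) (mdim N)) p.2) Fhat \o
     (fun v => row_mx (chart_map c e1) v)) v.

Let sG (p : K * seq 'I_(mdim M)) : ksmooth_on k (chart_img d) (G p).
Proof.
have := ksmooth_reindex (row_mx_basis_r (chart_map c e1)) (@row_mxr_continuous _ _ _ _)
  (ksmooth_kpartials (map (@lshift (mdim M) (mdim N)) p.2) hat_smooth).
apply: ksmooth_onS => u cu /=; rewrite prod_imgE; split=> //.
exact: chart_img_map.
Qed.

Lemma jet_param_l s (f : Cinf k N) :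
  (forall y, f y = S (to_Cinf k (fun x => F (x, y)))) ->
  jet d s e2 f = \sum_(p <- l) p.1 *
    kpar (map (@rshift _ _) s ++ map (@lshift _ _) p.2) Fhat
      (row_mx (chart_map c e1) (chart_map d e2)).
Proof.
move=> fE; have od := @chart_img_open _ _ _ d.
have E u : chart_img d u -> (f \o chart_inv d) u = \sum_(p <- l) p.1 * G p u.
  move=> du; have [dv duK] := chart_imgP du.
  rewrite /= fE El; apply: eq_bigr => p _.
  by rewrite jet_slice_l// duK.
rewrite /jet (eq_kpartials_on k s od E (chart_img_map de)).
rewrite (kpartials_sum l (fun p => p.1) s od sG (chart_img_map de)).
apply: eq_bigr => p _; congr (_ * _).
by rewrite [G p]/(_ \o _) (kpartials_reindex _ (row_mx_basis_r _)) kpartials_cat.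
Qed.

End LeftJets.

End Slices.

End Products.

Section F2.
Variables (R : realType) (K : numFieldType) (k : real_or_complex R K).
Local Notation kpar := (kpartials k).
Local Notation dpred := (@dist_at_pred R K k _).

Lemma smooth_param (M N : manifold R) (e2 : N) (T : dist_at k e2)
    (F : prod_manifold M N -> K) : smooth_fun k F ->
  smooth_fun k (fun x => T (to_Cinf k (fun y => F (x, y)))).
Proof.
move=> sF c Mc; have [d Nd de] := atlas_cover e2.
have [l El] := dist_jets T Nd de.
exact: (ksmooth_param_r Mc Nd sF de El).
Qed.

Definition swap_args (M N : manifold R) (p : prod_manifold N M) : prod_manifold M N :=
  (p.2, p.1).

Lemma smooth_swap_args (M N : manifold R) : smooth_map (@swap_args M N).
Proof. exact: smooth_pair (@smooth_snd R N M) (@smooth_fst R N M). Qed.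

Lemma smooth_param_l (M N : manifold R) (e1 : M) (S : dist_at k e1)
    (F : prod_manifold M N -> K) : smooth_fun k F ->
  smooth_fun k (fun y => S (to_Cinf k (fun x => F (x, y)))).
Proof.
move=> sF.
exact: (smooth_param S (smooth_fun_comp (@smooth_swap_args M N) sF)).
Qed.

Variables (M N : manifold R) (e1 : M) (e2 : N).
Implicit Types (S : dist_at k e1) (T : dist_at k e2).

(** The value at F of the distribution S (x) T on the product; it is given for all
    functions F in order to be used with compositions that are not bundled as
    smooth functions. *)
Definition iterated S T (F : prod_manifold M N -> K) : K :=
  S (to_Cinf k (fun x => T (to_Cinf k (fun y => F (x, y))))).

Lemma iterated_jets S T c d l1 l2 F : atlas M c -> chart_dom c e1 ->
  atlas N d -> chart_dom d e2 ->
  (forall f, S f = \sum_(p <- l1) p.1 * jet c p.2 e1 f) ->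
  (forall f, T f = \sum_(p <- l2) p.1 * jet d p.2 e2 f) ->
  smooth_fun k F ->
  iterated S T F = \sum_(p <- l1) \sum_(q <- l2) p.1 * q.1 *
    kpar (map (@lshift _ _) p.2 ++ map (@rshift _ _) q.2)
      (F \o chart_inv (prod_chart c d)) (row_mx (chart_map c e1) (chart_map d e2)).
Proof.
move=> Mc ce Nd de E1 E2 sF; rewrite /iterated E1; apply: eq_bigr => p _.
rewrite (jet_param_r Mc Nd sF ce de E2); last first.
  by move=> x; rewrite to_CinfE//; exact: smooth_param.
by rewrite mulr_sumr; apply: eq_bigr => q _; rewrite mulrA.
Qed.

(** By bilinearity this is the case of two jets, where the two sides take the
    same partial derivatives of F in different orders. *)
Lemma iteratedC S T F : smooth_fun k F ->
  iterated S T F = T (to_Cinf k (fun y => S (to_Cinf k (fun x => F (x, y))))).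
Proof.
move=> sF; have [c Mc ce] := atlas_cover e1; have [d Nd de] := atlas_cover e2.
have [l1 E1] := dist_jets S Mc ce; have [l2 E2] := dist_jets T Nd de.
rewrite (iterated_jets Mc ce Nd de E1 E2 sF) E2 exchange_big/=; apply: eq_bigr => q _.
rewrite (jet_param_l Mc Nd sF ce de E1); last first.
  by move=> y; rewrite to_CinfE//; exact: smooth_param_l.
rewrite mulr_sumr; apply: eq_bigr => p _; rewrite mulrA [p.1 * _]mulrC; congr (_ * _).
have ab : chart_img (prod_chart c d) (row_mx (chart_map c e1) (chart_map d e2)).
  by rewrite prod_imgE; split; exact: chart_img_map.
apply: (kpartials_perm (@chart_img_open _ _ _ (prod_chart c d)) (hat_smooth Mc Nd sF) _ ab).
by rewrite perm_catC.
Qed.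

Lemma iterated_pred S T :
  ((fun F : Cinf k (prod_manifold M N) => iterated S T F) :
     Cinf k (prod_manifold M N) -> K^o) \in dpred ((e1, e2) : prod_manifold M N).
Proof.
have [c Mc ce] := atlas_cover e1; have [d Nd de] := atlas_cover e2.
have [l1 E1] := dist_jets S Mc ce; have [l2 E2] := dist_jets T Nd de.
apply: (@jets_dist_pred R K k (prod_manifold M N) (prod_chart c d) _ [seq (p.1 * q.1,
  map (@lshift (mdim M) (mdim N)) p.2 ++ map (@rshift (mdim M) (mdim N)) q.2)
  | p <- l1, q <- l2]) => //; first exact: prod_chart_atlas.
move=> F; rewrite (iterated_jets Mc ce Nd de E1 E2 (Cinf_smooth F)).
by rewrite big_allpairs_dep.
Qed.

Definition F2_fun S T : dist_at k ((e1, e2) : prod_manifold M N) :=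
  to_dist k ((e1, e2) : prod_manifold M N) (fun F => iterated S T F).

Lemma F2_funE S T F : F2_fun S T F = iterated S T F.
Proof. exact: to_distE (iterated_pred S T). Qed.

Lemma iterated_linr S a T T' F : smooth_fun k F ->
  iterated S (a *: T + T') F = a * iterated S T F + iterated S T' F.
Proof.
move=> sF; have sP (Q : dist_at k e2) := smooth_param Q sF.
exact: etrans (congr1 (fun f : Cinf k M => S f) (to_Cinf_lin a (sP T) (sP T')))
  (dist_linear S a _ _).
Qed.

Lemma F2_bilinear : bilinear_for *:%R *:%R F2_fun.
Proof.
split=> [T a S S'|S a T T']; apply: dist_ext => F.
  exact: etrans (F2_funE (a *: S + S') T F)
    (esym (congr2 (fun x y => a * x + y) (F2_funE S T F) (F2_funE S' T F))).
exact: etrans (F2_funE S (a *: T + T') F) (etrans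
  (iterated_linr S a T T' (Cinf_smooth F))
  (esym (congr2 (fun x y => a * x + y) (F2_funE S T F) (F2_funE S T' F)))).
Qed.

Lemma F2_linear : linear (@F2 R K k M N e1 e2).
Proof. exact: (tens_lift_is_linear F2_bilinear). Qed.

Lemma F2_tens S T F : F2 (S ⊗ T) F = iterated S T F.
Proof. by rewrite -F2_funE; congr dist_fun; exact: (tens_lift_tens F2_bilinear). Qed.

Lemma dist_sum (P : manifold R) (e : P) (I : Type) (r : seq I) (F : I -> dist_at k e) f :
  (\sum_(i <- r) F i : dist_at k e) f = \sum_(i <- r) F i f.
Proof.
elim: r => [|i r IHr]; first by rewrite !big_nil.
by rewrite !big_cons -IHr.
Qed.

Lemma F2E (t : dist_at k e1 ⊗ dist_at k e2) F :
  F2 t F = \sum_(p <- repr t) iterated p.1 p.2 F.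
Proof.
by rewrite /F2 /tens_lift /eval_sum dist_sum; apply: eq_bigr => p _; exact: F2_funE.
Qed.

End F2.

(** * The push-forward along the diagonal *)

Section Diagonal.
Variables (R : realType) (K : numFieldType) (k : real_or_complex R K).
Variables (M : manifold R) (e : M).

Lemma smooth_diag : smooth_map (@diag R M).
Proof. exact: smooth_pair (@smooth_map_id R M) (@smooth_map_id R M). Qed.

Definition diag_push (a : dist_at k e) : dist_at k (diag e) :=
  Defs.pushforward (diag e) (@diag R M) a.

Lemma diag_pushE (a : dist_at k e) F : diag_push a F = a (to_Cinf k (F \o @diag R M)).
Proof. exact: pushforwardE smooth_diag erefl a F. Qed.

(** For a jet of word s, the Leibniz rule gives diag_* J_s as the sum of
    F2 (J_s1 (x) J_s2) over the splittings (s1, s2) of s. *)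
Lemma diag_push_image (a : dist_at k e) :
  exists t : dist_at k e ⊗ dist_at k e, F2 t = diag_push a.
Proof.
have [c Mc ce] := atlas_cover e; have [l El] := dist_jets a Mc ce.
pose J s : dist_at k e := to_dist k e (jet c s e).
have JE s f : J s f = jet c s e f by rewrite /J to_distE//; exact: jet_dist_pred.
exists (\sum_(p <- l) \sum_(q <- splits p.2) p.1 *: (J q.1 ⊗ J q.2)).
have F2sum (I : Type) (r : seq I) G : F2 (\sum_(i <- r) G i) =
    \sum_(i <- r) F2 (G i) :> dist_at k (diag e).
  exact: (lin_map_sum (@F2_linear R K k M M e e)).
have F2Z b t : F2 (b *: t) = b *: F2 t :> dist_at k (diag e).
  exact: (lin_mapZ (@F2_linear R K k M M e e)).
apply: dist_ext => F; rewrite diag_pushE El F2sum dist_sum; apply: eq_bigr => p _.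
rewrite F2sum dist_sum.
have oW := @chart_img_open _ _ _ (prod_chart c c).
have sF := hat_smooth Mc Mc (Cinf_smooth F).
have We : chart_img (prod_chart c c) (diag_mx2 (chart_map c e)).
  by rewrite prod_imgE; split; exact: chart_img_map.
have -> : jet c p.2 e (to_Cinf k (F \o @diag R M)) =
   kpartials k p.2 ((F \o chart_inv (prod_chart c c)) \o @diag_mx2 R _) (chart_map c e).
  rewrite /jet; congr (kpartials k p.2 _ _); apply/funext => u /=.
  rewrite to_CinfE; last by apply: smooth_fun_comp smooth_diag _; exact: Cinf_smooth.
  by rewrite /= /prod_inv row_mxKl row_mxKr.
rewrite (kpartials_diag _ oW sF We) mulr_sumr; apply: eq_bigr => q _.
rewrite F2Z -[p.1 *: _]addr0 dist_lin addr0.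
rewrite F2_tens (iterated_jets (l1 := [:: (1, q.1)]) (l2 := [:: (1, q.2)]) Mc ce Mc ce).
- by rewrite !big_seq1 !mul1r.
- by move=> f; rewrite big_seq1 mul1r JE.
- by move=> f; rewrite big_seq1 mul1r JE.
- exact: Cinf_smooth.
Qed.

(** As diag_* a lies in the range of F2, the preimage picked by Delta is a true
    one. *)
Lemma F2_Delta (a : dist_at k e) F :
  F2 (dist_Delta k e a) F = a (to_Cinf k (F \o @diag R M)).
Proof.
rewrite -diag_pushE; congr dist_fun; rewrite /dist_Delta /F2_inv.
have [t Et] := diag_push_image a.
have := @xgetPex _ 0 [set t | F2 t = diag_push a] (ex_intro _ t Et).
exact.
Qed.

End Diagonal.

(** * Separation of tensors by pairings *)

Section TensorPairing.
Variable K : fieldType.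

Lemma tens_linl (V W : lmodType K) a (v v' : V) (w : W) :
  (a *: v + v') ⊗ w = a *: (v ⊗ w) + v' ⊗ w.
Proof. exact: (tens_bilinear V W).1. Qed.

Lemma tens_linr (V W : lmodType K) a (v : V) (w w' : W) :
  v ⊗ (a *: w + w') = a *: (v ⊗ w) + v ⊗ w'.
Proof. exact: (tens_bilinear V W).2. Qed.

Section Pair.
Variables (V W : lmodType K) (f : V -> K) (g : W -> K).

Definition pairing (t : V ⊗ W) : K := tens_lift (fun v w => f v * g w : K^o) t.

Lemma pairingE t : pairing t = \sum_(p <- repr t) f p.1 * g p.2.
Proof. by []. Qed.

Hypotheses (lf : scalar f) (lg : scalar g).

Lemma pairing_bilinear : bilinear_for *:%R *:%R (fun v w => f v * g w : K^o).
Proof.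
split=> [w a v v'|v a w w'] /=; first by rewrite lf mulrDl -mulrA.
by rewrite lg mulrDr mulrCA.
Qed.

Lemma pairing_scalar : scalar pairing.
Proof. exact: (tens_lift_is_linear pairing_bilinear). Qed.

Lemma pairing_tens v w : pairing (v ⊗ w) = f v * g w.
Proof. exact: (tens_lift_tens pairing_bilinear). Qed.

Lemma pairing_sum (I : Type) (r : seq I) F :
  pairing (\sum_(i <- r) F i) = \sum_(i <- r) pairing (F i).
Proof. exact: (lin_map_sum (W := K^o) pairing_scalar). Qed.

Lemma pairing_tens_map (V' W' : lmodType K) (phi : V' -> V) (psi : W' -> W) t :
  pairing (tens_map phi psi t) = \sum_(p <- repr t) f (phi p.1) * g (psi p.2).
Proof.
rewrite /tens_map /tens_lift /eval_sum pairing_sum.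
by apply: eq_bigr => p _; rewrite pairing_tens.
Qed.

End Pair.

Section Separation.
Variables (V W : lmodType K) (I J : Type) (phi : I -> V -> K) (psi : J -> W -> K).
Hypotheses (lphi : forall i, scalar (phi i)) (lpsi : forall j, scalar (psi j)).
Hypotheses (phi_sep : forall v, (forall i, phi i v = 0) -> v = 0)
  (psi_sep : forall w, (forall j, psi j w = 0) -> w = 0).

Let scalar_sum (A : lmodType K) (f : A -> K) (lf : scalar f) (L : Type)
  (r : seq L) (F : L -> A) : f (\sum_(i <- r) F i) = \sum_(i <- r) f (F i).
Proof. exact: (lin_map_sum (W := K^o) lf). Qed.

(** By induction on the number of terms of the sum.  If w != 0, pick a functional
    psi j0 with psi j0 w != 0.  The hypothesis for psi j0 expresses v as a
    combination of the other left factors, and substituting it distributes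
    v (x) w over the other terms, without changing the sum of the pairings. *)
Lemma tens_sum_separated (s : seq (V * W)) :
  (forall i j, \sum_(p <- s) phi i p.1 * psi j p.2 = 0) ->
  \sum_(p <- s) p.1 ⊗ p.2 = 0.
Proof.
elim: {s}(size s) {-2}s (erefl (size s)) => [|n IHn] [|[v w] s] //=.
  by move=> _ _; rewrite big_nil.
move=> [sn] H; rewrite big_cons /=.
have [w0|] := pselect (forall j, psi j w = 0).
  rewrite (psi_sep w0); have -> : v ⊗ (0 : W) = 0.
    by have := tens_linr (-1) v (0 : W) 0; rewrite scaler0 addr0 scaleN1r addNr.
  rewrite add0r; apply: IHn => // i j.
  by have := H i j; rewrite big_cons /= w0 mulr0 add0r.
move=> /existsNP[j0 /eqP wj0].
pose c (p : V * W) := psi j0 p.2 / psi j0 w.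
have vE : v = - \sum_(p <- s) c p *: p.1.
  apply/eqP; rewrite -subr_eq0 opprK; apply/eqP; apply: phi_sep => i.
  have lp : linear (phi i : V -> K^o) by exact: lphi.
  rewrite (lin_mapD lp) (scalar_sum (lphi i)); apply: (mulIf wj0); rewrite mul0r mulrDl.
  rewrite -[RHS](H i j0) big_cons /=; congr (_ + _).
  rewrite mulr_suml; apply: eq_bigr => p _.
  by rewrite (lin_mapZ lp) [_ *: _]mulrC -mulrA divfK.
pose s' := [seq (p.1, - c p *: w + p.2) | p <- s].
have -> : v ⊗ w + \sum_(p <- s) p.1 ⊗ p.2 = \sum_(p <- s') p.1 ⊗ p.2.
  rewrite big_map /=; under [RHS]eq_bigr do rewrite tens_linr.
  rewrite big_split /=; congr (_ + _).
  have lw : linear (fun u : V => u ⊗ w) by move=> a u u'; exact: tens_linl.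
  rewrite {1}vE (lin_mapN lw) (lin_map_sum lw) -sumrN; apply: eq_bigr => p _.
  by rewrite (lin_mapZ lw) scaleNr.
apply: IHn; first by rewrite size_map.
move=> i j; rewrite big_map /=.
under eq_bigr do rewrite lpsi mulrDr.
rewrite big_split /=.
rewrite -[RHS](H i j) big_cons /=; congr (_ + _).
have lp : linear (phi i : V -> K^o) by exact: lphi.
rewrite [in RHS]vE (lin_mapN lp) (scalar_sum (lphi i)) mulNr mulr_suml -sumrN.
apply: eq_bigr => p _; rewrite (lin_mapZ lp) /GRing.scale /=; ring.
Qed.

Lemma tensor_separated (t t' : V ⊗ W) :
  (forall i j, pairing (phi i) (psi j) t = pairing (phi i) (psi j) t') -> t = t'.
Proof.
move=> H; apply/eqP; rewrite -subr_eq0; apply/eqP.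
rewrite [LHS]tensorE; apply: tens_sum_separated => i j.
rewrite -pairingE addrC -scaleN1r (pairing_scalar (lphi i) (lpsi j)) H.
by rewrite mulN1r addNr.
Qed.

End Separation.

Section TensorMaps.
Variables U V W A B C D : lmodType K.

Lemma tens_assoc_bilinear : bilinear_for *:%R *:%R
  (fun (t : U ⊗ V) (w : W) => tens_lift (fun u v => u ⊗ (v ⊗ w)) t).
Proof.
split=> [w a t t'|t a w w'] /=.
  apply: tens_lift_is_linear; split=> [v b u u'|u b v v'] /=; first exact: tens_linl.
  by rewrite tens_linl tens_linr.
rewrite /tens_lift /eval_sum scaler_sumr -big_split; apply: eq_bigr => p _ /=.
by rewrite !tens_linr.
Qed.

Let swap_inner_bilinear (a : A) (b : B) : bilinear_for *:%R *:%R
  (fun (c : C) (d : D) => (a ⊗ c) ⊗ (b ⊗ d)).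
Proof.
split=> [d x c c'|c x d d'] /=; first by rewrite tens_linr tens_linl.
by rewrite !tens_linr.
Qed.

Lemma tens_swap_mid_bilinear : bilinear_for *:%R *:%R
  (fun (s : A ⊗ B) (t : C ⊗ D) =>
    tens_lift (fun a b => tens_lift (fun c d => (a ⊗ c) ⊗ (b ⊗ d)) t) s).
Proof.
split=> [t x s s'|s x t t'] /=.
  apply: tens_lift_is_linear; split=> [b y a a'|a y b b'] /=;
    rewrite /tens_lift /eval_sum scaler_sumr -big_split; apply: eq_bigr => p _ /=.
    by rewrite !tens_linl.
  by rewrite tens_linl tens_linr.
rewrite [LHS]/tens_lift /eval_sum scaler_sumr -big_split; apply: eq_bigr => p _ /=.
exact: (tens_lift_is_linear (swap_inner_bilinear p.1 p.2)).
Qed.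

End TensorMaps.

End TensorPairing.

(** * The coalgebra of distributions at a point, and the rack product *)

Section PointCoalgebra.
Variables (R : realType) (K : numFieldType) (k : real_or_complex R K).

Lemma dist_lin_sum (M : manifold R) (e : M) (T : dist_at k e) (I : Type) (r : seq I)
    (F : I -> Cinf k M) : T (\sum_(i <- r) F i) = \sum_(i <- r) T (F i).
Proof. exact: (lin_map_sum (W := K^o) (dist_linear T)). Qed.

Lemma Cinf_sum (M : manifold R) (I : Type) (r : seq I) (F : I -> Cinf k M) x :
  (\sum_(i <- r) F i : Cinf k M) x = \sum_(i <- r) F i x.
Proof.
elim: r => [|i r IHr]; first by rewrite !big_nil.
by rewrite !big_cons -IHr.
Qed.

Lemma eq_to_Cinf (M : manifold R) (f g : M -> K) : f =1 g -> to_Cinf k f = to_Cinf k g.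
Proof. by move=> /funext ->. Qed.

Lemma eq_dist (M : manifold R) (e : M) (T : dist_at k e) (f g : M -> K) :
  f =1 g -> T (to_Cinf k f) = T (to_Cinf k g).
Proof. by move=> /funext ->. Qed.

Lemma dist_to_Cinf (M : manifold R) (e : M) (T : dist_at k e) (f : M -> K)
    (g : Cinf k M) : f =1 g -> T (to_Cinf k f) = T g.
Proof. by move=> fg; rewrite (to_Cinf_id fg). Qed.

Lemma eq_iterated (M N : manifold R) (e1 : M) (e2 : N) (S : dist_at k e1)
    (T : dist_at k e2) (F G : prod_manifold M N -> K) :
  F =1 G -> iterated S T F = iterated S T G.
Proof. by move=> /funext ->. Qed.

Variables (M : manifold R) (e : M).
Local Notation D := (dist_at k e).
Local Notation Delta := (dist_Delta k e).
Local Notation eps := (@dist_eps R K k M e).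
Local Notation one := (@dirac_at R K k M e).

Definition ev (f : Cinf k M) (T : D) : K := T f.

Lemma ev_scalar f : scalar (ev f).
Proof. by []. Qed.

Lemma ev_sep (T : D) : (forall f, ev f T = 0) -> T = 0.
Proof. by move=> H; apply: dist_ext => f; exact: H. Qed.

Definition pair2 (f g : Cinf k M) : D ⊗ D -> K := pairing (ev f) (ev g).

Lemma pair2_scalar f g : scalar (pair2 f g).
Proof. exact: pairing_scalar (ev_scalar f) (ev_scalar g). Qed.

Lemma tensor2_ext (t t' : D ⊗ D) : (forall f g, pair2 f g t = pair2 f g t') -> t = t'.
Proof. exact: (tensor_separated ev_scalar ev_scalar ev_sep ev_sep). Qed.

Lemma pair2_sep (t : D ⊗ D) :
  (forall fg : Cinf k M * Cinf k M, pair2 fg.1 fg.2 t = 0) -> t = 0.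
Proof.
move=> H; apply: tensor2_ext => f g; rewrite (H (f, g)).
by rewrite (lin_map0 (W := K^o) (pair2_scalar f g)).
Qed.

Lemma tensor3_ext (t t' : D ⊗ (D ⊗ D)) :
  (forall f g h, pairing (ev f) (pair2 g h) t = pairing (ev f) (pair2 g h) t') -> t = t'.
Proof.
move=> H; apply: (tensor_separated ev_scalar
  (psi := fun gh : Cinf k M * Cinf k M => pair2 gh.1 gh.2) _ ev_sep pair2_sep).
  by move=> gh; exact: pair2_scalar.
by move=> f gh; exact: H.
Qed.

Definition tensor_fun (f g : Cinf k M) (p : prod_manifold M M) : K := f p.1 * g p.2.

Lemma smooth_tensor_fun f g : smooth_fun k (tensor_fun f g).
Proof.
apply: smooth_fun_mul.
  exact: (smooth_fun_comp (@smooth_fst R M M) (Cinf_smooth f)).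
exact: (smooth_fun_comp (@smooth_snd R M M) (Cinf_smooth g)).
Qed.

Lemma iterated_tensor_fun (S T : D) f g : iterated S T (tensor_fun f g) = S f * T g.
Proof.
have E x : T (to_Cinf k (fun y => tensor_fun f g (x, y))) = f x * T g.
  have -> : to_Cinf k (fun y => tensor_fun f g (x, y)) = f x *: g + 0.
    by apply: to_Cinf_id => y; rewrite Cinf_lin Cinf0 addr0.
  by rewrite dist_linear (scalar0 (dist_linear T)) addr0.
rewrite /iterated (eq_to_Cinf E).
have -> : to_Cinf k (fun x => f x * T g) = T g *: f + 0.
  by apply: to_Cinf_id => y; rewrite Cinf_lin Cinf0 addr0 mulrC.
by rewrite dist_linear (scalar0 (dist_linear S)) addr0 mulrC.
Qed.

(** Restricting f (x) g to the diagonal gives the product f g: the comultiplication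
    is dual to the multiplication of functions. *)
Lemma pair2_Delta f g (a : D) : pair2 f g (Delta a) = a (Cmul f g).
Proof.
have := F2_Delta a (to_Cinf k (tensor_fun f g)).
have -> : to_Cinf k (to_Cinf k (tensor_fun f g) \o @diag R M) = Cmul f g.
  apply: to_Cinf_id => x /=; rewrite to_CinfE; last exact: smooth_tensor_fun.
  by rewrite CmulE.
move=> <-; rewrite F2E /pair2 pairingE; apply: eq_bigr => p _.
rewrite -iterated_tensor_fun; apply: eq_iterated => x.
by rewrite to_CinfE//; exact: smooth_tensor_fun.
Qed.

Lemma iterated_Delta (a : D) (G : prod_manifold M M -> K) : smooth_fun k G ->
  \sum_(p <- repr (Delta a)) iterated p.1 p.2 G = a (to_Cinf k (fun x => G (x, x))).
Proof.
move=> sG; have := F2_Delta a (to_Cinf k G); rewrite F2E.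
have E : to_Cinf k G =1 G by exact: to_CinfE.
rewrite (eq_to_Cinf (g := fun x => G (x, x))) => [<-|x]; last by rewrite /= E.
by apply: eq_bigr => p _; apply: eq_iterated => x; rewrite E.
Qed.

(** Delta chooses preimages, so linearity is not formal.  It holds since a tensor t
    is determined by its pairings, and these are values of F2 t: thus F2 is
    injective. *)
Lemma Delta_is_linear : linear Delta.
Proof.
move=> a S T; apply: tensor2_ext => f g.
by rewrite pair2_scalar !pair2_Delta dist_lin.
Qed.

Lemma Cmul1r (f : Cinf k M) : Cmul f (to_Cinf k (fun=> 1)) = f.
Proof.
apply: Cinf_ext => x; rewrite CmulE to_CinfE ?mulr1//; exact: smooth_fun_cst.
Qed.

Lemma Cmul1l (f : Cinf k M) : Cmul (to_Cinf k (fun=> 1)) f = f.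
Proof.
apply: Cinf_ext => x; rewrite CmulE to_CinfE ?mul1r//; exact: smooth_fun_cst.
Qed.

Lemma CmulA (f g h : Cinf k M) : Cmul f (Cmul g h) = Cmul (Cmul f g) h.
Proof.
apply: Cinf_ext => x.
apply: etrans (CmulE f (Cmul g h) x) _.
apply: etrans (congr1 ( *%R (f x)) (CmulE g h x)) _.
apply: etrans (mulrA _ _ _) _.
exact: esym (etrans (CmulE (Cmul f g) h x) (congr1 ( *%R^~ (h x)) (CmulE f g x))).
Qed.

(** Paired with f, g and h, both sides are a(f g h). *)
Lemma Delta_coassociative (a : D) :
  tens_assoc (tens_map Delta id (Delta a)) = tens_map id Delta (Delta a).
Proof.
apply: tensor3_ext => f g h.
have lfgh : scalar (pairing (ev f) (pair2 g h)).
  exact: pairing_scalar (ev_scalar f) (pair2_scalar g h).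
rewrite [RHS](pairing_tens_map (ev_scalar f) (pair2_scalar g h)).
transitivity (a (Cmul f (Cmul g h))); last first.
  rewrite -pair2_Delta /pair2 pairingE; apply: eq_bigr => p _.
  by congr (_ * _); rewrite [RHS]pair2_Delta.
rewrite CmulA -pair2_Delta [RHS]pairingE.
rewrite /tens_map /tens_lift /eval_sum /tens_assoc.
rewrite (lin_map_sum (tens_lift_is_linear (@tens_assoc_bilinear K D D D))).
rewrite (lin_map_sum (W := K^o) lfgh); apply: eq_bigr => p _.
rewrite (tens_lift_tens (@tens_assoc_bilinear K D D D)).
rewrite {1}/tens_lift /eval_sum (lin_map_sum (W := K^o) lfgh).
have -> : ev (Cmul f g) p.1 = pair2 f g (Delta p.1) by rewrite pair2_Delta.
rewrite [pair2 f g _]pairingE mulr_suml; apply: eq_bigr => q _.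
rewrite (pairing_tens (ev_scalar f) (pair2_scalar g h)).
by rewrite /pair2 (pairing_tens (ev_scalar g) (ev_scalar h)) mulrA.
Qed.

Lemma Delta_counital_l (a : D) : tens_lift (fun x y => eps x *: y) (Delta a) = a.
Proof.
apply: dist_ext => f.
rewrite /tens_lift /eval_sum dist_sum -[in RHS](Cmul1l f) -pair2_Delta.
rewrite /pair2 pairingE; apply: eq_bigr => p _.
by rewrite -[_ *: _]addr0 dist_lin addr0.
Qed.

Lemma Delta_counital_r (a : D) : tens_lift (fun x y => eps y *: x) (Delta a) = a.
Proof.
apply: dist_ext => f.
rewrite /tens_lift /eval_sum dist_sum -[in RHS](Cmul1r f) -pair2_Delta.
rewrite /pair2 pairingE; apply: eq_bigr => p _.
by rewrite -[_ *: _]addr0 dist_lin addr0 mulrC.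
Qed.

Lemma point_coalgebra : is_coalgebra Delta eps.
Proof.
split.
- exact: Delta_is_linear.
- by move=> a S T; rewrite /dist_eps dist_lin.
- exact: Delta_coassociative.
- exact: Delta_counital_l.
- exact: Delta_counital_r.
Qed.

Section Rack.
Variables (m : prod_manifold M M -> M) (rack : lie_rack e m).
Local Notation mu := (@dist_mu R K k M e m).

Let sm : smooth_map m := rack_smooth rack.
Let mee : m (e, e) = e := rack_unit_r rack e.

Lemma smooth_rack_fun (f : Cinf k M) : smooth_fun k (f \o m).
Proof. exact: (smooth_fun_comp sm (Cinf_smooth f)). Qed.

Lemma mu_is_linear : linear mu.
Proof.
move=> a s t; rewrite /dist_mu (@F2_linear R K k M M e e).
exact: (pushforward_linear sm mee).
Qed.

(** The rack product in terms of functions: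
    (S |> T)(f) = S(x |-> T(y |-> f(x |> y))). *)
Lemma muE (S T : D) f : mu (S ⊗ T) f = iterated S T (f \o m).
Proof.
rewrite /dist_mu (pushforwardE sm mee) F2_tens; apply: eq_iterated => p.
by rewrite to_CinfE//; exact: smooth_rack_fun.
Qed.

Lemma mu_sumE (t : D ⊗ D) f :
  mu t f = \sum_(p <- repr t) iterated p.1 p.2 (f \o m).
Proof.
rewrite {1}[t]tensorE (lin_map_sum mu_is_linear) dist_sum.
by apply: eq_bigr => p _; exact: muE.
Qed.

Lemma mu_unit_l (a : D) : mu (one ⊗ a) = a.
Proof.
apply: dist_ext => f; rewrite muE /iterated dirac_atE to_CinfE; last first.
  exact: (smooth_param a (smooth_rack_fun f)).
apply: dist_to_Cinf => y /=.
by rewrite (rack_unit_l rack).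
Qed.

(** Since x |> e = e, the inner function is the constant f(e). *)
Lemma mu_unit_r (a : D) : mu (a ⊗ one) = eps a *: one.
Proof.
apply: dist_ext => f; rewrite muE /iterated.
rewrite (eq_to_Cinf (g := fun=> f e)) => [|x]; last first.
  rewrite dirac_atE to_CinfE /= ?(rack_unit_r rack)//.
  exact: (smooth_slice_r x (smooth_rack_fun f)).
rewrite dist_cst -[_ *: _]addr0 dist_lin addr0 dirac_atE mulrC.
by [].
Qed.

(** Both sides integrate the constant function 1. *)
Lemma mu_eps (t : D ⊗ D) : eps (mu t) = tens_eps eps eps t.
Proof.
rewrite /dist_eps mu_sumE /tens_eps /tens_lift /eval_sum; apply: eq_bigr => p _.
rewrite -iterated_tensor_fun; apply: eq_iterated => x.
have c1 := @smooth_fun_cst R K k M 1.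
by rewrite /tensor_fun /= !to_CinfE// mulr1.
Qed.

(** Both sides applied to f are a(x |-> G(x, x)), with
    G(x, x') = b(y |-> c(z |-> f((x |> y) |> (x' |> z)))): the left one by the
    self-distributivity of the rack, the right one by the definition of Delta
    and an exchange of b with the second part of a. *)
Lemma mu_self_distr (a b c : D) : mu (a ⊗ mu (b ⊗ c)) =
  tens_lift (fun a1 a2 => mu (mu (a1 ⊗ b) ⊗ mu (a2 ⊗ c))) (Delta a).
Proof.
apply: dist_ext => f.
pose MM := prod_manifold M M.
pose Phi (q : prod_manifold (prod_manifold MM M) M) : M :=
  m (m (q.1.1.1, q.1.2), m (q.1.1.2, q.2)).
have sPhi : smooth_map Phi.
  have s1 := @smooth_fst R (prod_manifold MM M) M.
  have s11 := smooth_map_comp s1 (@smooth_fst R MM M).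
  have s12 := smooth_map_comp s1 (@smooth_snd R MM M).
  have s111 := smooth_map_comp s11 (@smooth_fst R M M).
  have s112 := smooth_map_comp s11 (@smooth_snd R M M).
  have s2 := @smooth_snd R (prod_manifold MM M) M.
  apply: (smooth_map_comp _ sm).
  apply: (smooth_pair (smooth_map_comp (smooth_pair s111 s12) sm)
    (smooth_map_comp (smooth_pair s112 s2) sm)).
pose H3 (q : prod_manifold MM M) : K := c (to_Cinf k (fun z => f (Phi (q, z)))).
have sH3 : smooth_fun k H3.
  exact: (smooth_param c (smooth_fun_comp sPhi (Cinf_smooth f))).
pose G (x : MM) : K := b (to_Cinf k (fun y => H3 (x, y))).
have sG : smooth_fun k G by exact: (smooth_param b sH3).
have sHx x : smooth_fun k ((fun yx => H3 ((x, yx.2), yx.1)) : MM -> K).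
  apply: (smooth_fun_comp (phi := fun yx : MM => (((x, yx.2), yx.1) : prod_manifold MM M))
    _ sH3).
  apply: smooth_pair; last exact: smooth_fst.
  by apply: smooth_pair; [exact: smooth_map_cst|exact: smooth_snd].
transitivity (a (to_Cinf k (fun x => G (x, x)))).
  rewrite muE.
  rewrite /iterated.
  apply: eq_dist => x.
  have sx := smooth_slice_r x (smooth_rack_fun f).
  rewrite muE /iterated /G; apply: eq_dist => y.
  rewrite /H3; apply: eq_dist => z.
  by rewrite /= to_CinfE//= (rack_self_distr rack).
rewrite -(iterated_Delta a sG) /tens_lift /eval_sum dist_sum.
apply: eq_bigr => p _; rewrite muE /iterated.
have sX (x : M) : smooth_fun k (fun y : M => f (m (x, y))).
  exact: (smooth_slice_r x (smooth_rack_fun f)).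
have sY : smooth_fun k (fun x : M => mu (p.2 ⊗ c) (to_Cinf k (fun y => (f \o m) (x, y)))).
  exact: (smooth_param (mu (p.2 ⊗ c)) (smooth_rack_fun f)).
rewrite muE /iterated; apply: eq_dist => x.
(* On the right the second part of a acts inside b; G has them the other way round. *)
transitivity (iterated b p.2 (fun yx => H3 ((x, yx.2), yx.1))).
  exact: esym (iteratedC b p.2 (sHx x)).
rewrite /iterated; apply: eq_dist => y.
apply: etrans _ (esym (etrans (to_CinfE sY (m (x, y))) (muE p.2 c _))).
rewrite /iterated; apply: eq_dist => x'.
apply: eq_dist => z.
exact: esym (to_CinfE (sX (m (x, y))) (m (x', z))).
Qed.

(** Paired with f (x) g, the left-hand side is mu(S (x) T)(f g), and
    (f g) o m = (f o m) (g o m).  The product under T is removed by Delta T, and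
    then that under S by Delta S: with A h r = (x |-> r(y |-> h(x |> y))), the
    common value is the sum over r in Delta T of S(A f r1 . A g r2). *)
Lemma mu_Delta (t : D ⊗ D) : Delta (mu t) = tens_map mu mu (tens_Delta Delta Delta t).
Proof.
apply: tensor2_ext => f g.
pose Lf (s : D ⊗ D) := mu s f; pose Lg (s : D ⊗ D) := mu s g.
have lLf : scalar Lf by move=> a s s'; rewrite /Lf mu_is_linear dist_lin.
have lLg : scalar Lg by move=> a s s'; rewrite /Lg mu_is_linear dist_lin.
have lL := pairing_scalar lLf lLg.
rewrite [LHS]pair2_Delta mu_sumE.
rewrite [RHS](pairing_tens_map (ev_scalar f) (ev_scalar g)).
transitivity (pairing Lf Lg (tens_Delta Delta Delta t)); last by [].
rewrite /tens_Delta /tens_map /tens_lift /eval_sum /tens_swap_mid.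
rewrite (lin_map_sum (tens_lift_is_linear (@tens_swap_mid_bilinear K D D D D))).
rewrite (lin_map_sum (W := K^o) lL); apply: eq_bigr => -[S T] _ /=.
rewrite (tens_lift_tens (@tens_swap_mid_bilinear K D D D D)).
rewrite /tens_lift /eval_sum (lin_map_sum (W := K^o) lL).
under eq_bigr do rewrite (lin_map_sum (W := K^o) lL).
under eq_bigr do under eq_bigr do rewrite (pairing_tens lLf lLg) /Lf /Lg !muE.
rewrite exchange_big /=.
pose A (h : Cinf k M) (r : D) : Cinf k M :=
  to_Cinf k (fun x => r (to_Cinf k (fun y => h (m (x, y))))).
have AE h r x : A h r x = r (to_Cinf k (fun y => h (m (x, y)))).
  by rewrite to_CinfE//; exact: (smooth_param r (smooth_rack_fun h)).
transitivity (\sum_(r <- repr (Delta T)) pair2 (A f r.1) (A g r.2) (Delta S)).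
  under [RHS]eq_bigr do rewrite pair2_Delta.
  rewrite -dist_lin_sum /iterated; apply: dist_to_Cinf => x.
  apply: etrans _ (esym (Cinf_sum _ _ x)).
  transitivity (pair2 (to_Cinf k (fun y => f (m (x, y))))
    (to_Cinf k (fun y => g (m (x, y)))) (Delta T)); last first.
    rewrite [LHS]pairingE; apply: eq_bigr => r _.
    exact: esym (etrans (CmulE (A f r.1) (A g r.2) x)
      (congr2 *%R (AE f r.1 x) (AE g r.2 x))).
  rewrite pair2_Delta; apply: dist_to_Cinf => y.
  have sx h := smooth_slice_r x (smooth_rack_fun h).
  exact: etrans (CmulE f g (m (x, y))) (esym (etrans (CmulE _ _ y)
    (congr2 *%R (to_CinfE (sx f) y) (to_CinfE (sx g) y)))).
by apply: eq_bigr => r _; rewrite /pair2 pairingE.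
Qed.

End Rack.

End PointCoalgebra.

Theorem theorem3p6 (R : realType) (K : numFieldType) (k : real_or_complex R K)
    (M : manifold R) (e : M) (m : prod_manifold M M -> M) :
  lie_rack e m ->
  is_rack_bialgebra (dist_Delta k e) (dist_eps k e) (dirac_at k e)
    (dist_mu k e m).
Proof.
move=> rack; split.
- exact: point_coalgebra.
- apply: tensor2_ext => f g; rewrite pair2_Delta dirac_atE CmulE.
  by rewrite /pair2 (pairing_tens (ev_scalar f) (ev_scalar g)) /ev !dirac_atE.
- by rewrite /dist_eps dirac_atE to_CinfE//; exact: smooth_fun_cst.
- exact: mu_is_linear.
- exact: mu_Delta.
- exact: mu_eps.
- exact: mu_unit_l.
- exact: mu_unit_l.
- exact: mu_unit_r.
- exact: mu_self_distr.
Qed.
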